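(* Let $n\ge 1$ and let $\mathcal{B}_n=Q_1\cup\cdots\cup Q_n\subset\mathbb{P}^2$ be a union of $n$ distinct quadrics which are tangent to each other at one common point. Then there are meridians $a_1,\dots,a_n$ of $Q_1,\dots,Q_n$ respectively such that $\pi_1(\mathbb{P}^2\setminus\mathcal{B}_n)$ is generated by $a_1,\dots,a_n$ and admits the presentation $$\pi_1(\mathbb{P}^2\setminus \mathcal{B}_n)\simeq\big\langle a_1,a_2,\dots,a_n \;\big|\; (a_1a_2\cdots a_n)^2=e\big\rangle .$$
   Context: $\mathbb{P}^2$ is the complex projective plane. A quadric is a smooth conic (smooth plane curve of degree 2) in $\mathbb{P}^2$. ''Tangent to each other at one common point'' means that there is a point $p\in\mathbb{P}^2$ lying on all the $Q_i$ such that for all $i\ne j$ the conics $Q_i$ and $Q_j$ meet only at $p$ (so, by Bézout, with intersection multiplicity $4$ at $p$). For $n=1$, $\mathcal{B}_1$ is a single smooth conic. A meridian of an irreducible component $B$ of a curve $C\subset\mathbb{P}^2$, based at $*\in\mathbb{P}^2\setminus C$, is (the homotopy class of) a loop which follows a path $\omega$ in $\mathbb{P}^2\setminus C$ from $*$ to a point near a point $p\in B\setminus \mathrm{Sing}(C)$, turns once in the positive sense along the boundary of a small disc that meets $C$ only at $p$ and transversally, and returns to $*$ along $\omega^{-1}$. *)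

(* Defs.v *)
From HB Require Import structures.
(* [mpoly] comes first because it shadows names of the core library, and without
   its notations because they clash with those of the analysis library. *)
From mathcomp Require Import -(notations) mpoly.
From mathcomp Require Import all_boot all_order all_algebra generic_quotient.
From mathcomp Require Import all_classical all_reals all_analysis.
From mathcomp Require Import homotopy complex lra.

Set Implicit Arguments.
Unset Strict Implicit.
Unset Printing Implicit Defensive.

Import Order.TTheory GRing.Theory Num.Theory numFieldNormedType.Exports.
Local Open Scope classical_set_scope.
Local Open Scope ring_scope.
Local Open Scope quotient_scope.

Definition I01 (R : realType) : Type := set_type `[0 : R, 1]%classic.

HB.instance Definition _ (R : realType) :=
  Topological.copy (I01 R) (set_type `[0 : R, 1]%classic).

Section UnitInterval.
Variable R : realType.

Definition I01_val (t : I01 R) : R := set_val t.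

Lemma I01_bounds t : 0 <= I01_val t <= 1.
Proof. by have := set_valP t; rewrite /= in_itv. Qed.

Lemma clamp_subproof (r : R) : Num.max 0 (Num.min r 1) \in `[0 : R, 1]%classic.
Proof.
by rewrite inE /= in_itv /= le_max lexx /= ge_max ler01 ge_min lexx orbT.
Qed.

Definition clamp (r : R) : I01 R :=
  exist (fun x => x \in `[0 : R, 1]%classic) _ (clamp_subproof r).

Lemma I01_val_clamp r : I01_val (clamp r) = Num.max 0 (Num.min r 1).
Proof. by rewrite /I01_val set_valE. Qed.

Lemma I01_val_inj : injective I01_val.
Proof. by move=> s t; rewrite /I01_val !set_valE; exact: val_inj. Qed.

Lemma I01_valK r : 0 <= r <= 1 -> I01_val (clamp r) = r.
Proof. by case/andP=> r0 r1; rewrite I01_val_clamp min_l // max_r. Qed.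

Lemma clampK t : clamp (I01_val t) = t.
Proof. by apply: I01_val_inj; rewrite I01_valK // I01_bounds. Qed.

Lemma clamp_le0 r : r <= 0 -> clamp r = clamp 0.
Proof.
move=> r0; apply: I01_val_inj.
by rewrite !I01_val_clamp !min_l ?ler01 ?(le_trans r0) ?ler01 // max_l // maxxx.
Qed.

Lemma clamp_ge1 r : 1 <= r -> clamp r = clamp 1.
Proof. by move=> r1; apply: I01_val_inj; rewrite !I01_val_clamp min_r // minxx. Qed.

Lemma I01_val_continuous : continuous I01_val.
Proof. exact: initial_continuous. Qed.

Lemma clamp_continuous : continuous clamp.
Proof.
apply: (@continuous_comp_initial _ _ _ (set_val : I01 R -> R)) => x /=.
apply: (@continuous_max R R (cst 0) (fun r => Num.min r 1)).
  exact: cvg_cst.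
by apply: (@continuous_min R R id (cst 1)); [exact: cvg_id|exact: cvg_cst].
Qed.

Lemma I01_zero_neq_one : clamp 0 != clamp 1.
Proof.
apply/eqP => /(congr1 I01_val); rewrite !I01_valK ?lexx ?ler01 // => /eqP.
by rewrite eq_sym oner_eq0.
Qed.

HB.instance Definition _ := isBiPointed.Build (I01 R) I01_zero_neq_one.

Lemma I01_zeroE : (zero : I01 R) = clamp 0. Proof. by []. Qed.
Lemma I01_oneE : (one : I01 R) = clamp 1. Proof. by []. Qed.

Lemma glue_continuous (X T : topologicalType) (u : X -> R) (c : R)
    (F G : X -> T) :
  continuous u -> continuous F -> continuous G ->
  (forall x, u x = c -> F x = G x) ->
  continuous (fun x => if u x <= c then F x else G x).
Proof.
move=> cu cF cG FG x W.
have [ux|ux|ux] := ltgtP (u x) c => Wx;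
  change (\forall y \near x, W (if u y <= c then F y else G y)).
- have nF : \forall y \near x, W (F y) by apply: (cF x W).
  have nu : \forall y \near x, u y < c by apply: (cu x (fun r => r < c)); exact: lt_nbhsl.
  near=> y => /=; rewrite ltW; first by near: y.
  by near: y.
- have nG : \forall y \near x, W (G y) by apply: (cG x W).
  have nu : \forall y \near x, c < u y by apply: (cu x (fun r => c < r)); exact: lt_nbhsr.
  near=> y => /=; rewrite leNgt (_ : c < u y); first by near: y.
  by near: y.
- have nF : \forall y \near x, W (F y) by apply: (cF x W).
  have nG : \forall y \near x, W (G y) by apply: (cG x W); rewrite -FG.
  by apply: filterS2 nF nG => y ? ?; case: ifP.
Unshelve. all: by end_near. Qed.

Lemma continuous_pair (X Y Z : topologicalType) (a : X -> Y) (b : X -> Z) :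
  continuous a -> continuous b -> continuous (fun x => (a x, b x)).
Proof. by move=> ca cb x; apply: cvg_pair; [exact: ca|exact: cb]. Qed.

Lemma continuous_compT (X Y Z : topologicalType) (a : X -> Y) (b : Y -> Z) :
  continuous a -> continuous b -> continuous (fun x => b (a x)).
Proof. by move=> ca cb x; apply: continuous_comp; [exact: ca|exact: cb]. Qed.

Lemma continuous_lin (X : topologicalType) (u v a b : X -> R) :
  continuous u -> continuous v -> continuous a -> continuous b ->
  continuous (fun x => a x * u x + b x * v x).
Proof.
move=> cu cv ca cb x; apply: (@cvgD _ _ _ _ _ (a \* u) (b \* v)).
  by apply: cvgM; [exact: ca|exact: cu].
by apply: cvgM; [exact: cb|exact: cv].
Qed.

Lemma continuous_affine (X : topologicalType) (u : X -> R) (a b : R) :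
  continuous u -> continuous (fun x => a * u x + b).
Proof.
move=> cu x.
apply: (@cvgD _ _ _ _ _ (cst a \* u) (cst b)); last exact: cvg_cst.
by apply: cvgM; [exact: cvg_cst|exact: cu].
Qed.

Lemma continuous_val1 : continuous (fun st : I01 R * I01 R => I01_val st.1).
Proof.
apply: continuous_compT; last exact: I01_val_continuous.
by move=> st; exact: cvg_fst.
Qed.

Lemma continuous_val2 : continuous (fun st : I01 R * I01 R => I01_val st.2).
Proof.
apply: continuous_compT; last exact: I01_val_continuous.
by move=> st; exact: cvg_snd.
Qed.

Lemma continuous_clamp_affine (X : topologicalType) (u : X -> R) (a b : R) :
  continuous u -> continuous (fun x => clamp (a * u x + b)).
Proof.
move=> cu; apply: (continuous_compT _ clamp_continuous).
exact: continuous_affine.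
Qed.

End UnitInterval.

Section Paths.
Variables (R : realType) (T : topologicalType).
Implicit Types x y z : T.

Definition concat_fun (f g : I01 R -> T) (t : I01 R) : T :=
  if I01_val t <= 2^-1 then f (clamp (2 * I01_val t))
  else g (clamp (2 * I01_val t - 1)).

Section Concat.
Context (x y z : T).
Context (f : {path I01 R from x to y in T}).
Context (g : {path I01 R from y to z in T}).

Lemma concat_continuous : continuous (concat_fun f g).
Proof.
apply: glue_continuous; first exact: I01_val_continuous.
- apply: (continuous_compT _ (@cts_fun _ _ f)).
  rewrite (_ : (fun t => _) = fun t : I01 R => clamp (2 * I01_val t + 0)).
    exact/continuous_clamp_affine/I01_val_continuous.
  by apply/funext => t; rewrite addr0.
- apply: (continuous_compT _ (@cts_fun _ _ g)).
  exact/continuous_clamp_affine/I01_val_continuous.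
- move=> t ->; rewrite divff ?pnatr_eq0 // subrr.
  by rewrite -I01_zeroE -I01_oneE path_zero path_one.
Qed.

Lemma concat_zero : concat_fun f g zero = x.
Proof.
rewrite /concat_fun I01_zeroE I01_valK ?lexx ?ler01 // mulr0.
by rewrite invr_ge0 ler0n -I01_zeroE path_zero.
Qed.

Lemma concat_one : concat_fun f g one = z.
Proof.
rewrite /concat_fun I01_oneE I01_valK ?lexx ?ler01 //.
have -> : (1 <= 2^-1 :> R) = false by lra.
have -> : 2 * 1 - 1 = 1 :> R by lra.
by rewrite -I01_oneE path_one.
Qed.

Definition concat : {path I01 R from x to z in T} :=
  mk_path concat_continuous concat_zero concat_one.

Lemma concatE t : concat t =
  if I01_val t <= 2^-1 then f (clamp (2 * I01_val t))
  else g (clamp (2 * I01_val t - 1)).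
Proof. by []. Qed.

End Concat.

Definition rev_fun (f : I01 R -> T) (t : I01 R) : T := f (clamp (1 - I01_val t)).

Section Reverse.
Variables (x y : T) (f : {path I01 R from x to y in T}).

Lemma rev_continuous : continuous (rev_fun f).
Proof.
apply: (continuous_compT _ (@cts_fun _ _ f)).
rewrite (_ : (fun t => _) = fun t : I01 R => clamp (-1 * I01_val t + 1)).
  exact/continuous_clamp_affine/I01_val_continuous.
by apply/funext => t; rewrite mulN1r addrC.
Qed.

Lemma rev_zero : rev_fun f zero = y.
Proof.
by rewrite /rev_fun I01_zeroE I01_valK ?lexx ?ler01 // subr0 -I01_oneE path_one.
Qed.

Lemma rev_one : rev_fun f one = x.
Proof.
by rewrite /rev_fun I01_oneE I01_valK ?lexx ?ler01 // subrr -I01_zeroE path_zero.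
Qed.

Definition path_rev : {path I01 R from y to x in T} :=
  mk_path rev_continuous rev_zero rev_one.

Lemma path_revE t : path_rev t = f (clamp (1 - I01_val t)).
Proof. by []. Qed.

End Reverse.

Definition cst_path x : {path I01 R from x to x in T} := cst x.

(* Homotopy relative to the endpoints; the first coordinate of [H] is the
   deformation parameter. *)
Definition homotopic x y (f g : {path I01 R from x to y in T}) : Prop :=
  exists H : I01 R * I01 R -> T,
    [/\ continuous H,
        forall t, H (zero, t) = f t, forall t, H (one, t) = g t,
        forall s, H (s, zero) = x & forall s, H (s, one) = y].

Lemma homotopic_refl x y (f : {path I01 R from x to y in T}) : homotopic f f.
Proof.
exists (fun st => f st.2); split=> // [|s|s]; last 2 first.
- exact: path_zero.
- exact: path_one.
move=> st; apply: continuous_comp; last exact: cts_fun.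
exact: cvg_snd.
Qed.

Lemma homotopic_sym x y (f g : {path I01 R from x to y in T}) :
  homotopic f g -> homotopic g f.
Proof.
case=> H [cH H0 H1 Hx Hy].
exists (fun st => H (clamp (-1 * I01_val st.1 + 1), st.2)); split=> //=.
- apply: (continuous_compT _ cH); apply: continuous_pair.
    exact/continuous_clamp_affine/continuous_val1.
  by move=> st; exact: cvg_snd.
- move=> t; rewrite I01_zeroE I01_valK ?lexx ?ler01 // mulr0 add0r.
  by rewrite -I01_oneE.
- move=> t; rewrite I01_oneE I01_valK ?lexx ?ler01 // mulr1 addNr.
  by rewrite -I01_zeroE.
Qed.

Lemma homotopic_trans x y (f g h : {path I01 R from x to y in T}) :
  homotopic f g -> homotopic g h -> homotopic f h.
Proof.
case=> H [cH H0 H1 Hx Hy] [K [cK K0 K1 Kx Ky]].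
exists (fun st => if I01_val st.1 <= 2^-1
                  then H (clamp (2 * I01_val st.1 + 0), st.2)
                  else K (clamp (2 * I01_val st.1 + - 1), st.2)); split=> /=.
- apply: glue_continuous; first exact: continuous_val1.
  + apply: (continuous_compT _ cH); apply: continuous_pair.
      exact/continuous_clamp_affine/continuous_val1.
    by move=> st; exact: cvg_snd.
  + apply: (continuous_compT _ cK); apply: continuous_pair.
      exact/continuous_clamp_affine/continuous_val1.
    by move=> st; exact: cvg_snd.
  + move=> st ->; rewrite divff ?pnatr_eq0 // subrr addr0.
    by rewrite -I01_zeroE -I01_oneE H1 K0.
- move=> t; rewrite I01_zeroE I01_valK ?lexx ?ler01 // invr_ge0 ler0n.
  by rewrite mulr0 addr0 -I01_zeroE.
- move=> t; rewrite I01_oneE I01_valK ?lexx ?ler01 //.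
  have -> : (1 <= 2^-1 :> R) = false by lra.
  have -> : 2 * 1 + -1 = 1 :> R by lra.
  by rewrite -I01_oneE.
- by move=> s; case: ifP.
- by move=> s; case: ifP.
Qed.

Lemma homotopic_concat x y z (f f' : {path I01 R from x to y in T})
    (g g' : {path I01 R from y to z in T}) :
  homotopic f f' -> homotopic g g' -> homotopic (concat f g) (concat f' g').
Proof.
case=> H [cH H0 H1 Hx Hy] [K [cK K0 K1 Kx Ky]].
exists (fun st => if I01_val st.2 <= 2^-1
                  then H (st.1, clamp (2 * I01_val st.2 + 0))
                  else K (st.1, clamp (2 * I01_val st.2 + - 1))); split=> /=.
- apply: glue_continuous; first exact: continuous_val2.
  + apply: (continuous_compT _ cH); apply: continuous_pair.
      by move=> st; exact: cvg_fst.
    exact/continuous_clamp_affine/continuous_val2.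
  + apply: (continuous_compT _ cK); apply: continuous_pair.
      by move=> st; exact: cvg_fst.
    exact/continuous_clamp_affine/continuous_val2.
  + move=> st ->; rewrite divff ?pnatr_eq0 // subrr addr0.
    by rewrite -I01_zeroE -I01_oneE Hy Kx.
- by move=> t; rewrite addr0 H0 K0.
- by move=> t; rewrite addr0 H1 K1.
- move=> s; rewrite I01_zeroE I01_valK ?lexx ?ler01 // invr_ge0 ler0n.
  by rewrite mulr0 addr0 -I01_zeroE.
- move=> s; rewrite I01_oneE I01_valK ?lexx ?ler01 //.
  have -> : (1 <= 2^-1 :> R) = false by lra.
  have -> : 2 * 1 + -1 = 1 :> R by lra.
  by rewrite -I01_oneE.
Qed.

Lemma homotopic_rev x y (f g : {path I01 R from x to y in T}) :
  homotopic f g -> homotopic (path_rev f) (path_rev g).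
Proof.
case=> H [cH H0 H1 Hx Hy].
exists (fun st => H (st.1, clamp (-1 * I01_val st.2 + 1))); split=> /=.
- apply: (continuous_compT _ cH); apply: continuous_pair.
    by move=> st; exact: cvg_fst.
  exact/continuous_clamp_affine/continuous_val2.
- by move=> t; rewrite H0 mulN1r addrC.
- by move=> t; rewrite H1 mulN1r addrC.
- move=> s; rewrite I01_zeroE I01_valK ?lexx ?ler01 // mulr0 add0r.
  by rewrite -I01_oneE.
- move=> s; rewrite I01_oneE I01_valK ?lexx ?ler01 // mulr1 addNr.
  by rewrite -I01_zeroE.
Qed.

Lemma homotopic_reparam x y (f g : {path I01 R from x to y in T})
    (h : R -> T) (phi psi : R -> R) :
  continuous h -> continuous phi -> continuous psi ->
  phi 0 = psi 0 -> phi 1 = psi 1 ->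
  (forall t, f t = h (phi (I01_val t))) ->
  (forall t, g t = h (psi (I01_val t))) -> homotopic f g.
Proof.
move=> ch cphi cpsi e0 e1 fE gE.
exists (fun st => h ((1 - I01_val st.1) * phi (I01_val st.2) +
                     I01_val st.1 * psi (I01_val st.2))); split=> /=.
- apply: (continuous_compT _ ch); apply: continuous_lin.
  + exact: (continuous_compT (@continuous_val2 R) cphi).
  + exact: (continuous_compT (@continuous_val2 R) cpsi).
  + rewrite (_ : (fun st => _) = fun st : I01 R * I01 R => -1 * I01_val st.1 + 1).
      exact/continuous_affine/continuous_val1.
    by apply/funext => st; rewrite mulN1r addrC.
  + exact: continuous_val1.
- move=> t; rewrite fE I01_zeroE I01_valK ?lexx ?ler01 //.
  by rewrite subr0 mul1r mul0r addr0.
- move=> t; rewrite gE I01_oneE I01_valK ?lexx ?ler01 //.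
  by rewrite subrr mul1r mul0r add0r.
- move=> s; rewrite -[RHS](@path_zero _ _ _ _ f) fE I01_zeroE I01_valK ?lexx ?ler01 // -e0.
  by rewrite -mulrDl subrK mul1r.
- move=> s; rewrite -[RHS](@path_one _ _ _ _ f) fE I01_oneE I01_valK ?lexx ?ler01 // -e1.
  by rewrite -mulrDl subrK mul1r.
Qed.

Lemma lift_continuous x y (f : {path I01 R from x to y in T}) :
  continuous (fun r : R => f (clamp r)).
Proof.
by apply: continuous_compT; [exact: clamp_continuous|exact: cts_fun].
Qed.

Lemma continuous_minR (a b : R -> R) : continuous a -> continuous b ->
  continuous (fun t => Num.min (a t) (b t)).
Proof.
by move=> ca cb t; apply: (@continuous_min R R a b); [exact: ca|exact: cb].
Qed.

Lemma continuous_maxR (a b : R -> R) : continuous a -> continuous b ->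
  continuous (fun t => Num.max (a t) (b t)).
Proof.
by move=> ca cb t; apply: (@continuous_max R R a b); [exact: ca|exact: cb].
Qed.

Lemma homotopic_unit_l x y (f : {path I01 R from x to y in T}) :
  homotopic (concat (cst_path x) f) f.
Proof.
apply: (@homotopic_reparam _ _ _ _ (fun r => f (clamp r))
  (fun t => Num.max 0 (2 * t + - 1)) id).
- apply: lift_continuous.
- by apply: continuous_maxR; [exact: cst_continuous|apply: continuous_affine => ?; exact: cvg_id].
- by move=> ?; exact: cvg_id.
- by rewrite max_l //; lra.
- by rewrite max_r; lra.
- move=> t; rewrite concatE; case: ifPn => ht.
    by rewrite max_l; [rewrite -I01_zeroE path_zero|lra].
  by rewrite max_r //; lra.
- by move=> t; rewrite /= clampK.
Qed.

Lemma homotopic_unit_r x y (f : {path I01 R from x to y in T}) :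
  homotopic (concat f (cst_path y)) f.
Proof.
apply: (@homotopic_reparam _ _ _ _ (fun r => f (clamp r))
  (fun t => Num.min 1 (2 * t + 0)) id).
- apply: lift_continuous.
- by apply: continuous_minR; [exact: cst_continuous|apply: continuous_affine => ?; exact: cvg_id].
- by move=> ?; exact: cvg_id.
- by rewrite min_r; lra.
- by rewrite min_l //; lra.
- move=> t; rewrite concatE addr0; case: ifPn => ht.
    by rewrite min_r ?addr0 //; lra.
  by rewrite min_l; [rewrite -I01_oneE path_one|lra].
- by move=> t; rewrite /= clampK.
Qed.

Lemma homotopic_rev_r x y (f : {path I01 R from x to y in T}) :
  homotopic (concat f (path_rev f)) (cst_path x).
Proof.
apply: (@homotopic_reparam _ _ _ _ (fun r => f (clamp r))
  (fun t => Num.min (2 * t + 0) (-2 * t + 2)) (cst 0)).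
- apply: lift_continuous.
- by apply: continuous_minR; (apply: continuous_affine => ?; exact: cvg_id).
- exact: cst_continuous.
- by rewrite min_l /=; lra.
- by rewrite min_r /=; lra.
- move=> t; rewrite concatE addr0.
  have /andP[t0 t1] := I01_bounds t; case: ifPn => ht.
    by rewrite min_l ?addr0 //; lra.
  rewrite min_r; last by lra.
  rewrite path_revE I01_valK; last by lra.
  by congr (f (clamp _)); lra.
- by move=> t; rewrite /= -I01_zeroE path_zero.
Qed.

Lemma path_revK x y (f : {path I01 R from x to y in T}) :
  path_rev (path_rev f) = f.
Proof.
apply/path_eqP => t; rewrite !path_revE.
have /andP[t0 t1] := I01_bounds t.
by rewrite I01_valK ?subKr ?clampK //; lra.
Qed.

Lemma homotopic_rev_l x y (f : {path I01 R from x to y in T}) :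
  homotopic (concat (path_rev f) f) (cst_path y).
Proof. by have := homotopic_rev_r (path_rev f); rewrite path_revK. Qed.

Lemma homotopic_assoc x y z w (f : {path I01 R from x to y in T})
    (g : {path I01 R from y to z in T}) (h : {path I01 R from z to w in T}) :
  homotopic (concat f (concat g h)) (concat (concat f g) h).
Proof.
apply: homotopic_sym.
apply: (@homotopic_reparam _ _ _ _ (fun r => concat f (concat g h) (clamp r))
  (fun t => Num.min (2 * t + 0) (Num.min (1 * t + 4^-1) (2^-1 * t + 2^-1))) id).
- apply: lift_continuous.
- by do ?apply: continuous_minR; (apply: continuous_affine => ?; exact: cvg_id).
- by move=> ?; exact: cvg_id.
- by rewrite min_l ?le_min; lra.
- rewrite (@min_r _ _ (_ + 4^-1)); last by lra.
  by rewrite min_r; lra.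
- move=> t; have /andP[t0 t1] := I01_bounds t.
  rewrite !concatE addr0 mul1r.
  case: ifPn => ht.
    rewrite (@I01_valK _ (2 * I01_val t)); last by lra.
    case: ifPn => ht'.
      rewrite min_l ?le_min; last by lra.
      rewrite I01_valK; last by lra.
      by rewrite ifT //; lra.
    rewrite (@min_l _ _ (_ + 4^-1)); last by lra.
    rewrite min_r; last by lra.
    rewrite (@I01_valK _ (_ + _)); last by lra.
    rewrite ifF; last by lra.
    rewrite I01_valK; last by lra.
    rewrite ifT; last by lra.
    by congr (g (clamp _)); lra.
  rewrite (@min_r _ _ (_ + 4^-1)); last by lra.
  rewrite min_r; last by lra.
  rewrite (@I01_valK _ (_ + _)); last by lra.
  rewrite ifF; last by lra.
  rewrite I01_valK; last by lra.
  rewrite ifF; last by lra.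
  by congr (h (clamp _)); lra.
- by move=> t; rewrite /= clampK.
Qed.

End Paths.

Section FundamentalGroup.
Variables (R : realType) (T : topologicalType) (x : T).
Local Notation loop := {path I01 R from x to x in T}.

Definition homotopicb (f g : loop) : bool := `[< homotopic f g >].

Lemma homotopicb_refl : reflexive homotopicb.
Proof. by move=> f; apply/asboolP/homotopic_refl. Qed.

Lemma homotopicb_sym : symmetric homotopicb.
Proof.
by move=> f g; apply/idP/idP => /asboolP h; apply/asboolP/homotopic_sym.
Qed.

Lemma homotopicb_trans : transitive homotopicb.
Proof.
by move=> g f h /asboolP fg /asboolP gh; apply/asboolP/(homotopic_trans fg).
Qed.

Definition homotopic_equiv :=
  EquivRel homotopicb homotopicb_refl homotopicb_sym homotopicb_trans.

Definition pi1 : Type := {eq_quot homotopic_equiv}.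
HB.instance Definition _ := Choice.on pi1.
HB.instance Definition _ := Quotient.on pi1.

Definition loop_class (f : loop) : pi1 := \pi_pi1 f.

Lemma loop_classP (f g : loop) : loop_class f = loop_class g <-> homotopic f g.
Proof.
by split=> [/eqquotP/asboolP|fg]; last apply/eqquotP/asboolP.
Qed.

Lemma loop_class_repr (a : pi1) : loop_class (repr a) = a.
Proof. exact: reprK. Qed.

Definition pi1_mul (a b : pi1) : pi1 := loop_class (concat (repr a) (repr b)).
Definition pi1_one : pi1 := loop_class (cst_path R x).
Definition pi1_inv (a : pi1) : pi1 := loop_class (path_rev (repr a)).

Lemma repr_loop_class (f : loop) : homotopic (repr (loop_class f)) f.
Proof. by apply/loop_classP; rewrite loop_class_repr. Qed.

Lemma pi1_mulE f g :
  pi1_mul (loop_class f) (loop_class g) = loop_class (concat f g).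
Proof. by apply/loop_classP/homotopic_concat; exact: repr_loop_class. Qed.

Lemma pi1_mulA : associative pi1_mul.
Proof.
move=> a b c; rewrite -(loop_class_repr a) -(loop_class_repr b).
by rewrite -(loop_class_repr c) !pi1_mulE; apply/loop_classP/homotopic_assoc.
Qed.

Lemma pi1_mul1 : left_id pi1_one pi1_mul.
Proof.
move=> a; rewrite -(loop_class_repr a) pi1_mulE.
exact/loop_classP/homotopic_unit_l.
Qed.

Lemma pi1_1mul : right_id pi1_one pi1_mul.
Proof.
move=> a; rewrite -(loop_class_repr a) pi1_mulE.
exact/loop_classP/homotopic_unit_r.
Qed.

Lemma pi1_invE f : pi1_inv (loop_class f) = loop_class (path_rev f).
Proof. by apply/loop_classP/homotopic_rev; exact: repr_loop_class. Qed.

Lemma pi1_mulV : left_inverse pi1_one pi1_inv pi1_mul.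
Proof.
move=> a; rewrite -(loop_class_repr a) pi1_invE pi1_mulE.
exact/loop_classP/homotopic_rev_l.
Qed.

Lemma pi1_Vmul : right_inverse pi1_one pi1_inv pi1_mul.
Proof.
move=> a; rewrite -(loop_class_repr a) pi1_invE pi1_mulE.
exact/loop_classP/homotopic_rev_r.
Qed.

HB.instance Definition _ := isGroup.Build pi1
  pi1_mulA pi1_mul1 pi1_1mul pi1_mulV pi1_Vmul.

End FundamentalGroup.

Section Presentation.
Variable S : choiceType.

(* The letter [(s, true)] stands for the generator [s] and [(s, false)] for its
   inverse. *)
Definition word : Type := seq (S * bool).
HB.instance Definition _ := Choice.on word.

Definition word_inv (w : word) : word := rev [seq (l.1, ~~ l.2) | l <- w].

Variable rels : set word.

Inductive word_eq : word -> word -> Prop :=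
| word_eq_refl u : word_eq u u
| word_eq_sym u v : word_eq u v -> word_eq v u
| word_eq_trans u v w : word_eq u v -> word_eq v w -> word_eq u w
| word_eq_cancel u v s b : word_eq (u ++ (s, b) :: (s, ~~ b) :: v) (u ++ v)
| word_eq_rel u v r : rels r -> word_eq (u ++ r ++ v) (u ++ v).

Lemma word_eq_cat2 p q u v : word_eq u v -> word_eq (p ++ u ++ q) (p ++ v ++ q).
Proof.
elim=> {u v} [u|u v _|u v w _ + _|u v s b|u v r rr].
- exact: word_eq_refl.
- exact: word_eq_sym.
- exact: word_eq_trans.
- by have := word_eq_cancel (p ++ u) (v ++ q) s b; rewrite -!catA.
- by have := word_eq_rel (p ++ u) (v ++ q) rr; rewrite -!catA.
Qed.

Lemma word_eq_cat u u' v v' :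
  word_eq u u' -> word_eq v v' -> word_eq (u ++ v) (u' ++ v').
Proof.
move=> /(word_eq_cat2 [::] v) /= uu' /(word_eq_cat2 u' [::]).
by rewrite !cats0; exact: word_eq_trans.
Qed.

Lemma word_invK : involutive word_inv.
Proof.
move=> w; rewrite /word_inv map_rev revK -map_comp -[RHS]map_id.
by apply: eq_map => -[s b] /=; rewrite negbK.
Qed.

Lemma word_inv_cat u v : word_inv (u ++ v) = word_inv v ++ word_inv u.
Proof. by rewrite /word_inv map_cat rev_cat. Qed.

Lemma word_eq_mulV w : word_eq (w ++ word_inv w) [::].
Proof.
elim: w => [|[s b] w IH]; first exact: word_eq_refl.
rewrite -cat1s word_inv_cat catA -(catA [:: (s, b)]).
apply: word_eq_trans (word_eq_cat2 [:: (s, b)] [:: (s, ~~ b)] IH) _.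
exact: (word_eq_cancel [::] [::] s b).
Qed.

Lemma word_eq_Vmul w : word_eq (word_inv w ++ w) [::].
Proof. by have := word_eq_mulV (word_inv w); rewrite word_invK. Qed.

Lemma word_eq_inv u v : word_eq u v -> word_eq (word_inv u) (word_inv v).
Proof.
move=> uv.
apply: (@word_eq_trans _ (word_inv u ++ (v ++ word_inv v))).
  have := word_eq_cat (word_eq_refl (word_inv u)) (word_eq_mulV v).
  by rewrite cats0 => /word_eq_sym.
rewrite catA -[X in word_eq _ X]cat0s.
apply: word_eq_cat (word_eq_refl _).
apply: word_eq_trans (word_eq_Vmul u).
exact: word_eq_cat (word_eq_refl _) (word_eq_sym uv).
Qed.

Definition word_eqb (u v : word) : bool := `[< word_eq u v >].

Lemma word_eqb_refl : reflexive word_eqb.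
Proof. by move=> u; apply/asboolP/word_eq_refl. Qed.

Lemma word_eqb_sym : symmetric word_eqb.
Proof. by move=> u v; apply/idP/idP => /asboolP h; apply/asboolP/word_eq_sym. Qed.

Lemma word_eqb_trans : transitive word_eqb.
Proof.
by move=> v u w /asboolP uv /asboolP vw; apply/asboolP/(word_eq_trans uv).
Qed.

Definition word_equiv :=
  EquivRel word_eqb word_eqb_refl word_eqb_sym word_eqb_trans.

Definition presented_group : Type := {eq_quot word_equiv}.
HB.instance Definition _ := Choice.on presented_group.
HB.instance Definition _ := Quotient.on presented_group.

Definition word_class (w : word) : presented_group := \pi_presented_group w.

Definition pgen (s : S) : presented_group := word_class [:: (s, true)].

Lemma word_classP u v : word_class u = word_class v <-> word_eq u v.
Proof. by split=> [/eqquotP/asboolP|uv]; last apply/eqquotP/asboolP. Qed.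

Lemma word_class_repr a : word_class (repr a) = a.
Proof. exact: reprK. Qed.

Lemma repr_word_class w : word_eq (repr (word_class w)) w.
Proof. by apply/word_classP; rewrite word_class_repr. Qed.

Definition pg_mul (a b : presented_group) := word_class (repr a ++ repr b).
Definition pg_one : presented_group := word_class [::].
Definition pg_inv (a : presented_group) := word_class (word_inv (repr a)).

Lemma pg_mulE u v : pg_mul (word_class u) (word_class v) = word_class (u ++ v).
Proof. by apply/word_classP/word_eq_cat; exact: repr_word_class. Qed.

Lemma pg_invE u : pg_inv (word_class u) = word_class (word_inv u).
Proof. by apply/word_classP/word_eq_inv; exact: repr_word_class. Qed.

Lemma pg_mulA : associative pg_mul.
Proof.
move=> a b c; rewrite -(word_class_repr a) -(word_class_repr b).
by rewrite -(word_class_repr c) !pg_mulE catA.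
Qed.

Lemma pg_mul1 : left_id pg_one pg_mul.
Proof. by move=> a; rewrite -(word_class_repr a) pg_mulE. Qed.

Lemma pg_1mul : right_id pg_one pg_mul.
Proof. by move=> a; rewrite -(word_class_repr a) pg_mulE cats0. Qed.

Lemma pg_mulV : left_inverse pg_one pg_inv pg_mul.
Proof.
move=> a; rewrite -(word_class_repr a) pg_invE pg_mulE.
exact/word_classP/word_eq_Vmul.
Qed.

Lemma pg_Vmul : right_inverse pg_one pg_inv pg_mul.
Proof.
move=> a; rewrite -(word_class_repr a) pg_invE pg_mulE.
exact/word_classP/word_eq_mulV.
Qed.

HB.instance Definition _ := isGroup.Build presented_group
  pg_mulA pg_mul1 pg_1mul pg_mulV pg_Vmul.

End Presentation.

Definition generates (S : Type) (G : groupType) (a : S -> G) : Prop :=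
  forall H : {pred G}, group_closed H -> (forall s, a s \in H) ->
  forall x, x \in H.

Definition presents (S : choiceType) (G : groupType) (a : S -> G)
    (rels : set (word S)) : Prop :=
  exists phi : {multiplicative presented_group rels -> G},
    bijective phi /\ forall s, phi (pgen rels s) = a s.

Definition Cplx (R : realType) : numClosedFieldType := R[i].

Section ProjectivePlane.
Variable R : realType.
Local Notation C := (Cplx R).
Local Notation poly3 := (mpoly 3 C).

Definition hvec : Type := set_type [set v : 'rV[C]_3 | v != 0].
HB.instance Definition _ :=
  Topological.copy hvec (set_type [set v : 'rV[C]_3 | v != 0]).

Definition hvec_val (u : hvec) : 'rV[C]_3 := set_val u.

Definition proportional (u v : hvec) : bool :=
  `[< exists2 c : C, c != 0 & hvec_val v = c *: hvec_val u >].

Lemma proportional_refl : reflexive proportional.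
Proof.
by move=> u; apply/asboolP; exists 1; rewrite ?oner_eq0 ?scale1r.
Qed.

Lemma proportional_sym : symmetric proportional.
Proof.
by move=> u v; apply/idP/idP => /asboolP[c c0 e]; apply/asboolP;
  exists c^-1; rewrite ?invr_eq0 // e scalerA mulVf ?scale1r.
Qed.

Lemma proportional_trans : transitive proportional.
Proof.
move=> v u w /asboolP[c c0 e] /asboolP[d d0 e']; apply/asboolP.
by exists (d * c); rewrite ?mulf_neq0 // e' e scalerA.
Qed.

Definition proportional_equiv :=
  EquivRel proportional proportional_refl proportional_sym proportional_trans.

Definition P2 : Type := {eq_quot proportional_equiv}.
HB.instance Definition _ :=
  Topological.copy P2 (quotient_topology {eq_quot proportional_equiv}).
HB.instance Definition _ := Quotient.on P2.

(* [v] is a vector of homogeneous coordinates of [p]; in particular [v != 0]. *)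
Definition coords (p : P2) (v : 'rV[C]_3) : Prop :=
  exists2 u : hvec, \pi_P2 u = p & hvec_val u = v.

Definition eval3 (G : poly3) (v : 'rV[C]_3) : C := meval (v 0) G.

(* The differential of [G] at [v] applied to [w]. *)
Definition diff3 (G : poly3) (v w : 'rV[C]_3) : C :=
  \sum_(k < 3) eval3 (mderiv k G) v * w 0 k.

Definition homogeneous (d : nat) (G : poly3) : bool :=
  G \is ishomog1 d mdeg.

Definition plane_curve (G : poly3) : set P2 :=
  [set p | exists2 v, coords p v & eval3 G v = 0].

(* Singular points of the curve [plane_curve G], for a reduced equation [G]. *)
Definition singular_locus (G : poly3) : set P2 :=
  [set p | exists2 v, coords p v &
     eval3 G v = 0 /\ forall k, eval3 (mderiv k G) v = 0].

Definition quadric (G : poly3) : Prop :=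
  homogeneous 2 G /\ singular_locus G = set0.

Definition unit_circle (t : I01 R) : C :=
  (cos (2 * pi * I01_val t) +i* sin (2 * pi * I01_val t))%C.

Section Arrangement.
Variables (n : nat) (F : 'I_n -> poly3).

Definition arrangement : set P2 := \bigcup_i plane_curve (F i).

Definition complement : Type := set_type (~` arrangement).
HB.instance Definition _ :=
  Topological.copy complement (set_type (~` arrangement)).

Definition complement_val (q : complement) : P2 := set_val q.

Lemma arrangementE : arrangement = plane_curve (\prod_i F i).
Proof.
apply/seteqP; split => [p [i _ [v pv Fv0]]|p [v pv]].
  exists v => //; rewrite /eval3 rmorph_prod (bigD1 i) //=.
  by move: Fv0; rewrite /eval3 => ->; rewrite mul0r.
rewrite /eval3 rmorph_prod => /eqP/prodf_eq0[i _ /eqP Fv0].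
by exists i => //; exists v.
Qed.

(* The small disc of the meridian is the round disc [{[v + z w] : |z| <= 1}] in
   a projective line, with centre [p = [v]] and radius absorbed in [w]; it meets
   the arrangement only for [z = 0], and transversally there.  Multiplication by
   [unit_circle] is the positive orientation.  [\prod_j F j] is a reduced equation
   of the arrangement when the [F j] are irreducible and pairwise not
   proportional. *)
Definition meridian (i : 'I_n) (x0 : complement) (a : pi1 R x0) : Prop :=
  exists (p : P2) (v w : 'rV[C]_3) (y : complement)
      (omega : {path I01 R from x0 to y in complement})
      (delta : {path I01 R from y to y in complement}),
    [/\ coords p v,
        (plane_curve (F i) `\` singular_locus (\prod_j F j)) p,
        diff3 (\prod_j F j) v w != 0,
        forall z : C, 0 < `|z| <= 1 ->
          exists q : complement, coords (complement_val q) (v + z *: w) &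
        (forall t, coords (complement_val (delta t)) (v + unit_circle t *: w)) /\
        a = loop_class (concat (concat omega delta) (path_rev omega))].

End Arrangement.

End ProjectivePlane.

(* The word [(a_1 ... a_n)^2]. *)
Definition squared_product (n : nat) : word 'I_n :=
  let w := [seq (i, true) | i <- enum 'I_n] in w ++ w.

(* Main.v *)
(* Coordinates can be chosen in which the common point is [0:1:0] and the conics
   are y z + x^2 = c_j z^2.  Off the line z = 0 the complement is the product of
   the x-line with the t-line punctured at the c_j, t = (y z + x^2) / z^2; it is
   covered by contractible strips and bands, whose nerve is a graph with free
   fundamental group on meridians a_1, ..., a_n.  What is left of the line z = 0
   has a contractible neighbourhood, and in it a loop around that line satisfies
   t ~ x^2, so it goes twice around all the punctures: this gives the relation
   (a_1 ... a_n)^2 = 1.  That there is no other relation is seen from the local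
   system with values in the presented group whose transition across the j-th cut
   is the j-th generator: the relation is what is needed to extend it over the
   neighbourhood of the line, and its monodromy inverts the map from the presented
   group to the fundamental group. *)
From HB Require Import structures.
From Corelib Require Setoid Morphisms ssrsetoid.
From Corelib Require RelationClasses.
From mathcomp Require Import -(notations) mpoly.
From mathcomp Require Import all_boot all_order all_algebra generic_quotient.
From mathcomp Require Import all_classical all_reals all_analysis.
From mathcomp Require Import homotopy complex ring lra.
Require Import Defs.

Set Implicit Arguments.
Unset Strict Implicit.
Unset Printing Implicit Defensive.

Import Order.TTheory GRing.Theory Num.Theory numFieldNormedType.Exports.
Local Open Scope classical_set_scope.
Local Open Scope ring_scope.

(** * Paths and tethered loops *)

(** Paths are cut where they change charts: each chart has a tether from the base point, and two
    charts containing a common point define a transition element of the fundamental group. Tethers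
    chosen along a tree make most transitions trivial. One family of labels with values in a group
    serves twice: in the fundamental group its quotients are the transitions and yield the relation,
    in the presented group it defines the local system. The obstacle is the overlap of the chart at
    infinity with the affine part, which is connected but not simply connected: the label at
    infinity agrees with the affine ones only off a slit, across which it jumps by the square of the
    product. The constants are first scaled apart so that a shear depending on the real part can
    move the j-th puncture to height j; this makes the pieces convex and fixes the order of the
    product. *)

(** Compactness of [[a, b]], playing the part of a Lebesgue number: the supremum of the good right
    ends is good and, if it were below [b], could be passed. *)
Lemma interval_ind (R : realType) (P : R -> R -> Prop) (a b : R) : a <= b ->
  (forall u v w, a <= u -> u <= v -> v <= w -> w <= b ->
     P u v -> P v w -> P u w) ->
  (forall t, a <= t <= b -> exists2 e, 0 < e & forall u v,
     a <= u -> u <= t -> t <= v -> v <= b -> t - e < u -> v < t + e -> P u v) ->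
  P a b.
Proof.
move=> ab trans loc; pose S := [set t | a <= t <= b /\ P a t].
have Sa : S a.
  split; first by rewrite lexx.
  have /loc[e e0 He] : a <= a <= b by rewrite lexx.
  by apply: He; rewrite ?lexx //; lra.
have ubS : ubound S b by move=> t [/andP[]].
have supS : has_sup S by split; [exists a|exists b].
have as_ : a <= sup S by apply: ub_le_sup Sa; exists b.
have sb : sup S <= b by apply: ge_sup ubS; exists a.
have /loc[e e0 He] : a <= sup S <= b by rewrite as_ sb.
have [t St lt_t] := sup_adherent e0 supS; have [/andP[at_ tb] Pt] := St.
have ts : t <= sup S by apply: ub_le_sup St; exists b.
pose v := Num.min b (sup S + e / 2).
have vb : v <= b by rewrite /v ge_min lexx.
have sv : sup S <= v by rewrite /v le_min sb /=; lra.
have ve : v < sup S + e by rewrite /v gt_min; apply/orP; right; lra.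
have Pv : P a v by apply: (trans a t v) => //; [lra|exact: He].
have vs : v <= sup S.
  have Sv : S v by split=> //; apply/andP; split => //; lra.
  by apply: ub_le_sup Sv; exists b.
suff -> : b = v by [].
by move: vs; rewrite /v; case: (leP b (sup S + e / 2)) => // _; lra.
Qed.

Lemma nbhs_interval (R : realType) (t : R) (A : set R) : nbhs t A ->
  exists2 e, 0 < e & forall u, t - e < u -> u < t + e -> A u.
Proof.
move=> /nbhs_ballP[e /= e0 He]; exists e => // u h1 h2.
by apply: He; rewrite -ball_normE /= ltr_norml; lra.
Qed.

#[export] Hint Resolve homotopic_refl : core.

#[export] Instance homotopic_equivalence (R : realType) (T : topologicalType)
  (x y : T) : RelationClasses.Equivalence (@homotopic R T x y).
Proof.
split; first by move=> f; exact: homotopic_refl.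
  by move=> f g; exact: homotopic_sym.
by move=> f g h; exact: homotopic_trans.
Qed.

#[export] Instance concat_proper (R : realType) (T : topologicalType)
  (x y z : T) : Morphisms.Proper (Morphisms.respectful (@homotopic R T x y)
    (Morphisms.respectful (@homotopic R T y z) (@homotopic R T x z))) (@concat R T x y z).
Proof. by move=> f f' ff' g g' gg'; exact: homotopic_concat. Qed.

#[export] Instance path_rev_proper (R : realType) (T : topologicalType)
  (x y : T) : Morphisms.Proper (Morphisms.respectful (@homotopic R T x y) (@homotopic R T y x))
    (@path_rev R T x y).
Proof. by move=> f f' ff'; exact: homotopic_rev. Qed.

Section TetheredClass.
Variables (R : realType) (T : topologicalType) (x : T).
Local Notation path a b := {path I01 R from a to b in T}.

Lemma concat_revK a b c (f : path a b) (g : path a c) :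
  homotopic (concat f (concat (path_rev f) g)) g.
Proof. by rewrite homotopic_assoc homotopic_rev_r homotopic_unit_l. Qed.

Lemma concat_Krev a b c (f : path b a) (g : path a c) :
  homotopic (concat (path_rev f) (concat f g)) g.
Proof. by rewrite homotopic_assoc homotopic_rev_l homotopic_unit_l. Qed.

(** Tethers carry the fundamental groupoid into the group at [x]: paths with any endpoints become
    elements that multiply like paths. *)
Definition tethered_class p q (tau : path x p) (f : path p q) (sigma : path x q)
    : pi1 R x := loop_class (concat tau (concat f (path_rev sigma))).

Lemma tethered_classM p q r (tau : path x p) (f : path p q) (sigma : path x q)
    (g : path q r) (ups : path x r) :
  (tethered_class tau f sigma * tethered_class sigma g ups)%g =
  tethered_class tau (concat f g) ups.
Proof.
rewrite /tethered_class [LHS]pi1_mulE; apply/loop_classP.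
by rewrite -!homotopic_assoc concat_Krev.
Qed.

Lemma eq_tethered_class p q (tau tau' : path x p) (f f' : path p q)
    (sigma sigma' : path x q) : homotopic tau tau' -> homotopic f f' ->
  homotopic sigma sigma' ->
  tethered_class tau f sigma = tethered_class tau' f' sigma'.
Proof. by move=> h1 h2 h3; apply/loop_classP; rewrite h1 h2 h3. Qed.

Lemma tethered_class_eq1 p q (tau : path x p) (f : path p q) (sigma : path x q) :
  homotopic (concat tau f) sigma -> tethered_class tau f sigma = 1%g.
Proof.
by move=> h; apply/loop_classP; rewrite homotopic_assoc h homotopic_rev_r.
Qed.

(** The tether of the base point goes out to a chart center and back, so it need not be constant;
    conjugating by it lets a loop be read from a chart. *)
Lemma tethered_class_conj (tau f : path x x) :
  tethered_class tau (concat (path_rev tau) (concat f tau)) tau = loop_class f.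
Proof.
apply/loop_classP.
rewrite -homotopic_assoc concat_revK -homotopic_assoc homotopic_rev_r.
exact: homotopic_unit_r.
Qed.

End TetheredClass.

(** * Pieces of a path, cut at real parameters *)

Section Subpath.
Variables (R : realType) (T : topologicalType).
Variables (h : R -> T) (ch : continuous h).

Section Def.
Variables a b : R.

Lemma subpath_continuous :
  continuous (fun t : I01 R => h ((b - a) * I01_val t + a)).
Proof.
by apply: (continuous_compT _ ch); exact/continuous_affine/I01_val_continuous.
Qed.

Lemma subpath_zero : h ((b - a) * I01_val (zero : I01 R) + a) = h a.
Proof. by rewrite I01_zeroE I01_valK ?lexx ?ler01 // mulr0 add0r. Qed.

Lemma subpath_one : h ((b - a) * I01_val (one : I01 R) + a) = h b.
Proof. by rewrite I01_oneE I01_valK ?lexx ?ler01 // mulr1 subrK. Qed.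

Definition subpath : {path I01 R from h a to h b in T} :=
  mk_path subpath_continuous subpath_zero subpath_one.

End Def.

Lemma homotopic_subpath_concat (a b c : R) :
  homotopic (concat (subpath a b) (subpath b c)) (subpath a c).
Proof.
(* [phi] runs through [[0, 1]] in the first half and [phi'] in the second, so the concatenation is
   [h] after one real function, to be deformed into the affine one. *)
pose phi (t : R) := Num.min (2 * t + 0) 1.
pose phi' (t : R) := Num.max 0 (2 * t + -1).
have cid : continuous (@id R) by move=> ?; exact: cvg_id.
apply: (@homotopic_reparam _ _ _ _ _ _ h
  (fun t => 1 * ((b - a) * phi t + a) + 1 * ((c - b) * phi' t + 0))
  (fun t => (c - a) * t + a)) => //.
- apply: continuous_lin; try exact: cst_continuous.
  + apply: continuous_affine; apply: continuous_minR; last exact: cst_continuous.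
    exact: continuous_affine.
  + apply: continuous_affine; apply: continuous_maxR; first exact: cst_continuous.
    exact: continuous_affine.
- exact: continuous_affine.
- by rewrite /phi /phi' min_l ?max_l; lra.
- by rewrite /phi /phi' min_r ?max_r; lra.
move=> t; rewrite concatE; have /andP[t0 t1] := I01_bounds t.
case: ifPn => ht; congr (h _); rewrite /phi /phi'.
  by rewrite min_l ?max_l ?I01_valK; lra.
by rewrite min_r ?max_r ?I01_valK; lra.
Qed.

End Subpath.

Lemma subpath_full (R : realType) (T : topologicalType) (x y : T)
    (f : {path I01 R from x to y in T}) (h : R -> T) (ch : continuous h) :
  (forall t, h (I01_val t) = f t) ->
  forall t, subpath ch 0 1 t = f t.
Proof.
by move=> hf t; rewrite -hf; congr (h _); rewrite subr0 mul1r addr0.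
Qed.

(** * Covers by contractible open sets *)

Section Contraction.
Variables (R : realType) (X : topologicalType).
Local Notation path a b := {path I01 R from a to b in X}.

(** [K] is total and continuous only at the points over [U], which avoids a topology on [U] itself.
    It may move [c]. *)
Definition contracts_to (U : set X) (c : X) : Prop :=
  exists K : I01 R * X -> X,
    [/\ forall s u, U u -> U (K (s, u)) /\ {for (s, u), continuous K},
        forall u, U u -> K (zero, u) = c &
        forall u, U u -> K (one, u) = u].

Variables (U : set X) (c : X).
Hypothesis Uc : contracts_to U c.

Lemma contracts_to_path u : U u ->
  exists f : path c u, forall t, U (f t).
Proof.
have [K [KU K0 K1]] := Uc => Uu.
have cK : continuous (fun t : I01 R => K (t, u)).
  move=> t; apply: (@continuous_comp _ _ _ (fun t : I01 R => (t, u)) K).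
    by apply: continuous_pair; [move=> ?; exact: cvg_id|exact: cst_continuous].
  by case: (KU t _ Uu).
exists (mk_path cK (K0 _ Uu) (K1 _ Uu)) => t.
by case: (KU t _ Uu).
Qed.

(* Pulls [f] to the center and back while traversing it only in the middle third. *)
Lemma contracts_to_detour p q (f : path p q) : (forall t, U (f t)) ->
  exists2 e : path p q, homotopic f e & forall t, e t =
    if I01_val t <= 3^-1 then
      projT1 (cid Uc) (clamp (1 - 3 * I01_val t), p)
    else if I01_val t <= 2 / 3 then c
    else projT1 (cid Uc) (clamp (3 * I01_val t - 2), q).
Proof.
move=> Uf; case: (cid Uc) => K /= [KU K0 K1].
(* [mu] goes from 1 to 0, rests, and returns to 1; [phi] advances only in the middle third, where
   [mu] is 0. The homotopy moves the parameters of [K] and [f] linearly from [(1, t)] to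
   [(mu t, phi t)]. *)
pose mu (t : R) := Num.max 0 (Num.max (-3 * t + 1) (3 * t + -2)).
pose phi (t : R) := Num.max 0 (Num.min (3 * t + -1) 1).
pose A (st : I01 R * I01 R) :=
  clamp ((-1 * I01_val st.1 + 1) * 1 + I01_val st.1 * mu (I01_val st.2)).
pose B (st : I01 R * I01 R) := f (clamp
  ((-1 * I01_val st.1 + 1) * I01_val st.2 + I01_val st.1 * phi (I01_val st.2))).
have cid : continuous (@id R) by move=> ?; exact: cvg_id.
have caff a b : continuous (fun t : R => a * t + b) by exact: continuous_affine.
have cmu : continuous mu.
  apply: continuous_maxR; first exact: cst_continuous.
  exact: continuous_maxR.
have cphi : continuous phi.
  apply: continuous_maxR; first exact: cst_continuous.
  by apply: continuous_minR => //; exact: cst_continuous.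
have c1 := @continuous_val1 R; have c2 := @continuous_val2 R.
have cA : continuous A.
  apply: (continuous_compT _ (@clamp_continuous R)); apply: continuous_lin => //.
  - exact: cst_continuous.
  - exact: (continuous_compT c2).
  - exact: continuous_affine.
have cB : continuous B.
  apply: (continuous_compT _ (@lift_continuous _ _ _ _ f)); apply: continuous_lin => //.
  - exact: (continuous_compT c2).
  - exact: continuous_affine.
pose H st := K (A st, B st).
have cH : continuous H.
  move=> st; apply: (@continuous_comp _ _ _ (fun st => (A st, B st)) K).
    exact: continuous_pair.
  by case: (KU (A st) (B st) (Uf _)).
have v0 : I01_val (zero : I01 R) = 0 by rewrite I01_zeroE I01_valK ?lexx ?ler01.
have v1 : I01_val (one : I01 R) = 1 by rewrite I01_oneE I01_valK ?lexx ?ler01.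
have H0 t : H (zero, t) = f t.
  by rewrite /H /A /B /= v0 !mulr0 !mul0r add0r !addr0 !mul1r clampK -I01_oneE K1.
have mu0 : mu 0 = 1 by rewrite /mu max_r ?le_max ?max_l; lra.
have mu1 : mu 1 = 1.
  by rewrite /mu (@max_r _ _ (-3 * 1 + 1)) ?max_r; lra.
have phi0 : phi 0 = 0 by rewrite /phi max_l // ge_min; apply/orP; left; lra.
have phi1 : phi 1 = 1 by rewrite /phi min_r ?max_r; lra.
have Hz s : H (s, zero) = p.
  rewrite /H /A /B /= v0 mu0 phi0 !mulr0 !mulr1 add0r addrAC mulN1r addNr add0r.
  by rewrite -I01_oneE K1 // -I01_zeroE path_zero.
have Ho s : H (s, one) = q.
  rewrite /H /A /B /= v1 mu1 phi1 !mulr1 addrAC mulN1r addNr add0r.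
  by rewrite -I01_oneE K1 // path_one.
have ce : continuous (fun t => H (one, t)).
  move=> t; apply: (@continuous_comp _ _ _ (fun t => (one, t)) H); last exact: cH.
  by apply: continuous_pair; [exact: cst_continuous|move=> ?; exact: cvg_id].
exists (mk_path ce (Hz one) (Ho one)); first by exists H; split.
move=> t; rewrite [LHS]/=/mk_path /H /A /B /= v1 !mulr1 addNr add0r mul0r add0r !mul1r.
rewrite /mu /phi; have /andP[t0 t1] := I01_bounds t.
case: ifPn => h1.
  rewrite (@max_l _ _ (-3 * _ + 1)); last by lra.
  rewrite max_r; last by lra.
  rewrite [in X in (_, X)]min_l; last by lra.
  rewrite max_l; last by lra.
  by rewrite -I01_zeroE path_zero; congr (K (clamp _, _)); lra.
case: ifPn => h2.
  rewrite max_l; last by rewrite ge_max; lra.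
  by rewrite -I01_zeroE K0.
rewrite (@max_r _ _ (-3 * _ + 1)); last by lra.
rewrite max_r; last by lra.
rewrite [in X in (_, X)]min_r; last by lra.
rewrite max_r ?ler01 //.
by rewrite -I01_oneE path_one; congr (K (clamp _, _)); lra.
Qed.

(** The detour depends on the endpoints alone, so both paths are homotopic to the same one;
    [projT1 (cid Uc)] in its formula fixes one contraction for both. *)
Lemma contracts_to_homotopic p q (f g : path p q) :
  (forall t, U (f t)) -> (forall t, U (g t)) -> homotopic f g.
Proof.
move=> /contracts_to_detour[e fe eE] /contracts_to_detour[e' ge' e'E].
rewrite fe ge'; suff -> : e = e' by [].
by apply/path_eqP => t; rewrite eE e'E.
Qed.

Lemma concat_in p q r (f : path p q) (g : path q r) :
  (forall t, U (f t)) -> (forall t, U (g t)) -> forall t, U (concat f g t).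
Proof. by move=> Uf Ug t; rewrite concatE; case: ifP. Qed.

Lemma path_rev_in p q (f : path p q) :
  (forall t, U (f t)) -> forall t, U (path_rev f t).
Proof. by move=> Uf t; rewrite path_revE. Qed.

Lemma contracts_to_join p q : U p -> U q -> exists f : path p q, forall t, U (f t).
Proof.
move=> /contracts_to_path[f Uf] /contracts_to_path[g Ug].
by exists (concat (path_rev f) g); apply: concat_in => //; exact: path_rev_in.
Qed.

End Contraction.

(** * Transition elements of a cover *)

Section Transition.
Variables (R : realType) (X : topologicalType) (x0 : X) (I : Type).
Variables (U : I -> set X) (c : I -> X).
Local Notation path a b := {path I01 R from a to b in X}.
Hypothesis openU : forall i, open (U i).
Hypothesis Uc : forall i p, U i p -> contracts_to R (U i) (c i).

Definition spoke i p (h : U i p) : path (c i) p :=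
  projT1 (cid (contracts_to_path (Uc h) h)).

Lemma spoke_in i p (h : U i p) t : U i (spoke h t).
Proof. by rewrite /spoke; case: cid. Qed.

Variable tau : forall i, path x0 (c i).

Definition tether i p (h : U i p) : path x0 p := concat (tau i) (spoke h).

Definition lam i j p q (hp : U i p) (hq : U j q) (f : path p q) : pi1 R x0 :=
  tethered_class (tether hp) f (tether hq).

(** Out through chart [i], back through chart [j]. These elements form a 1-cocycle ([transM]) with
    values in the fundamental group. *)
Definition trans i j p (hi : U i p) (hj : U j p) : pi1 R x0 :=
  lam hi hj (cst_path R p).

Lemma lamM i j k p q r (hp : U i p) (hq : U j q) (hr : U k r)
    (f : path p q) (g : path q r) :
  (lam hp hq f * lam hq hr g)%g = lam hp hr (concat f g).
Proof. exact: tethered_classM. Qed.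

Lemma eq_lam i j p q (hp : U i p) (hq : U j q) (f g : path p q) :
  homotopic f g -> lam hp hq f = lam hp hq g.
Proof. by move=> fg; exact: eq_tethered_class. Qed.

Lemma lam_in i p q (hp hq : U i _) (f : path p q) :
  (forall t, U i (f t)) -> lam hp hq f = 1%g.
Proof.
move=> Uf; apply: tethered_class_eq1; rewrite /tether -homotopic_assoc.
suff -> : homotopic (concat (spoke hp) f) (spoke hq) by [].
apply: (contracts_to_homotopic (Uc hq)); last exact: spoke_in.
by apply: concat_in => //; exact: spoke_in.
Qed.

Lemma trans_refl i p (h h' : U i p) : trans h h' = 1%g.
Proof. exact: lam_in. Qed.

Lemma transM i j k p (hi : U i p) (hj : U j p) (hk : U k p) :
  (trans hi hj * trans hj hk)%g = trans hi hk.
Proof. by rewrite lamM; apply: eq_lam; exact: homotopic_unit_l. Qed.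

Lemma transV i j p (hi : U i p) (hj : U j p) : (trans hi hj)^-1%g = trans hj hi.
Proof. by apply: mulg1_eq; rewrite transM trans_refl. Qed.

(** A path inside one chart [k] contributes nothing by itself ([lam_in]), so only the changes of
    chart at its ends remain. *)
Lemma lam_trans i j k p q (hp : U i p) (hq : U j q) (kp : U k p) (kq : U k q)
    (f : path p q) : (forall t, U k (f t)) ->
  lam hp hq f = (trans hp kp * trans kq hq)%g.
Proof.
move=> Uf; rewrite -[trans hp kp]mulg1 -(lam_in kp kq Uf) !lamM.
by apply: eq_lam; rewrite homotopic_unit_r homotopic_unit_l.
Qed.

(** The class of [f] tethered through [i] at one end and [j] at the other can be computed inside [i]
    or inside [j]; comparing the two shows that transitions are constant along paths in the
    overlap. *)
Lemma trans_path i j p q (ip : U i p) (jp : U j p) (iq : U i q) (jq : U j q)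
    (f : path p q) : (forall t, U i (f t)) -> (forall t, U j (f t)) ->
  trans ip jp = trans iq jq.
Proof.
by move=> fi fj; rewrite -[RHS]mul1g -(trans_refl ip ip) -(lam_trans ip jq ip iq fi)
  (lam_trans ip jq jp jq fj) trans_refl mulg1.
Qed.

(** For the edges of the tree of charts: a tether built by passing through [p] has a trivial
    transition there. *)
Lemma trans_tree i j p (hi : U i p) (hj : U j p) :
  homotopic (tau j) (concat (tau i) (concat (spoke hi) (path_rev (spoke hj)))) ->
  trans hi hj = 1%g.
Proof.
move=> h; apply: tethered_class_eq1; rewrite /tether h homotopic_unit_r.
by rewrite -!homotopic_assoc homotopic_rev_l homotopic_unit_r.
Qed.

(** Endpoints such as [f (clamp 0)] and [p] are only propositionally equal, so the two paths have
    different types. *)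
Lemma lam_transport i j p q p' q' (hp : U i p) (hq : U j q) (hp' : U i p')
    (hq' : U j q') (f : path p q) (f' : path p' q') :
  (forall t, f t = f' t) -> lam hp hq f = lam hp' hq' f'.
Proof.
move=> ff'; have ep : p = p' by rewrite -(@path_zero _ _ _ _ f) ff' path_zero.
have eq_ : q = q' by rewrite -(@path_one _ _ _ _ f) ff' path_one.
subst p' q'; rewrite (Prop_irrelevance hp hp') (Prop_irrelevance hq hq').
by congr lam; apply/path_eqP.
Qed.

(** Cuts a path into pieces lying each in one chart. [Q] records the parameters and charts at both
    ends of a piece; [J] limits the charts allowed at the cuts. *)
Lemma lam_ind (J : set I) (Q : I01 R -> I01 R -> I -> I -> pi1 R x0 -> Prop)
    p q (f : path p q) :
  (forall a b d i j k g g', Q a b i j g -> Q b d j k g' -> Q a d i k (g * g')%g) ->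
  (forall t, exists k, [/\ J k, U k (f t) & \forall u \near t & v \near t,
     forall i j (iu : U i (f u)) (ku : U k (f u)) (kv : U k (f v))
       (jv : U j (f v)), J i -> J j ->
     Q u v i j (trans iu ku * trans kv jv)%g]) ->
  forall i j (hp : U i p) (hq : U j q), J i -> J j ->
  Q zero one i j (lam hp hq f).
Proof.
move=> QM loc; have ch := @lift_continuous _ _ _ _ f.
pose P (a b : R) := forall i j (ha : U i (f (clamp a))) (hb : U j (f (clamp b))),
  J i -> J j -> Q (clamp a) (clamp b) i j (lam ha hb (subpath ch a b)).
suff P01 : P 0 1.
  move=> i j hp hq Ji Jj.
  have hp' : U i (f (clamp 0)) by rewrite -I01_zeroE path_zero.
  have hq' : U j (f (clamp 1)) by rewrite -I01_oneE path_one.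
  rewrite (@lam_transport _ _ _ _ _ _ hp hq hp' hq' f (subpath ch 0 1)).
    exact: P01.
  by move=> t; symmetry; apply: subpath_full => s; rewrite clampK.
apply: interval_ind; rewrite ?ler01 //.
- move=> u v w u0 uv vw w1 Puv Pvw i j hu hw Ji Jj.
  have [k [Jk Uk _]] := loc (clamp v).
  rewrite (eq_lam hu hw (homotopic_sym (homotopic_subpath_concat ch u v w))).
  by rewrite -(lamM hu Uk hw); apply: QM; [exact: Puv|exact: Pvw].
- move=> t t01; have [k [Jk Uk]] := loc (clamp t) => -[[A B]] /= [nA nB] AB.
  have nU : nbhs t (fun r => U k (f (clamp r))).
    by apply: (ch t (U k)); apply: open_nbhs_nbhs; split.
  have nA' : nbhs t (fun r => A (clamp r)) by exact: (@clamp_continuous R t A).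
  have nB' : nbhs t (fun r => B (clamp r)) by exact: (@clamp_continuous R t B).
  have [e e0 He] := nbhs_interval (filterI nU (filterI nA' nB')).
  exists e => // u v u0 ut tv v1 eu ev i j hu hv Ji Jj.
  have Ue s : u <= s -> s <= v -> U k (f (clamp s)).
    by move=> us sv; case: (He s) => //; lra.
  have Uu := Ue u (lexx _) (le_trans ut tv).
  have Uv := Ue v (le_trans ut tv) (lexx _).
  rewrite (lam_trans hu hv Uu Uv); last first.
    move=> s; have /andP[s0 s1] := I01_bounds s.
    apply: Ue; first by rewrite -{1}[u]add0r lerD2r mulr_ge0 //; lra.
    rewrite -lerBrDr -[leRHS]mulr1 ler_wpM2l //; lra.
  apply: (AB (clamp u, clamp v)) => //; split.
    by case: (He u) => [||_ []] //; lra.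
  by case: (He v) => [||_ []] //; lra.
Qed.

Lemma lam_closed (J : set I) (H : {pred pi1 R x0}) p q (f : path p q) :
  group_closed H ->
  (forall i j r (hi : U i r) (hj : U j r), J i -> J j -> trans hi hj \in H) ->
  (forall t, exists2 k, J k & U k (f t)) ->
  forall i j (hp : U i p) (hq : U j q), J i -> J j -> lam hp hq f \in H.
Proof.
move=> /group_closedM HM Htr cov.
apply: (@lam_ind J (fun _ _ _ _ g => g \in H)) => [a b d i j k g g'|t].
  exact: HM.
have [k Jk Uk] := cov t; exists k; split=> //.
near=> u v => i j iu ku kv jv Ji Jj.
by apply: HM; exact: Htr.
Unshelve. all: by end_near. Qed.

(** [K] lifts the path to the local system given by the [l i]: up to a constant on the left it
    agrees locally with [l k] along [f]. The contributions of the pieces then telescope. *)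
Lemma lam_lift (J : set I) (l : I -> X -> pi1 R x0) (K : I01 R -> pi1 R x0)
    p q (f : path p q) :
  (forall i j r (hi : U i r) (hj : U j r), J i -> J j ->
     trans hi hj = (l i r / l j r)%g) ->
  (forall t, exists k, [/\ J k, U k (f t) &
     \forall u \near t, (K u / l k (f u) = K t / l k (f t))%g]) ->
  forall i j (hp : U i p) (hq : U j q), J i -> J j ->
  lam hp hq f = (l i p / K zero * (K one / l j q))%g.
Proof.
move=> trE loc i j hp hq Ji Jj.
suff : lam hp hq f = (l i (f zero) / K zero * (K one / l j (f one)))%g.
  by rewrite path_zero path_one.
apply: (@lam_ind J (fun a b i j g =>
  g = (l i (f a) / K a * (K b / l j (f b)))%g)) => // {i j hp hq Ji Jj} [a b d i j k g g' -> ->|t].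
  by rewrite -!mulgA mulKg mulVKg.
have [k [Jk Uk nK]] := loc t; exists k; split=> //.
near=> u v => i j iu ku kv jv Ji Jj.
rewrite !trE //.
have : (K u / l k (f u) = K v / l k (f v))%g.
  have -> : (K u / l k (f u) = K t / l k (f t))%g by near: u.
  by symmetry; near: v.
move/(congr1 (fun g => l i (f u) / K u * g * (l k (f v) / l j (f v)))%g).
by rewrite -!mulgA !mulKg.
Unshelve. all: by end_near. Qed.

End Transition.

(** * Presentations *)

Section Presents.
Variables (S : choiceType) (G : groupType) (a : S -> G) (rels : set (word S)).
Local Open Scope group_scope.

Definition word_eval (w : word S) : G :=
  \prod_(l <- w) (if l.2 then a l.1 else (a l.1)^-1).

Lemma word_eval_cat u v : word_eval (u ++ v) = word_eval u * word_eval v.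
Proof. exact: big_cat. Qed.

Hypothesis rels1 : forall r, rels r -> word_eval r = 1.

Lemma word_eval_eq u v : word_eq rels u v -> word_eval u = word_eval v.
Proof.
elim=> {u v} // [u v w _ -> _ -> //|u v s b|u v r /rels1 r1].
  rewrite !word_eval_cat /word_eval !big_cons /=.
  by case: b; rewrite /= ?mulKg ?mulVKg.
by rewrite !word_eval_cat r1 mul1g.
Qed.

Definition pg_eval (x : presented_group rels) : G := word_eval (repr x).

Lemma pg_eval_class w : pg_eval (word_class rels w) = word_eval w.
Proof. exact/word_eval_eq/repr_word_class. Qed.

Lemma pg_evalM : {morph pg_eval : x y / x * y}.
Proof.
move=> x y; rewrite -(word_class_repr x) -(word_class_repr y).
by rewrite [_ * _]pg_mulE !pg_eval_class word_eval_cat.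
Qed.

HB.instance Definition _ := isMultiplicative.Build _ _ pg_eval pg_evalM.

(** Generation makes the evaluation map from the presented group surjective; [h] is a left inverse
    on the generators, hence everywhere, which gives injectivity. *)
Lemma presents_of_retraction (h : G -> presented_group rels) :
  generates a -> {morph h : x y / x * y} -> (forall s, h (a s) = pgen rels s) ->
  presents a rels.
Proof.
move=> gen hM ha.
have h1 : h 1 = 1 by apply: (mulgI (h 1)); rewrite -hM !mulg1.
have hV x : h x^-1 = (h x)^-1.
  by symmetry; apply: mulg1_eq; rewrite -hM mulgV.
have hK : cancel pg_eval h.
  move=> x; rewrite -(word_class_repr x) pg_eval_class.
  elim: (repr x) => [|[s b] w IH]; first by rewrite /word_eval big_nil h1.
  rewrite /word_eval big_cons hM [h (\prod_(l <- w) _)]IH -cat1s -pg_mulE.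
  congr (_ * _); case: b; first exact: ha.
  by rewrite hV ha [LHS]pg_invE.
have Kh x : exists y, pg_eval y = x.
  have /= := gen [pred x | `[< exists y, pg_eval y = x >]] _ _ x.
  move=> H; apply/asboolP; apply: H => [|s].
    split.
      apply/asboolP; exists 1.
      by rewrite -[1]/(word_class _ [::]) pg_eval_class /word_eval big_nil.
    move=> _ _ /asboolP[u <-] /asboolP[v <-]; apply/asboolP; exists (u * v^-1).
    rewrite pg_evalM; congr (_ * _); symmetry; apply: mulg1_eq.
    by rewrite -pg_evalM mulgV -[1]/(word_class _ [::]) pg_eval_class /word_eval big_nil.
  by apply/asboolP; exists (pgen rels s); rewrite pg_eval_class /word_eval big_seq1.
exists pg_eval; split.
  by exists h => // x; have [y <-] := Kh x; rewrite hK.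
by move=> s; rewrite /= pg_eval_class /word_eval big_seq1.
Qed.

End Presents.

Lemma word_eval_squared_product (G : groupType) n (a : 'I_n -> G) :
  (word_eval a (squared_product n) = (\prod_(i < n) a i) * (\prod_(i < n) a i))%g.
Proof. by rewrite word_eval_cat /word_eval big_map enumT. Qed.

(** * Holonomy of local systems *)

Section Lift.
Variables (R : realType) (X : topologicalType) (I : Type) (U : I -> set X).
Variables (Gamma : groupType) (l : I -> X -> Gamma).
Hypothesis openU : forall i, open (U i).
Hypothesis coverU : forall x, exists i, U i x.
Hypothesis l_compat : forall i j x, U i x -> U j x ->
  \forall y \near x, (l i y / l j y = l i x / l j x)%g.
Local Notation path a b := {path I01 R from a to b in X}.

(* [K] is a section, along [h], of the local system whose local sections over
   [U i] are the left translates of [l i]. *)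
Definition is_lift (Y : topologicalType) (D : set Y) (h : Y -> X) (K : Y -> Gamma) :=
  forall y i, D y -> U i (h y) ->
    \forall z \near y, D z -> (K z / l i (h z) = K y / l i (h y))%g.

Section LiftTheory.
Variable Y : topologicalType.
Implicit Types (D : set Y) (h : Y -> X) (K : Y -> Gamma).

(** [is_lift] asks for every chart at a point; one is enough because the quotients [l i / l j] are
    locally constant. *)
Lemma is_lift_some D h K : continuous h ->
  (forall y, D y -> exists2 i, U i (h y) &
    \forall z \near y, D z -> (K z / l i (h z) = K y / l i (h y))%g) ->
  is_lift D h K.
Proof.
move=> ch loc y j Dy Uj; have [i Ui nK] := loc y Dy.
have nl : \forall z \near y, (l i (h z) / l j (h z) = l i (h y) / l j (h y))%g.
  exact: (ch y _ (l_compat Ui Uj)).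
near=> z => Dz.
have : (K z / l i (h z) = K y / l i (h y))%g by move: Dz; near: z.
have : (l i (h z) / l j (h z) = l i (h y) / l j (h y))%g by near: z.
by move=> e1 e2; rewrite -(divgKA (l i (h z))) e1 e2 divgKA.
Unshelve. all: by end_near. Qed.

Lemma is_lift_label D h i : continuous h -> (forall y, D y -> U i (h y)) ->
  is_lift D h (fun y => l i (h y)).
Proof.
move=> ch Ui; apply: is_lift_some => // y Dy; exists i; first exact: Ui.
by near=> z => Dz; rewrite !mulgV.
Unshelve. all: by end_near. Qed.

Lemma eq_is_lift D h h' K : (forall y, D y -> h y = h' y) ->
  is_lift D h K -> is_lift D h' K.
Proof.
move=> hh' KP y i Dy; rewrite -hh' // => Ui.
by apply: filterS (KP y i Dy Ui) => z Kz Dz; rewrite -hh' // Kz.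
Qed.

Lemma is_lift_cst D x g : is_lift D (cst x) (cst g).
Proof. by move=> y i Dy Ui; apply: filterE. Qed.

(** Both lifts are locally left translates of the same [l i], so [K / L] is locally constant along
    [sigma]. *)
Lemma is_lift_unique D h K L (sigma : R -> Y) : is_lift D h K -> is_lift D h L ->
  continuous sigma -> (forall r, 0 <= r <= 1 -> D (sigma r)) ->
  (K (sigma 0%R) / L (sigma 0%R) = K (sigma 1%R) / L (sigma 1%R))%g.
Proof.
move=> KP LP cs Ds.
apply: (@interval_ind _ (fun a b =>
  K (sigma a) / L (sigma a) = K (sigma b) / L (sigma b))%g) => //.
  by move=> u v w _ _ _ _ -> ->.
move=> t t01; have [i Ui] := coverU (h (sigma t)).
have KL : forall z, (K z / l i (h z) = K (sigma t) / l i (h (sigma t)))%g ->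
    (L z / l i (h z) = L (sigma t) / l i (h (sigma t)))%g ->
    (K z / L z = K (sigma t) / L (sigma t))%g.
  move=> z Kz Lz; rewrite -(mulgKA (l i (h z))^-1 (K z) (L z)) Kz Lz.
  exact: mulgKA.
have near_t := cs t _ (filterI (KP _ i (Ds t t01) Ui) (LP _ i (Ds t t01) Ui)).
have [e e0 He] := nbhs_interval (near_t _).
exists e => // u v u0 ut tv v1 eu ev.
have He' r : 0 <= r <= 1 -> t - e < r -> r < t + e ->
    (K (sigma r) / L (sigma r) = K (sigma t) / L (sigma t))%g.
  move=> r01 h1 h2; have [h3 h4] := He r h1 h2.
  by apply: KL; [apply: h3|apply: h4]; exact: Ds.
by rewrite !He' //; lra.
Qed.

Lemma is_lift_glue g D D' h K K' : closed D -> closed D' ->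
  is_lift D h K -> is_lift D' h K' ->
  (forall y, D y -> D' y -> K y = (g * K' y)%g) ->
  is_lift (D `|` D') h (fun y => if `[< D y >] then K y else (g * K' y)%g).
Proof.
move=> cD cD' KP K'P KK'.
have away (E : set Y) y : closed E -> ~ E y -> \forall z \near y, ~ E z.
  by move=> cE Ey; apply: open_nbhs_nbhs; split=> //; exact: closed_openC.
move=> y i Dy Ui; have [Dy1|nDy1] := pselect (D y); last first.
  have D'y : D' y by case: Dy.
  near=> z => Dz; rewrite !asboolF //; last by near: z; exact: away.
  rewrite -!mulgA; congr (_ * _)%g.
  suff: D' z -> (K' z / l i (h z) = K' y / l i (h y))%g.
    by apply; case: Dz => // /[dup] _; suff: ~ D z by []; near: z; exact: away.
  by near: z; exact: K'P.
have [D'y|nD'y] := pselect (D' y); last first.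
  near=> z => Dz; have Dz1 : D z.
    by case: Dz => // D'z; suff: ~ D' z by []; near: z; exact: away.
  rewrite !asboolT //; move: Dz1; near: z; exact: KP.
near=> z => Dz; rewrite (asboolT Dy1).
case: asboolP => [Dz1|nDz1]; first by move: Dz1; near: z; exact: KP.
have D'z : D' z by case: Dz.
rewrite (KK' y) // -!mulgA; congr (_ * _)%g.
by move: D'z; near: z; exact: K'P.
Unshelve. all: by end_near. Qed.

(** The translating constant is forced at [z0]; uniqueness of lifts propagates it over the connected
    overlap. *)
Lemma is_lift_glue_connected z0 D D' h : closed D -> closed D' ->
  (forall z, D z -> D' z -> exists sigma : R -> Y, [/\ continuous sigma,
     sigma 0 = z0, sigma 1 = z & forall r, 0 <= r <= 1 -> D (sigma r) /\ D' (sigma r)]) ->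
  (exists K, is_lift D h K) -> (exists K, is_lift D' h K) ->
  exists K, is_lift (D `|` D') h K.
Proof.
move=> cD cD' conn [K KP] [K' K'P].
pose g := (K z0 / K' z0)%g.
exists (fun y => if `[< D y >] then K y else (g * K' y)%g).
apply: is_lift_glue => // z Dz D'z.
have [sigma [cs s0 s1 Ds]] := conn z Dz D'z.
have KI : is_lift (D `&` D') h K.
  move=> y i [Dy _] Ui; apply: filterS (KP y i Dy Ui) => ? + [? _]; exact.
have K'I : is_lift (D `&` D') h K'.
  move=> y i [_ Dy] Ui; apply: filterS (K'P y i Dy Ui) => ? + [_ ?]; exact.
have := is_lift_unique KI K'I cs Ds; rewrite s0 s1 -/g => ->.
by rewrite mulgVK.
Qed.

End LiftTheory.

Lemma is_lift_comp (Y Z : topologicalType) (D : set Y) (D' : set Z) (h : Y -> X)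
    (K : Y -> Gamma) (sigma : Z -> Y) : continuous sigma ->
  (forall z, D' z -> D (sigma z)) -> is_lift D h K ->
  is_lift D' (h \o sigma) (K \o sigma).
Proof.
move=> cs DD' KP z i D'z Ui.
have H : \forall w \near z, D (sigma w) ->
    (K (sigma w) / l i (h (sigma w)) = K (sigma z) / l i (h (sigma z)))%g.
  exact: (cs z _ (KP (sigma z) i (DD' z D'z) Ui)).
by apply: filterS H => w Kw D'w; apply: Kw; exact: DD'.
Qed.

(** * Lifts over the unit square *)

Section Square.
Variable H : R * R -> X.
Hypothesis cH : continuous H.

Definition rect (a b c d : R) : set (R * R) :=
  [set z | (a <= z.1 <= b) && (c <= z.2 <= d)].

Lemma closed_rect a b c d : closed (rect a b c d).
Proof.
have -> : rect a b c d = (fst @^-1` `[a, b]%classic) `&` (snd @^-1` `[c, d]%classic).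
  apply/seteqP; split=> z; rewrite /rect /= !in_itv /=; first by move/andP.
  by move=> [-> ->].
have cfst : continuous (@fst R R) by move=> ?; exact: cvg_fst.
have csnd : continuous (@snd R R) by move=> ?; exact: cvg_snd.
exact: (closedI ((continuous_closedP _).1 cfst _ (@itv_closed _ R _ _))
  ((continuous_closedP _).1 csnd _ (@itv_closed _ R _ _))).
Qed.

Let has_lift a b c d := exists K, is_lift (rect a b c d) H K.

Let segment (z w : R * R) (r : R) : R * R :=
  ((w.1 - z.1) * r + z.1, (w.2 - z.2) * r + z.2).

Let segment_connected a b c d a' b' c' d' z0 z :
  rect a b c d z0 -> rect a' b' c' d' z0 -> rect a b c d z -> rect a' b' c' d' z ->
  exists sigma : R -> R * R, [/\ continuous sigma, sigma 0 = z0, sigma 1 = z &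
    forall r, 0 <= r <= 1 -> rect a b c d (sigma r) /\ rect a' b' c' d' (sigma r)].
Proof.
move=> r1 r2 r3 r4; exists (segment z0 z); split.
- apply: continuous_pair; apply: continuous_affine => ?; exact: cvg_id.
- by rewrite /segment !mulr0 !add0r -surjective_pairing.
- by rewrite /segment !mulr1 !subrK -surjective_pairing.
have conv (u v w w' r : R) : u <= w <= v -> u <= w' <= v -> 0 <= r <= 1 ->
    u <= (w' - w) * r + w <= v.
  by move=> h1 h2 h3; apply/andP; split; nra.
move=> r r01; move: r1 r2 r3 r4; rewrite /rect /= => /andP[? ?] /andP[? ?].
by move=> /andP[? ?] /andP[? ?]; split; rewrite !conv.
Qed.

Let has_lift_join1 a b b' c d : a <= b -> b <= b' -> c <= d ->
  has_lift a b c d -> has_lift b b' c d -> has_lift a b' c d.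
Proof.
move=> ab bb' cd h1 h2; rewrite /has_lift.
have -> : rect a b' c d = rect a b c d `|` rect b b' c d.
  apply/seteqP; split=> z; rewrite /rect /=; last first.
    by move=> [] /andP[/andP[? ?] ->]; rewrite andbT; apply/andP; split; lra.
  move=> /andP[/andP[az zb] ->]; rewrite !andbT az zb andbT.
  by have [|/ltW] := leP z.1 b; [left|right].
apply: (@is_lift_glue_connected _ (b, c)) => //; try exact: closed_rect.
by move=> z h3 h4; apply: segment_connected; rewrite // /rect /= ?lexx ?ab ?bb' ?cd.
Qed.

Let has_lift_join2 a b c d d' : a <= b -> c <= d -> d <= d' ->
  has_lift a b c d -> has_lift a b d d' -> has_lift a b c d'.
Proof.
move=> ab cd dd' h1 h2; rewrite /has_lift.
have -> : rect a b c d' = rect a b c d `|` rect a b d d'.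
  apply/seteqP; split=> z; rewrite /rect /=; last first.
    by move=> [] /andP[-> /andP[? ?]] /=; apply/andP; split; lra.
  move=> /andP[-> /andP[az zb]] /=; rewrite az zb andbT.
  by have [|/ltW] := leP z.2 d; [left|right].
apply: (@is_lift_glue_connected _ (a, d)) => //; try exact: closed_rect.
by move=> z h3 h4; apply: segment_connected; rewrite // /rect /= ?lexx ?ab ?dd' ?cd.
Qed.

(** Two nested inductions over intervals: around each segment with fixed first coordinate a thin
    rectangle has a lift, and these rectangles are glued along common sides. *)
Lemma square_lift : exists K, is_lift (rect 0 1 0 1) H K.
Proof.
suff : has_lift 0 1 0 1 by [].
apply: (@interval_ind _ (fun a b => has_lift a b 0 1)) => //.
  by move=> u v w _ uv vw _; exact: has_lift_join1.
move=> s _.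
(* The width [e] must come before [a] and [b], uniformly along the segment; joins in the second
   coordinate take the minimum of two widths. *)
suff [e e0 He] : exists2 e, 0 < e & forall a b, a <= s -> s <= b ->
    s - e < a -> b < s + e -> has_lift a b 0 1.
  by exists e => // u v _ us sv _; exact: He.
apply: (@interval_ind _ (fun c d => exists2 e, 0 < e & forall a b,
    a <= s -> s <= b -> s - e < a -> b < s + e -> has_lift a b c d)) => //.
  move=> u v w _ uv vw _ [e e0 He] [e' e'0 He'].
  exists (Num.min e e'); first by rewrite lt_min e0.
  move=> a b as_ sb ea eb.
  apply: (has_lift_join2 (le_trans as_ sb) uv vw); [apply: He|apply: He'] => //;
    by move: ea eb; case: (leP e e') => ?; lra.
move=> t _; have [i Ui] := coverU (H (s, t)).
have [[A B] /= [nA nB] AB] := cH (open_nbhs_nbhs (conj (@openU i) Ui)).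
have [e e0 He] := nbhs_interval nA; have [e' e'0 He'] := nbhs_interval nB.
exists e' => // u v _ ut tv _ eu ev; exists e => // a b as_ sb ea eb.
exists (fun z => l i (H z)); apply: is_lift_label => // z.
rewrite /rect /= => /andP[/andP[? ?] /andP[? ?]].
by apply: AB; split; [apply: He|apply: He']; lra.
Qed.

End Square.

Section Holonomy.

(** A path is treated as a square that does not depend on its first coordinate. *)
Lemma path_lift_exists p q (f : path p q) : exists K, is_lift setT f K.
Proof.
have cf : continuous (fun z : R * R => f (clamp z.2)).
  apply: (@continuous_compT _ _ _ (fun z : R * R => z.2) (fun r => f (clamp r))).
    by move=> ?; exact: cvg_snd.
  exact: lift_continuous.
have [K KP] := square_lift cf.
exists (fun t => K (0, I01_val t)).
have := @is_lift_comp _ (I01 R) _ setT _ _ (fun t => (0, I01_val t)) _ _ KP.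
have cs : continuous (fun t : I01 R => (0 : R, I01_val t)).
  by apply: continuous_pair; [exact: cst_continuous|exact: I01_val_continuous].
move/(_ cs) => H; apply: eq_is_lift; last apply: H.
  by move=> t _ /=; rewrite clampK.
by move=> t _; rewrite /rect /= lexx ler01 I01_bounds.
Qed.

(** Multiplying [K] by a constant on the left does not change this quotient, so it depends on the
    path only. *)
Definition hol p q (f : path p q) : Gamma :=
  let K := projT1 (cid (path_lift_exists f)) in ((K zero)^-1 * K one)%g.

Lemma eq_hol_lift p q (f : path p q) K L : is_lift setT f K -> is_lift setT f L ->
  ((K zero)^-1 * K one = (L zero)^-1 * L one)%g.
Proof.
move=> KP LP; have := is_lift_unique KP LP (@clamp_continuous R) (fun _ _ => Logic.I).
rewrite -I01_zeroE -I01_oneE => /(congr1 (fun g => (K zero)^-1 * g * L one)%g).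
by rewrite -!mulgA mulKg mulVg mulg1.
Qed.

Lemma hol_lift p q (f : path p q) K : is_lift setT f K ->
  hol f = ((K zero)^-1 * K one)%g.
Proof. by move=> KP; rewrite /hol; case: cid => L LP /=; exact: eq_hol_lift LP KP. Qed.

Lemma hol_in i p q (f : path p q) : (forall t, U i (f t)) ->
  hol f = ((l i p)^-1 * l i q)%g.
Proof.
move=> Ui; have H : is_lift setT f (fun t => l i (f t)).
  by apply: is_lift_label => //; exact: cts_fun.
by rewrite (hol_lift H) path_zero path_one.
Qed.

(** A lift over the whole homotopy restricts to lifts of [f] and [g] on two sides of the square; on
    the other two the homotopy rests at [p] or [q], so the lift is constant there. *)
Lemma hol_homotopic p q (f g : path p q) : homotopic f g -> hol f = hol g.
Proof.
move=> [H [cH H0 H1 Hp Hq]].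
have cH' : continuous (fun z : R * R => H (clamp z.1, clamp z.2)).
  apply: (continuous_compT _ cH); apply: continuous_pair.
    by apply: (continuous_compT _ (@clamp_continuous R)) => ?; exact: cvg_fst.
  by apply: (continuous_compT _ (@clamp_continuous R)) => ?; exact: cvg_snd.
have [K KP] := square_lift cH'.
have slice (s : R) p' q' (f' : path p' q') : 0 <= s <= 1 ->
    (forall t, H (clamp s, t) = f' t) ->
    is_lift setT f' (fun t => K (s, I01_val t)).
  move=> s01 Hf.
  have cs : continuous (fun t : I01 R => (s, I01_val t)).
    by apply: continuous_pair; [exact: cst_continuous|exact: I01_val_continuous].
  have cD : forall t : I01 R, setT t -> rect 0 1 0 1 (s, I01_val t).
    by move=> t _; rewrite /rect /= s01 I01_bounds.
  by apply: eq_is_lift (is_lift_comp cs cD KP) => t _ /=; rewrite clampK.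
have edge (t : R) x : 0 <= t <= 1 -> (forall s, H (s, clamp t) = x) -> K (0, t) = K (1, t).
  move=> t01 Hx.
  have cs : continuous (fun s : I01 R => (I01_val s, t)).
    by apply: continuous_pair; [exact: I01_val_continuous|exact: cst_continuous].
  have cD : forall s : I01 R, setT s -> rect 0 1 0 1 (I01_val s, t).
    by move=> s _; rewrite /rect /= t01 I01_bounds.
  have L : is_lift setT (cst x) (fun s : I01 R => K (I01_val s, t)).
    by apply: eq_is_lift (is_lift_comp cs cD KP) => s _ /=.
  have := is_lift_unique L (@is_lift_cst _ setT x 1%g) (@clamp_continuous R) (fun _ _ => Logic.I).
  by rewrite !divg1 !I01_valK ?lexx ?ler01.
rewrite (hol_lift (slice 0 _ _ f _ _)) ?lexx ?ler01 //.
rewrite (hol_lift (slice 1 _ _ g _ _)) ?lexx ?ler01 //.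
rewrite I01_zeroE I01_oneE !I01_valK ?lexx ?ler01 //.
by rewrite (edge 0 p) ?(edge 1 q) ?lexx ?ler01 // -?I01_zeroE -?I01_oneE.
Qed.

Lemma hol_concat p q r (f : path p q) (g : path q r) :
  hol (concat f g) = (hol f * hol g)%g.
Proof.
have [K KP] := path_lift_exists f; have [L LP] := path_lift_exists g.
rewrite (hol_lift KP) (hol_lift LP).
pose D := [set t : I01 R | I01_val t <= 2^-1].
pose D' := [set t : I01 R | 2^-1 <= I01_val t].
have cv := @I01_val_continuous R.
have cD : closed D by exact: ((continuous_closedP _).1 cv _ (@closed_le R 2^-1)).
have cD' : closed D' by exact: ((continuous_closedP _).1 cv _ (@closed_ge R 2^-1)).
pose s1 (t : I01 R) := clamp (2 * I01_val t + 0).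
pose s2 (t : I01 R) := clamp (2 * I01_val t + -1).
have cs1 : continuous s1 by exact: continuous_clamp_affine.
have cs2 : continuous s2 by exact: continuous_clamp_affine.
have K1 : is_lift D (concat f g) (K \o s1).
  apply: eq_is_lift (is_lift_comp cs1 (fun _ _ => Logic.I) KP) => t Dt.
  by rewrite concatE Dt /s1 /= addr0.
have half t : D t -> D' t -> s1 t = one /\ s2 t = zero.
  move=> h1 h2; rewrite I01_oneE I01_zeroE /s1 /s2.
  have -> : I01_val t = 2^-1 by apply/eqP; rewrite eq_le; apply/andP.
  by split; congr clamp; lra.
have L1 : is_lift D' (concat f g) (L \o s2).
  apply: eq_is_lift (is_lift_comp cs2 (fun _ _ => Logic.I) LP) => t D't.
  rewrite concatE /=; case: ifP => // Dt.
  have [e1 e2] := half t Dt D't.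
  have -> : clamp (2 * I01_val t) = s1 t by rewrite /s1 addr0.
  by rewrite e1 e2 path_zero path_one.
(* The lift of [g] is translated to start where the lift of [f] ends. *)
have := @is_lift_glue _ (K one / L zero)%g _ _ _ _ _ cD cD' K1 L1.
have -> : D `|` D' = setT.
  by apply/seteqP; split=> // t _; have [|/ltW] := leP (I01_val t) 2^-1; [left|right].
have KL t : D t -> D' t -> (K \o s1) t = (K one / L zero * (L \o s2) t)%g.
  by move=> h1 h2; have [/= -> ->] := half t h1 h2; rewrite mulgVK.
move/(_ KL)/hol_lift => ->.
have v0 : I01_val (zero : I01 R) = 0 by rewrite I01_zeroE I01_valK ?lexx ?ler01.
have v1 : I01_val (one : I01 R) = 1 by rewrite I01_oneE I01_valK ?lexx ?ler01.
rewrite asboolT; last by rewrite /D /= v0 invr_ge0 ler0n.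
rewrite asboolF; last by rewrite /D /= v1; apply/negP; rewrite -ltNge; lra.
have -> : (K \o s1) zero = K zero.
  by rewrite /= /s1 v0 mulr0 addr0 -I01_zeroE.
have -> : (L \o s2) one = L one.
  by rewrite /= /s2 v1 I01_oneE; congr (L (clamp _)); lra.
by rewrite !mulgA.
Qed.

Lemma hol_cst p : hol (cst_path R p) = 1%g.
Proof. by have [i Ui] := coverU p; rewrite (@hol_in i) // mulVg. Qed.

Lemma hol_rev p q (f : path p q) : hol (path_rev f) = (hol f)^-1%g.
Proof.
symmetry; apply: mulg1_eq; rewrite -hol_concat.
by rewrite (hol_homotopic (homotopic_rev_r f)) hol_cst.
Qed.

Variable x0 : X.

Definition monodromy (a : pi1 R x0) : Gamma := hol (repr a).

Lemma monodromy_class f : monodromy (loop_class f) = hol f.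
Proof. exact/hol_homotopic/repr_loop_class. Qed.

Lemma monodromyM : {morph monodromy : a b / a * b}%g.
Proof.
move=> a b; rewrite -(loop_class_repr a) -(loop_class_repr b) [(_ * _)%g in LHS]pi1_mulE.
by rewrite !monodromy_class hol_concat.
Qed.

Variables (c : I -> X) (tau : forall i, path x0 (c i)).
Hypothesis Uc : forall i p, U i p -> contracts_to R (U i) (c i).

(** A spoke contributes the label at [p] divided by the label at its center, so all that depends on
    [p] is the quotient of labels; the rest is one factor per chart. *)
Lemma monodromy_trans i j p (hi : U i p) (hj : U j p) :
  monodromy (trans Uc tau hi hj) =
  ((hol (tau i) / l i (c i)) * (l i p / l j p) / (hol (tau j) / l j (c j)))%g.
Proof.
have ht k (hk : U k p) : hol (tether Uc tau hk) = (hol (tau k) / l k (c k) * l k p)%g.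
  by rewrite hol_concat (@hol_in k _ _ (spoke Uc hk)) ?mulgA // => t; exact: spoke_in.
rewrite monodromy_class 2!hol_concat hol_rev hol_cst mul1g !ht.
by move: (hol (tau i)) (hol (tau j)) => a b; rewrite !invgM !mulgA.
Qed.

End Holonomy.

End Lift.

(** * Quadratic forms on the plane *)

Section QuadraticForm.
Variable R : realType.
Local Notation C := (Cplx R).
Local Notation poly3 := (mpoly 3 C).
Local Notation row3 := 'rV[C]_3.

(** The differential is carried along with the values so that it can be identified with the polar
    form; [q] need not be symmetric. *)
Definition quadratic_with (q : 'M[C]_3) (G : poly3) : Prop :=
  (forall v, eval3 G v = \sum_k \sum_l q k l * (v 0 k * v 0 l)) /\
  (forall v w, diff3 G v w =
     \sum_k \sum_l q k l * (w 0 k * v 0 l + v 0 k * w 0 l)).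

Lemma diff3D (G H : poly3) v w : diff3 (G + H) v w = diff3 G v w + diff3 H v w.
Proof.
rewrite /diff3 -big_split; apply: eq_bigr => k _.
by rewrite /eval3 mderivD mevalD mulrDl.
Qed.

Lemma diff3Z (G : poly3) c v w : diff3 (c *: G) v w = c * diff3 G v w.
Proof.
rewrite /diff3 mulr_sumr; apply: eq_bigr => k _.
by rewrite /eval3 mderivZ mevalZ mulrA.
Qed.

Lemma diff3M (G H : poly3) v w :
  diff3 (G * H) v w = diff3 G v w * eval3 H v + eval3 G v * diff3 H v w.
Proof.
rewrite /diff3 mulr_suml mulr_sumr -big_split; apply: eq_bigr => k _.
rewrite /eval3 mderivM mevalD !mevalM /= mulrDl.
by congr (_ + _); [exact: mulrAC|rewrite mulrA].
Qed.

Lemma diff3X (k : 'I_3) v w : diff3 (mpolyX C (mnm1 k)) v w = w 0 k.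
Proof.
rewrite /diff3 (bigD1 k) //= big1 => [|j jk].
  by rewrite /eval3 mderivX mevalZ mnm1E eqxx mevalX big1 ?mulr1 ?mul1r ?addr0
    // => i _; rewrite mnmBE subnn.
by rewrite /eval3 mderivX mevalZ mnm1E eq_sym (negbTE jk) !mul0r.
Qed.

Lemma quadratic_with0 : quadratic_with 0 0.
Proof.
split=> [v|v w]; first by rewrite /eval3 meval0 !big1 // => k _; rewrite big1 // => l _;
  rewrite mxE mul0r.
rewrite -[X in diff3 X](scale0r 0) diff3Z mul0r big1 // => k _.
by rewrite big1 // => l _; rewrite mxE mul0r.
Qed.

Lemma quadratic_withD q q' G G' : quadratic_with q G -> quadratic_with q' G' ->
  quadratic_with (q + q') (G + G').
Proof.
move=> [e d] [e' d']; split=> [v|v w].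
  rewrite /eval3 mevalD [meval _ G]e [meval _ G']e' -big_split; apply: eq_bigr => k _.
  by rewrite -big_split; apply: eq_bigr => l _; rewrite mxE /= mulrDl.
rewrite diff3D d d' -big_split; apply: eq_bigr => k _.
by rewrite -big_split; apply: eq_bigr => l _; rewrite mxE /= mulrDl.
Qed.

Lemma quadratic_withZ q c G : quadratic_with q G -> quadratic_with (c *: q) (c *: G).
Proof.
move=> [e d]; split=> [v|v w].
  rewrite /eval3 mevalZ [meval _ G]e mulr_sumr; apply: eq_bigr => k _.
  by rewrite mulr_sumr; apply: eq_bigr => l _; rewrite mxE -mulrA.
rewrite diff3Z d mulr_sumr; apply: eq_bigr => k _.
by rewrite mulr_sumr; apply: eq_bigr => l _; rewrite mxE -mulrA.
Qed.

Lemma sum_delta_mx (i j : 'I_3) (f : 'I_3 -> 'I_3 -> C) :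
  \sum_k \sum_l (delta_mx i j : 'M[C]_3) k l * f k l = f i j.
Proof.
rewrite (bigD1 i) //= [X in _ + X]big1 => [|k /negbTE ki]; last first.
  by rewrite big1 // => l _; rewrite mxE ki mul0r.
rewrite addr0 (bigD1 j) //= big1 => [|l /negbTE lj]; last first.
  by rewrite mxE lj andbF mul0r.
by rewrite mxE !eqxx mul1r addr0.
Qed.

Lemma quadratic_with_monomial (m : multinom 3) : mdeg m = 2%N ->
  exists q, quadratic_with q (mpolyX C m).
Proof.
move=> m2; have [i mi] : exists i, m i != 0%N.
  apply/existsP; apply: contra_eqT m2 => /existsPn h; rewrite mdegE big1 // => i _.
  by have := h i; rewrite negbK => /eqP.
move: mi; rewrite -lep1mP => /submK em.
have /mdeg1P[j /eqP ej] : mdeg (mnm_sub m (mnm1 i)) == 1%N.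
  by move/(congr1 (@mdeg 3)): em; rewrite mdegD mdeg1 m2 addn1 => -[->].
exists (delta_mx i j); rewrite -em ej addmC mpolyXD; split=> [v|v w].
  by rewrite sum_delta_mx /eval3 mevalM !mevalXU.
by rewrite sum_delta_mx diff3M !diff3X /eval3 !mevalXU.
Qed.

Lemma homogeneous_quadratic G : homogeneous 2 G -> exists q, quadratic_with q G.
Proof.
move=> /dhomogP Ghom; rewrite (mpolyE G) big_seq.
apply: (big_ind (fun H => exists q, quadratic_with q H)).
- by exists 0; exact: quadratic_with0.
- by move=> H H' [q qH] [q' qH']; exists (q + q'); exact: quadratic_withD.
- move=> m /Ghom/quadratic_with_monomial[q qm].
  by exists (mcoeff m G *: q); exact: quadratic_withZ.
Qed.

Section Homogeneous2.
Variable G : poly3.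
Hypothesis G2 : homogeneous 2 G.

Lemma eval3D v w : eval3 G (v + w) = eval3 G v + eval3 G w + diff3 G v w.
Proof.
have [q [e d]] := homogeneous_quadratic G2.
rewrite !e d -!big_split; apply: eq_bigr => k _.
by rewrite -!big_split; apply: eq_bigr => l _; rewrite !mxE /=; ring.
Qed.

Lemma eval3Z c v : eval3 G (c *: v) = c ^+ 2 * eval3 G v.
Proof.
have [q [e d]] := homogeneous_quadratic G2.
rewrite !e mulr_sumr; apply: eq_bigr => k _.
by rewrite mulr_sumr; apply: eq_bigr => l _; rewrite !mxE; ring.
Qed.

Lemma diff3C v w : diff3 G v w = diff3 G w v.
Proof. 
apply: (addrI (eval3 G w + eval3 G v)); rewrite -[RHS]eval3D (addrC w) eval3D.
by rewrite (addrC (eval3 G v)). Qed.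

Lemma diff3vv v : diff3 G v v = 2 * eval3 G v.
Proof.
apply: (addrI (eval3 G v + eval3 G v)); rewrite -eval3D -mulr2n -scaler_nat eval3Z.
by ring.
Qed.
End Homogeneous2.

Lemma diff3Dr (G : poly3) v w w' : diff3 G v (w + w') = diff3 G v w + diff3 G v w'.
Proof. by rewrite /diff3 -big_split; apply: eq_bigr => k _; rewrite mxE mulrDr. Qed.

Lemma diff3Zr (G : poly3) v c w : diff3 G v (c *: w) = c * diff3 G v w.
Proof. by rewrite /diff3 mulr_sumr; apply: eq_bigr => k _; rewrite mxE mulrCA. Qed.

Lemma coords_exists (v : row3) : v != 0 -> exists p : P2 R, coords p v.
Proof.
move=> v0; have vP : v \in [set v : 'rV[C]_3 | v != 0] by rewrite inE.
by exists (\pi_(P2 R)%qT (exist _ v vP : hvec R)), (exist _ v vP).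
Qed.

Lemma coords_neq0 (p : P2 R) (v : row3) : coords p v -> v != 0.
Proof. by move=> [u _ <-]; exact: (set_valP u). Qed.

Lemma coords_unique (p : P2 R) (v w : row3) : coords p v -> coords p w ->
  exists2 c : C, c != 0 & w = c *: v.
Proof.
by move=> [u <- <-] [u' /eqquotP + <-] => /asboolP[c c0 e];
  exists c^-1; rewrite ?invr_eq0 // e scalerA mulVf // scale1r.
Qed.

Lemma coordsZ (p : P2 R) (v : row3) (c : C) : c != 0 -> coords p v -> coords p (c *: v).
Proof.
move=> c0 [u up uv]; have v0 : c *: v != 0.
  by rewrite scaler_eq0 (negbTE c0) -uv; exact: (set_valP u).
have [q [u' u'q u'v]] := coords_exists v0.
exists u' => //; rewrite -up; apply/eqquotP/asboolP; exists c^-1.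
  by rewrite invr_eq0.
by rewrite u'v uv scalerA mulVf // scale1r.
Qed.

(** At a vector in the radical of the polar form all partial derivatives vanish and, by Euler's
    identity [diff3vv], so does [G]: the point would be singular. *)
Lemma quadric_nondegenerate (G : poly3) (v : row3) : quadric G -> v != 0 ->
  exists w, diff3 G v w != 0.
Proof.
move=> [G2 Gs] v0; apply: contrapT => h.
have dv w : diff3 G v w = 0 by apply/eqP/negP => /negP dw; apply: h; exists w.
have [p pv] := coords_exists v0.
suff : singular_locus G p by rewrite Gs.
exists v => //; split=> [|k].
  by have := diff3vv G2 v; rewrite dv => /esym/eqP; rewrite mulf_eq0 pnatr_eq0 => /eqP.
have := dv (delta_mx 0 k); rewrite /diff3 (bigD1 k) //= big1 => [|j /negbTE jk].
  by rewrite mxE !eqxx mulr1 addr0.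
by rewrite mxE jk andbF mulr0.
Qed.

Lemma plane_curveE (G : poly3) p v : homogeneous 2 G -> coords p v ->
  plane_curve G p <-> eval3 G v = 0.
Proof.
move=> G2 pv; split=> [[w pw Gw]|]; last by exists v.
by have [c c0 ->] := coords_unique pw pv; rewrite eval3Z // Gw mulr0.
Qed.

End QuadraticForm.

(** * Normal form of the arrangement *)

Section NormalForm.
Variable R : realType.
Local Notation C := (Cplx R).
Local Notation poly3 := (mpoly 3 C).
Local Notation row3 := 'rV[C]_3.

Definition cvec (x y z : C) : row3 := \row_(j < 3) nth 0 [:: x; y; z] j.

Definition rows3 (u v w : row3) : 'M[C]_3 := \matrix_(i < 3) nth 0 [:: u; v; w] i.

Lemma cvec_rows3 x y z u v w :
  cvec x y z *m rows3 u v w = x *: u + y *: v + z *: w.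
Proof.
rewrite mulmx_sum_row !big_ord_recl big_ord0 addr0 !rowK !mxE /=.
by rewrite addrA.
Qed.

Lemma cvec_surj (v : row3) : exists x y z, v = cvec x y z.
Proof.
exists (v 0 0), (v 0 1), (v 0 2); apply/rowP => j; rewrite mxE.
by case: j => [[|[|[|]]]] //= j; congr (v 0 _); apply: val_inj.
Qed.

Lemma cvec_eq x y z x' y' z' : cvec x y z = cvec x' y' z' ->
  [/\ x = x', y = y' & z = z'].
Proof.
by move=> e; split; [have := congr1 (fun v : row3 => v 0 0) e
  |have := congr1 (fun v : row3 => v 0 1) e
  |have := congr1 (fun v : row3 => v 0 2) e]; rewrite !mxE.
Qed.

Lemma cvecZ c x y z : c *: cvec x y z = cvec (c * x) (c * y) (c * z).
Proof. by apply/rowP => -[[|[|[|]]]] // j; rewrite !mxE. Qed.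

Lemma cvecD x y z x' y' z' :
  cvec x y z + cvec x' y' z' = cvec (x + x') (y + y') (z + z').
Proof. by apply/rowP => -[[|[|[|]]]] // j; rewrite !mxE. Qed.

Lemma cvec_eq0 x y z : (cvec x y z == 0) = [&& x == 0, y == 0 & z == 0].
Proof.
apply/eqP/and3P => [e|[/eqP-> /eqP-> /eqP->]]; last first.
  by apply/rowP => -[[|[|[|]]]] // j; rewrite !mxE.
have e0 : cvec x y z = cvec 0 0 0.
  by rewrite e; apply/rowP => -[[|[|[|]]]] // j; rewrite !mxE.
by have [-> -> ->] := cvec_eq e0.
Qed.

Lemma eval3_frame (G : poly3) u v w x y z : homogeneous 2 G ->
  eval3 G (x *: u + y *: v + z *: w) =
  x ^+ 2 * eval3 G u + y ^+ 2 * eval3 G v + z ^+ 2 * eval3 G w +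
  x * y * diff3 G u v + x * z * diff3 G u w + y * z * diff3 G v w.
Proof.
move=> G2; rewrite !eval3D // !eval3Z // !diff3Zr (diff3C G2 (x *: u + _) w) diff3Dr.
rewrite !diff3Zr (diff3C G2 w v) (diff3C G2 w u) (diff3C G2 (x *: u) v) diff3Zr.
rewrite (diff3C G2 v u) mulrDr !mulrA (mulrC y x) (mulrC z x) (mulrC z y) !addrA.
by congr (_ + _ + _); exact: addrAC.
Qed.

(** Splits off a hyperbolic plane: [e2] is an isotropic vector paired with [e1], and [u] spans the
    orthogonal complement. In this frame [G] is [x^2 + y z]. *)
Lemma isotropic_frame (G : poly3) (e1 : row3) : quadric G -> e1 != 0 ->
  eval3 G e1 = 0 -> exists u e2 : row3, [/\ rows3 u e1 e2 \in unitmx,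
    eval3 G u = 1, eval3 G e2 = 0, diff3 G e1 e2 = 1 &
    diff3 G u e1 = 0 /\ diff3 G u e2 = 0].
Proof.
move=> Gq e10 Ge1; have [G2 _] := Gq.
have [w0 bw0] := quadric_nondegenerate Gq e10.
have b11 : diff3 G e1 e1 = 0 by rewrite diff3vv // Ge1 mulr0.
have [e2 Ge2 b12] : exists2 e2, eval3 G e2 = 0 & diff3 G e1 e2 = 1.
  have [w bw] : exists w, diff3 G e1 w = 1.
    by exists ((diff3 G e1 w0)^-1 *: w0); rewrite diff3Zr mulVf.
  (* Adding this multiple of the isotropic [e1] cancels [eval3 G w] and keeps the pairing with
     [e1]. *)
  exists (w + (- eval3 G w) *: e1); last by rewrite diff3Dr diff3Zr b11 mulr0 addr0.
  by rewrite eval3D // eval3Z // Ge1 mulr0 addr0 diff3Zr (diff3C G2) bw mulr1 subrr.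
have b21 : diff3 G e2 e1 = 1 by rewrite (diff3C G2).
have b22 : diff3 G e2 e2 = 0 by rewrite diff3vv // Ge2 mulr0.
have [u0 u00 [b1u0 b2u0]] : exists2 u0, u0 != 0 & diff3 G e1 u0 = 0 /\ diff3 G e2 u0 = 0.
  (* Two linear conditions in dimension 3 have a nonzero common solution. *)
  pose A : 'M[C]_(3, 2) := \matrix_(k, j)
    (if j == 0 then eval3 (mderiv k G) e1 else eval3 (mderiv k G) e2).
  have : kermx A != 0.
    rewrite -mxrank_eq0 mxrank_ker subn_eq0 -ltnNge.
    by rewrite (leq_ltn_trans (rank_leq_col A)).
  move=> /rowV0Pn[u0 /sub_kermxP uA u00]; exists u0 => //.
  have uA' j : \sum_k u0 0 k * A k j = 0.
    by have := congr1 (fun B : 'rV_2 => B 0 j) uA; rewrite !mxE.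
  split; [apply: etrans (uA' 0)|apply: etrans (uA' 1)];
    by apply: eq_bigr => k _; rewrite mxE mulrC.
have free u : u != 0 -> diff3 G e1 u = 0 -> diff3 G e2 u = 0 ->
    rows3 u e1 e2 \in unitmx.
  move=> u_neq0 b1u b2u; rewrite -row_free_unit -kermx_eq0.
  apply/rowV0P => v /sub_kermxP.
  have [x [y [z ->]]] := cvec_surj v; rewrite cvec_rows3 => e.
  have D0 (a : row3) : diff3 G a 0 = 0 by rewrite -[0](scale0r 0) diff3Zr mul0r.
  have := D0 e2; rewrite -e !diff3Dr !diff3Zr b2u b21 b22 mulr0 add0r mulr1 mulr0 addr0 => y0.
  have := D0 e1; rewrite -e !diff3Dr !diff3Zr b1u b11 b12 !mulr0 !add0r mulr1 => z0.
  move: e; rewrite y0 z0 !scale0r !addr0 => /eqP; rewrite scaler_eq0 (negbTE u_neq0) orbF.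
  by move=> /eqP->; apply/eqP; rewrite scale0r cvec_eq0 !eqxx.
(* Otherwise [u0] would be orthogonal to the whole frame, against nondegeneracy. *)
have Gu0 : eval3 G u0 != 0.
  apply/eqP => Gu0.
  have [a /negP] := quadric_nondegenerate Gq u00; apply; apply/eqP.
  rewrite -(mulmxKV (free u0 u00 b1u0 b2u0) a).
  have [x [y [z ->]]] := cvec_surj (a *m invmx (rows3 u0 e1 e2)).
  rewrite cvec_rows3 !diff3Dr !diff3Zr diff3vv // Gu0.
  by rewrite (diff3C G2 u0 e1) (diff3C G2 u0 e2) b1u0 b2u0 !mulr0 !addr0.
pose c := (sqrtC (eval3 G u0))^-1.
have c0 : c != 0 by rewrite invr_eq0 sqrtC_eq0.
have b1u : diff3 G e1 (c *: u0) = 0 by rewrite diff3Zr b1u0 mulr0.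
have b2u : diff3 G e2 (c *: u0) = 0 by rewrite diff3Zr b2u0 mulr0.
exists (c *: u0), e2; split=> //.
- by apply: free; rewrite // scaler_eq0 negb_or c0.
- by rewrite eval3Z // exprVn sqrtCK mulVf.
- by rewrite !(diff3C G2 (c *: u0)).
Qed.

Lemma poly_without_root (p : {poly C}) : (forall x, p.[x] != 0) ->
  forall i, (0 < i)%N -> p`_i = 0.
Proof.
move=> p0 i i0; have /negbNE/eqP sp : ~~ (size p != 1%N).
  by apply/closed_rootP => -[x /eqP]; apply/eqP.
by rewrite nth_default // sp.
Qed.

(* The points [s u - s^2 e1 + e2] are those of the conic [y z + x^2 = 0] other
   than [e1]; along them [G] is a polynomial in [s] without roots, so a constant. *)
Lemma hyperosculating_conic (G : poly3) u e1 e2 : quadric G ->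
  rows3 u e1 e2 \in unitmx -> eval3 G e1 = 0 ->
  (forall s : C, eval3 G (s *: u + - s ^+ 2 *: e1 + 1 *: e2) != 0) ->
  exists2 a : C, a != 0 & exists c : C, forall x y z : C,
    eval3 G (x *: u + y *: e1 + z *: e2) = a * (y * z + x ^+ 2 - c * z ^+ 2).
Proof.
move=> Gq Mu Ge1 G0; have [G2 _] := Gq.
(* There is no term of degree 4 since [e1] lies on [G]. Vanishing of the other coefficients of
   positive degree leaves only [x^2], [y z] and [z^2], the first two with equal coefficients. *)
pose p : {poly C} := Poly [:: eval3 G e2; diff3 G u e2;
  eval3 G u - diff3 G e1 e2; - diff3 G u e1].
have pE s : p.[s] = eval3 G (s *: u + - s ^+ 2 *: e1 + 1 *: e2).
  by rewrite eval3_frame // Ge1 horner_Poly /=; ring.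
have p0 := poly_without_root (fun s => eq_ind_r (fun x => x != 0) (G0 s) (pE s)).
have := p0 1%N isT; have := p0 2%N isT; have := p0 3%N isT; rewrite !coef_Poly /=.
move=> /eqP; rewrite oppr_eq0 => /eqP bu1 /eqP; rewrite subr_eq0 => /eqP Gu bu2.
have Gu0 : eval3 G u != 0.
  apply/eqP => Gu0.
  have u0 : u != 0.
    apply/eqP => u0.
    have : cvec 1 0 0 *m rows3 u e1 e2 = 0.
      by rewrite cvec_rows3 scale1r !scale0r !addr0.
    move/(congr1 (mulmx^~ (invmx (rows3 u e1 e2)))); rewrite mulmxK // mul0mx => /eqP.
    by rewrite cvec_eq0 oner_eq0.
  have [a] := quadric_nondegenerate Gq u0; rewrite -(mulmxKV Mu a).
  have [x [y [z ->]]] := cvec_surj (a *m invmx (rows3 u e1 e2)).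
  rewrite cvec_rows3 !diff3Dr !diff3Zr diff3vv // Gu0 bu1 bu2.
  by rewrite !mulr0 !addr0 eqxx.
exists (eval3 G u) => //; exists (- eval3 G e2 / eval3 G u) => x y z.
by rewrite eval3_frame // Ge1 bu1 bu2 -Gu; field.
Qed.
End NormalForm.

(** * Spreading the constants of the conics *)

Section Separation.
Variable R : realType.
Local Notation C := (Cplx R).

Lemma Re_mul (z w : C) : complex.Re (z * w) =
  complex.Re z * complex.Re w - complex.Im z * complex.Im w.
Proof. by case: z => a b; case: w. Qed.

(** The real part of [T (1 + N i) z] is [T (Re z - N Im z)]: [N] exceeds every slope, so no
    difference is killed, and [T] makes them large. A change of frame acts on the constants by
    [k^2]; the distance 4 keeps bumps of radius 2 apart. *)
Lemma exists_separating_scale n (c : 'I_n -> C) : injective c ->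
  exists2 k : C, k != 0 & forall i j, i != j ->
    4 <= `|complex.Re (k ^+ 2 * (c i - c j))|.
Proof.
move=> cI.
pose re i j := complex.Re (c i - c j); pose im i j := complex.Im (c i - c j).
have dif i j : i != j -> (re i j != 0) || (im i j != 0).
  move=> ij; rewrite -negb_and; apply: contra ij => /andP[/eqP h1 /eqP h2].
  have : c i - c j = 0 by apply/eqP; rewrite eq_complex; apply/andP; split; apply/eqP.
  by move/eqP; rewrite subr_eq0 => /eqP/cI ->.
pose N := 1 + \sum_i \sum_j `|re i j / im i j|.
have ge1 (f : 'I_n -> 'I_n -> R) i j : (forall k l, 0 <= f k l) ->
    f i j <= \sum_k \sum_l f k l.
  move=> f0; rewrite (bigD1 i) //= (bigD1 j) //= -addrA lerDl addr_ge0 //.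
    by apply: sumr_ge0.
  by apply: sumr_ge0 => k _; apply: sumr_ge0.
have dirP i j : i != j -> re i j - N * im i j != 0.
  move=> /dif ij; apply/eqP => e.
  have [im0|im0] := eqVneq (im i j) 0.
    by move: ij e; rewrite im0 eqxx orbF mulr0 subr0 => /eqP.
  have NE : N = re i j / im i j by move/eqP: e; rewrite subr_eq0 => /eqP ->; rewrite mulfK.
  have := ge1 (fun k l => `|re k l / im k l|) i j (fun _ _ => normr_ge0 _).
  rewrite -NE; have N0 : 0 <= N.
    by rewrite addr_ge0 // sumr_ge0 // => k _; rewrite sumr_ge0.
  by rewrite ger0_norm // /N => ?; lra.
pose T := 1 + \sum_i \sum_j `|4 / (re i j - N * im i j)|.
have T0 : 0 < T.
  by rewrite ltr_pwDl // sumr_ge0 // => k _; rewrite sumr_ge0.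
pose mu : C := (T +i* (T * N))%C.
exists (sqrtC mu) => [|i j ij].
  rewrite sqrtC_eq0; apply/eqP => /(congr1 (@complex.Re R)) /=.
  by move/eqP; rewrite (gt_eqF T0).
have -> : sqrtC mu ^+ 2 * (c i - c j) = mu * (c i - c j) by rewrite sqrtCK.
rewrite Re_mul [complex.Re mu]/= [complex.Im mu]/= -/(re i j) -/(im i j).
have -> : T * re i j - T * N * im i j = T * (re i j - N * im i j) by ring.
have d0 := dirP i j ij; rewrite normrM gtr0_norm //.
rewrite -ler_pdivrMr ?normr_gt0 //.
have := ge1 (fun k l => `|4 / (re k l - N * im k l)|) i j (fun _ _ => normr_ge0 _).
by rewrite normf_div (@ger0_norm _ 4) ?ler0n // /T => ?; lra.
Qed.

End Separation.

(** * The common frame of the conics *)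

Section ConicsNormalForm.
Variables (R : realType) (n : nat).
Local Notation C := (Cplx R).
Variables (F : 'I_n -> mpoly 3 C) (n_ge1 : (1 <= n)%N).
Hypothesis F_quadric : forall i, quadric (F i).
Hypothesis F_distinct : injective (fun i => plane_curve (F i)).
Hypothesis F_tangent : exists p : P2 R, (forall i, plane_curve (F i) p) /\
  (forall i j, i != j -> plane_curve (F i) `&` plane_curve (F j) = [set p]).

Lemma rows3_scale (u v w : 'rV[C]_3) (a b : C) :
  rows3 u (a *: v) (b *: w) = diag_mx (cvec 1 a b) *m rows3 u v w.
Proof.
apply/matrixP => i j; rewrite mul_diag_mx !mxE.
by case: i => [[|[|[|]]]] //= _; rewrite ?mul1r ?mxE.
Qed.

(** One conic is put in normal form with [e1] at the common point. Any other meets it nowhere else,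
    so [hyperosculating_conic] places it in the pencil spanned by the first and the doubled tangent
    [z^2]. *)
Lemma conics_common_frame : exists u e1 e2 : 'rV[C]_3, exists a c : 'I_n -> C,
  [/\ rows3 u e1 e2 \in unitmx, forall j, a j != 0 & forall j x y z,
    eval3 (F j) (x *: u + y *: e1 + z *: e2) =
      a j * (y * z + x ^+ 2 - c j * z ^+ 2)].
Proof.
have [p [Fp Fpp]] := F_tangent; pose i0 := Ordinal n_ge1.
have F2 i : homogeneous 2 (F i) by case: (F_quadric i).
have [e1 pe1 _] := Fp i0.
have Fe1 j : eval3 (F j) e1 = 0 by apply/(plane_curveE (F2 j) pe1).
have [u [e2 [Mu Fu Fe2 b12 [bu1 bu2]]]] :=
  isotropic_frame (F_quadric i0) (coords_neq0 pe1) (Fe1 i0).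
have F0 x y z : eval3 (F i0) (x *: u + y *: e1 + z *: e2) = y * z + x ^+ 2.
  by rewrite eval3_frame // Fu Fe2 b12 bu1 bu2 Fe1; ring.
have loc j : exists ac : C * C, ac.1 != 0 /\ forall x y z,
    eval3 (F j) (x *: u + y *: e1 + z *: e2) = ac.1 * (y * z + x ^+ 2 - ac.2 * z ^+ 2).
  have [->|ji] := eqVneq j i0.
    by exists (1, 0); rewrite /= oner_eq0; split=> // x y z; rewrite F0; ring.
  have [|a a0 [c acP]] := hyperosculating_conic (F_quadric j) Mu (Fe1 j); last by exists (a, c).
  (* This is a point of the first conic with [z = 1]; on the second conic as well, it would be the
     common point, whose last coordinate is 0. *)
  move=> s; apply/eqP => Fs.
  have vE : s *: u + - s ^+ 2 *: e1 + 1 *: e2 = cvec s (- s ^+ 2) 1 *m rows3 u e1 e2.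
    by rewrite cvec_rows3.
  have v0 : s *: u + - s ^+ 2 *: e1 + 1 *: e2 != 0.
    rewrite vE; apply/eqP => /(congr1 (mulmx^~ (invmx (rows3 u e1 e2)))).
    rewrite mulmxK // mul0mx => /eqP; rewrite cvec_eq0 oner_eq0.
    by rewrite !andbF.
  have [r rv] := coords_exists v0.
  have rp : r = p.
    suff : (plane_curve (F j) `&` plane_curve (F i0)) r by rewrite Fpp.
    by split; apply/(plane_curveE (F2 _) rv); rewrite ?F0 //; ring.
  rewrite rp vE in rv; have [d _] := coords_unique pe1 rv.
  have e1E : d *: e1 = (d *: cvec 0 1 0) *m rows3 u e1 e2.
    by rewrite -scalemxAl cvec_rows3 !scale0r scale1r add0r addr0.
  rewrite e1E => /(congr1 (mulmx^~ (invmx (rows3 u e1 e2)))); rewrite !mulmxK // cvecZ.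
  by move=> /cvec_eq[_ _ /eqP]; rewrite mulr0 oner_eq0.
have [ac acP] := choice loc.
exists u, e1, e2, (fun j => (ac j).1), (fun j => (ac j).2).
by split=> // j; have [] := acP j.
Qed.

Lemma conics_normal_form : exists (M : 'M[C]_3) (a c : 'I_n -> C),
  [/\ M \in unitmx, forall j, a j != 0,
    forall j x y z, eval3 (F j) (cvec x y z *m M) =
      a j * (y * z + x ^+ 2 - c j * z ^+ 2) &
    forall i j, i != j -> 4 <= `|complex.Re (c i) - complex.Re (c j)|].
Proof.
have [u [e1 [e2 [a [c [Mu a0 FE]]]]]] := conics_common_frame.
have cI : injective c.
  move=> i j cij; apply: F_distinct => /=.
  have F2 k : homogeneous 2 (F k) by case: (F_quadric k).
  have zero k v : exists x y z, (eval3 (F k) v == 0) = (y * z + x ^+ 2 - c k * z ^+ 2 == 0)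
      /\ v = cvec x y z *m rows3 u e1 e2.
    have [x [y [z e]]] := cvec_surj (v *m invmx (rows3 u e1 e2)).
    exists x, y, z; have -> : v = cvec x y z *m rows3 u e1 e2 by rewrite -e mulmxKV.
    by rewrite cvec_rows3 FE mulf_eq0 (negbTE (a0 k)).
  have sub k l : c k = c l -> plane_curve (F k) `<=` plane_curve (F l).
    move=> ckl p [v pv /eqP]; have [x [y [z [-> vE]]]] := zero k v => /eqP e.
    by exists v => //; rewrite vE cvec_rows3 FE -ckl e mulr0.
  by apply/seteqP; split; apply: sub.
have [k k0 sep] := exists_separating_scale cI.
(* This rescaling keeps [y z] and multiplies [z^2] by [k^2]. *)
exists (rows3 u (k^-1 *: e1) (k *: e2)), a, (fun j => k ^+ 2 * c j).
split; [|exact: a0| |].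
- rewrite rows3_scale unitmx_mul Mu andbT unitmxE det_diag unitfE.
  by apply/prodf_neq0 => -[[|[|[|]]]] // j _; rewrite mxE /= ?oner_eq0 ?invr_eq0.
- by move=> j x y z; rewrite cvec_rows3 !scalerA FE; field.
- move=> i j ij; have := sep i j ij; rewrite mulrBr.
  by case: (k ^+ 2 * c i) => ? ?; case: (k ^+ 2 * c j).
Qed.

End ConicsNormalForm.

(** * Continuity of complex coordinates *)

Section ComplexContinuity.
Variable R : realType.
Local Notation C := (Cplx R).
Variable T : topologicalType.
Implicit Types (t : T) (f g h : T -> C).

Lemma normc_real (x : R) : `|x%:C%C| = (`|x|%:C)%C :> R[i].
Proof. by rewrite normc_def /= expr0n addr0 sqrtr_sqr. Qed.

Lemma ReB (z w : C) : complex.Re (z - w) = complex.Re z - complex.Re w.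
Proof. by case: z; case: w. Qed.

Lemma Re_continuous : continuous (fun z : C => complex.Re z).
Proof.
move=> z; apply/(@cvgrPdist_lt _ _ _ (nbhs z) (nbhs_filter z)) => e e0.
(* Balls of [C] have their radii in [C]. *)
have e0' : 0 < (e%:C)%C :> C by rewrite ltcR.
have nb : \forall w \near z, ball z ((e%:C)%C : C) w by exact: nbhsx_ballx.
near=> w; have : ball z ((e%:C)%C : C) w by near: w; exact: nb.
rewrite -ball_normE /= => zw.
by rewrite -ReB -ltcR; apply: le_lt_trans zw; exact: normc_ge_Re.
Unshelve. all: by end_near. Qed.

Lemma ImE (z : C) : complex.Im z = - complex.Re (z * 'i%C).
Proof. by case: z => a b; rewrite /= mulr1 mulr0 sub0r opprK. Qed.

Lemma Im_continuous : continuous (fun z : C => complex.Im z).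
Proof.
have -> : (fun z : C => complex.Im z) = - (fun z : C => complex.Re (z * 'i%C)).
  by apply/funext => z; rewrite ImE.
move=> z; apply: continuousN; apply: (continuous_compT _ Re_continuous) => w.
by apply: (@continuousM C C id (cst 'i%C)) ; [by move=> A wA; exact: wA|exact: cst_continuous].
Qed.

Lemma real_complex_continuous : continuous (fun x : R => (x%:C)%C : C).
Proof.
move=> x; apply/cvgrPdist_lt => /= e e0.
have [eI eR] : complex.Im e = 0 /\ 0 < complex.Re e.
  by move: e0; rewrite ltcE /= => /andP[/eqP -> ->].
have eE : e = ((complex.Re e)%:C)%C by case: e eI {e0 eR} => ? ? /= ->.
have nb : \forall y \near x, ball x (complex.Re e) y by exact: nbhsx_ballx.
near=> y; have : ball x (complex.Re e) y by near: y; exact: nb.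
rewrite -ball_normE /= => xy.
by rewrite -rmorphB /= [`|_|]normc_real eE ltcR.
Unshelve. all: by end_near. Qed.

Lemma continuous_complex (f g : T -> R) t :
  {for t, continuous f} -> {for t, continuous g} ->
  {for t, continuous (fun s => (f s +i* g s)%C : C)}.
Proof.
move=> cf cg.
have -> : (fun s => (f s +i* g s)%C : C) =
    (fun s => (f s)%:C%C : C) \+ ((fun=> 'i%C) \* (fun s => (g s)%:C%C : C)).
  by apply/funext => s; rewrite [LHS]complexE.
apply: continuousD; first by apply: continuous_comp => //; exact: real_complex_continuous.
apply: continuousM; first exact: cst_continuous.
by apply: continuous_comp => //; exact: real_complex_continuous.
Qed.

Lemma continuous_row m (f : T -> 'rV[C]_m) t :
  (forall j, {for t, continuous (fun s => f s 0 j)}) -> {for t, continuous f}.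
Proof.
move=> cf A [P PM PA].
have : \forall s \near t, forall j, P 0 j (f s 0 j).
  by apply: filter_forall => j; apply: (cf j); exact: PM.
by apply: filterS => s Ps; apply: PA => i j; rewrite (ord1 i).
Qed.

Lemma continuous_cvec f g h t : {for t, continuous f} -> {for t, continuous g} ->
  {for t, continuous h} -> {for t, continuous (fun s => cvec (f s) (g s) (h s))}.
Proof.
move=> cf cg ch; apply: continuous_row => j.
have -> : (fun s => cvec (f s) (g s) (h s) 0 j) = nth f [:: f; g; h] j.
  by apply/funext => s; rewrite mxE; case: j => [[|[|[|]]]].
case: (nat_of_ord j) => [|[|[|[|m]]]]; [exact: cf|exact: cg|exact: ch|exact: cf|exact: cf].
Qed.

Lemma continuous_mulmx (f : T -> 'rV[C]_3) (M : 'M[C]_3) t :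
  {for t, continuous f} -> {for t, continuous (fun s => f s *m M)}.
Proof.
move=> cf; apply: continuous_row => j.
have -> : (fun s => (f s *m M) 0 j) = fun s => \sum_k (f s 0 k * M k j).
  by apply/funext => s; rewrite mxE.
apply: cvg_big => [|k _]; first exact: add_continuous.
apply: cvgM; last exact: cvg_cst.
by apply: (@continuous_comp _ _ _ f (fun v : 'rV[C]_3 => v 0 k)) => //; exact: coord_continuous.
Qed.

Lemma near_neq0 f t : {for t, continuous f} -> f t != 0 ->
  \forall s \near t, f s != 0.
Proof. by move=> cf; exact: cvgr_neq0. Qed.

End ComplexContinuity.

(** * Points of the complement in homogeneous coordinates *)

Section Points.
Variables (R : realType) (n : nat).
Local Notation C := (Cplx R).
Local Notation row3 := 'rV[C]_3.
Variables (F : 'I_n -> mpoly 3 C) (M : 'M[C]_3) (a c : 'I_n -> C).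
Hypothesis n_ge1 : (1 <= n)%N.
Hypothesis F2 : forall j, homogeneous 2 (F j).
Hypothesis Mu : M \in unitmx.
Hypothesis a_neq0 : forall j, a j != 0.
Hypothesis FE : forall j x y z, eval3 (F j) (cvec x y z *m M) =
  a j * (y * z + x ^+ 2 - c j * z ^+ 2).
Local Notation X := (complement F).
Variable x0 : X.

Definition off_conics (x y z : C) : Prop :=
  forall j, y * z + x ^+ 2 - c j * z ^+ 2 != 0.

Lemma arrangement_off p x y z : coords p (cvec x y z *m M) ->
  (~` arrangement F) p <-> off_conics x y z.
Proof.
move=> pv; split=> [Fp j|h [j _ /(plane_curveE (F2 j) pv)]].
  apply/eqP => e; apply: Fp; exists j => //.
  by apply/(plane_curveE (F2 j) pv); rewrite FE e mulr0.
by rewrite FE => /eqP; rewrite mulf_eq0 (negbTE (a_neq0 j)) (negbTE (h j)).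
Qed.

Lemma mulmxM_eq0 (v : row3) : (v *m M == 0) = (v == 0).
Proof.
apply/eqP/eqP => [|->]; last exact: mul0mx.
by move/(congr1 (mulmx^~ (invmx M))); rewrite mulmxK // mul0mx.
Qed.

Lemma off_conics_point x y z : off_conics x y z ->
  exists q : X, coords (complement_val q) (cvec x y z *m M).
Proof.
move=> h; have v0 : cvec x y z *m M != 0.
  rewrite mulmxM_eq0; apply/eqP => /eqP; rewrite cvec_eq0 => /and3P[/eqP ex /eqP ey /eqP ez].
  by have := h (Ordinal n_ge1); rewrite ex ez mulr0 expr0n mulr0 subr0 addr0 eqxx.
have [p pv] := coords_exists v0.
have Fp : p \in ~` arrangement F by apply/mem_set/(arrangement_off pv).
by exists (exist _ p Fp : X); rewrite /complement_val set_valE.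
Qed.

Lemma complement_coords (q : X) : exists v : row3, coords (complement_val q) (v *m M).
Proof.
have [v qv] : exists v : row3, coords (complement_val q) v.
  by exists (hvec_val (repr (complement_val q))), (repr (complement_val q)) => //; rewrite reprK.
by exists (v *m invmx M); rewrite mulmxKV.
Qed.

(** An arbitrary choice of coordinates, with no continuity; ratios of its entries will be
    continuous. *)
Definition ncv (q : X) : row3 := projT1 (cid (complement_coords q)).

Lemma ncvP q : coords (complement_val q) (ncv q *m M).
Proof. by rewrite /ncv; case: cid. Qed.

Lemma ncv_unique (q : X) v : coords (complement_val q) (v *m M) ->
  exists2 k : C, k != 0 & ncv q = k *: v.
Proof.
move=> qv; have [k k0 e] := coords_unique qv (ncvP q).
by exists k => //; rewrite -(mulmxK Mu (ncv q)) e scalemxAl mulmxK.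
Qed.

Lemma complement_off (q : X) x y z : coords (complement_val q) (cvec x y z *m M) ->
  off_conics x y z.
Proof. by move=> qv; apply/(arrangement_off qv); exact: (set_valP q). Qed.

Lemma coords_inj (q q' : X) v : coords (complement_val q) v ->
  coords (complement_val q') v -> q = q'.
Proof.
move=> [u uq uv] [u' uq' uv']; rewrite /complement_val !set_valE in uq uq'.
apply: val_inj; rewrite -uq -uq'; congr (\pi_(P2 R)%qT _).
by move: uv'; rewrite -uv /hvec_val !set_valE => /val_inj.
Qed.

(** Made total, with value [x0] on the conics, so that continuity can be stated point by point. *)
Definition npt (x y z : C) : X :=
  if pselect (off_conics x y z) is left h then projT1 (cid (off_conics_point h)) else x0.

Lemma nptP x y z : off_conics x y z ->
  coords (complement_val (npt x y z)) (cvec x y z *m M).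
Proof. by move=> h; rewrite /npt; case: pselect => // h'; case: cid. Qed.

Lemma npt_eq (q : X) x y z : coords (complement_val q) (cvec x y z *m M) -> npt x y z = q.
Proof. by move=> qv; apply: (coords_inj _ qv); apply: nptP; exact: complement_off qv. Qed.

Lemma npt_continuous (T : topologicalType) (f g h : T -> C) t :
  {for t, continuous f} -> {for t, continuous g} -> {for t, continuous h} ->
  off_conics (f t) (g t) (h t) ->
  {for t, continuous (fun s => npt (f s) (g s) (h s))}.
Proof.
move=> cf cg ch offt.
pose v s := cvec (f s) (g s) (h s) *m M.
have cv : {for t, continuous v}.
  apply: (@continuous_mulmx _ _ (fun s => cvec (f s) (g s) (h s)) M t).
  exact: (continuous_cvec cf cg ch).
have cq j : {for t, continuous (fun s => g s * h s + f s ^+ 2 - c j * h s ^+ 2)}.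
  have -> : (fun s => g s * h s + f s ^+ 2 - c j * h s ^+ 2) =
      (g \* h \+ f \* f) \- (cst (c j) \* (h \* h)).
    by apply/funext => s; rewrite /= !expr2.
  have cc : {for t, continuous (cst (c j) : T -> C)} by exact: cst_continuous.
  exact: (continuousB (continuousD (continuousM cg ch) (continuousM cf cf))
    (continuousM cc (continuousM ch ch))).
have noff : \forall s \near t, off_conics (f s) (g s) (h s).
  by apply: filter_forall => j; exact: (near_neq0 (cq j) (offt j)).
move=> W; rewrite nbhsE => -[B [oB Bt] BW].
(* An open set of the complement is the trace of one of the plane, whose preimage among the nonzero
   vectors is the trace of an open set of vectors. *)
have [B1 oB1 B1E] := oB; have [B2 oB2 B2E] := oB1.
have inO q : B q = B1 (complement_val q) by rewrite -B1E.
have inO1 u : B1 (\pi_(P2 R)%qT u) = B2 (hvec_val u).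
  by have := congr1 (fun A : set (hvec R) => A u) B2E.
have near_v : \forall s \near t, B2 (v s).
  apply: cv; apply: open_nbhs_nbhs; split=> //.
  by have [u uq uv] := nptP offt; rewrite /v -uv -inO1 uq -inO.
suff : \forall s \near t, W (npt (f s) (g s) (h s)) by [].
near=> s; apply: BW => /=.
have offs : off_conics (f s) (g s) (h s) by near: s.
have [u uq uv] := nptP offs.
by rewrite inO -uq inO1 uv; near: s.
Unshelve. all: by end_near. Qed.

Lemma chart_open (V : set row3) : open V ->
  (forall v k, k != 0 -> V v -> V (k *: v)) ->
  open [set q : X | exists2 v, coords (complement_val q) (v *m M) & V v].
Proof.
move=> oV hom; pose V' : set row3 := (fun w => w *m invmx M) @^-1` V.
have oV' : open V'.
  apply: open_comp oV => w _; apply: continuous_mulmx.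
  by move=> A wA; exact: wA.
pose B : set (P2 R) := [set p | exists2 w, coords p (w *m M) & V w].
suff oB : open B by exists B.
exists V' => //; apply/seteqP; split=> u /=.
  move=> Vu; exists (hvec_val u *m invmx M) => //; rewrite mulmxKV //.
  by exists u.
move=> [w [u' uu' u'w] Vw].
have [k k0 e] := coords_unique (ex_intro2 _ _ u' uu' u'w) (ex_intro2 _ _ u erefl erefl).
suff : V (hvec_val u *m invmx M) by [].
by rewrite e -scalemxAl mulmxK //; exact: hom.
Qed.

(** A function of degree 0 in the coordinates descends to the quotient with its continuity. Passing
    to the interior of [W] yields an open cone, to which [chart_open] applies. *)
Lemma chart_continuous (T : topologicalType) (phi : row3 -> T) (D : set row3)
    (Phi : X -> T) : open D ->
  (forall v k, k != 0 -> D v -> D (k *: v) /\ phi (k *: v) = phi v) ->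
  (forall v, D v -> {for v, continuous phi}) ->
  (forall (q : X) v, coords (complement_val q) (v *m M) -> D v -> Phi q = phi v) ->
  forall (q : X) v, coords (complement_val q) (v *m M) -> D v ->
  {for q, continuous Phi}.
Proof.
move=> oD hom cphi PhiE q v qv Dv W; rewrite (PhiE q v) // => Wv.
pose V := [set w | D w /\ W° (phi w)].
have oV : open V.
  rewrite openE => w [Dw Ww].
  suff : nbhs w (D `&` (phi @^-1` W°)) by [].
  apply: filterI; first exact: open_nbhs_nbhs.
  by apply: (cphi w Dw (W°)); apply: open_nbhs_nbhs; split=> //; exact: open_interior.
have Vhom w k : k != 0 -> V w -> V (k *: w).
  by move=> k0 [Dw Ww]; have [Dk phik] := hom w k k0 Dw; split=> //; rewrite phik.
have nq : nbhs q [set q' : X | exists2 w, coords (complement_val q') (w *m M) & V w].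
  by apply: open_nbhs_nbhs; split; [exact: chart_open|exists v].
apply: filterS nq => q' [w q'w [Dw Ww]].
by rewrite /= (PhiE q' w) //; exact: interior_subset Ww.
Qed.

End Points.

(** * The affine chart *)

(* In the coordinates given by [cf_M] the common point is [0 : 1 : 0] and the
   conics are [y z + x^2 = c j z^2]. *)
Record conic_frame (R : realType) (n : nat) (F : 'I_n -> mpoly 3 (Cplx R)) :=
  ConicFrame {
    cf_M : 'M[Cplx R]_3;
    cf_a : 'I_n -> Cplx R;
    cf_c : 'I_n -> Cplx R;
    cf_n_ge1 : (1 <= n)%N;
    cf_F2 : forall j, homogeneous 2 (F j);
    cf_unit : cf_M \in unitmx;
    cf_a_neq0 : forall j, cf_a j != 0;
    cf_FE : forall j x y z, eval3 (F j) (cvec x y z *m cf_M) =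
      cf_a j * (y * z + x ^+ 2 - cf_c j * z ^+ 2);
    cf_sep : forall i j, i != j ->
      4 <= `|complex.Re (cf_c i) - complex.Re (cf_c j)| }.

Section AffineChart.
Variables (R : realType) (n : nat).
Local Notation C := (Cplx R).
Local Notation row3 := 'rV[C]_3.
Variables (F : 'I_n -> mpoly 3 C) (D : conic_frame F).
Local Notation X := (complement F).
Local Notation c := (cf_c D).
Variable x0 : X.

Definition pt (x y z : C) : X :=
  npt (cf_n_ge1 D) (cf_F2 D) (cf_unit D) (cf_a_neq0 D) (cf_FE D) x0 x y z.
Definition hc (q : X) : row3 := ncv (cf_unit D) q.

Lemma hcP q : coords (complement_val q) (hc q *m cf_M D).
Proof. exact: ncvP. Qed.

Lemma ptP x y z : off_conics c x y z ->
  coords (complement_val (pt x y z)) (cvec x y z *m cf_M D).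
Proof. exact: nptP. Qed.

Lemma pt_eq (q : X) x y z :
  coords (complement_val q) (cvec x y z *m cf_M D) -> pt x y z = q.
Proof. exact: npt_eq. Qed.

Lemma pt_continuous (T : topologicalType) (f g h : T -> C) t :
  {for t, continuous f} -> {for t, continuous g} -> {for t, continuous h} ->
  off_conics c (f t) (g t) (h t) ->
  {for t, continuous (fun s => pt (f s) (g s) (h s))}.
Proof. exact: npt_continuous. Qed.

(** The plateau of radius 1 makes [psi] constant near each puncture, so that small circles stay
    round under the shear; the support has radius 2. *)
Definition bump (u : R) : R := Num.max 0 (Num.min 1 (2 - `|u|)).

Lemma bump_bounds u : 0 <= bump u <= 1.
Proof. by rewrite /bump le_max lexx ge_max ler01 ge_min lexx. Qed.

Lemma bump_near u : `|u| <= 1 -> bump u = 1.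
Proof. by move=> u1; rewrite /bump min_l ?max_r ?ler01 //; lra. Qed.

Lemma bump_far u : 2 <= `|u| -> bump u = 0.
Proof. by move=> u2; rewrite /bump max_l // ge_min; apply/orP; right; lra. Qed.

Lemma bump_continuous : continuous bump.
Proof.
move=> u; apply: continuous_maxR; first exact: cst_continuous.
apply: continuous_minR; first exact: cst_continuous.
have -> : (fun u : R => 2 - `|u|) = (fun u : R => -1 * `|u| + 2).
  by apply/funext => v; rewrite mulN1r addrC.
by apply: continuous_affine => v; exact: norm_continuous.
Qed.

(* The shear [t |-> Re t + i (Im t + psi (Re t))] moves [c j] to height [j]. *)
Definition psi (r : R) : R :=
  \sum_j ((nat_of_ord j)%:R - complex.Im (c j)) * bump (r - complex.Re (c j)).

Definition psi_max : R := \sum_j `|(nat_of_ord j)%:R - complex.Im (c j)|.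

Lemma psi_le r : `|psi r| <= psi_max.
Proof.
apply: le_trans (ler_norm_sum _ _ _) _; apply: ler_sum => j _.
have /andP[b0 b1] := bump_bounds (r - complex.Re (c j)).
by rewrite normrM (ger0_norm b0) ler_piMr.
Qed.

Lemma psi_near j r : `|r - complex.Re (c j)| <= 1 ->
  psi r = (nat_of_ord j)%:R - complex.Im (c j).
Proof.
move=> rj; rewrite /psi (bigD1 j) //= bump_near // mulr1 big1 ?addr0 // => i ij.
rewrite bump_far ?mulr0 //; have := cf_sep D ij.
set u := complex.Re (c i); set v := complex.Re (c j) in rj *.
have := ler_distD r u v; rewrite [`|u - r|]distrC; lra.
Qed.

Lemma psi_continuous : continuous psi.
Proof.
rewrite /psi => r; apply: cvg_big => [|j _]; first exact: add_continuous.
apply: (@continuousM R R (cst _) (fun r => bump (r - complex.Re (c j)))).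
  exact: cst_continuous.
apply: continuous_comp; last exact: bump_continuous.
have -> : (fun r => r - complex.Re (c j)) = (fun r : R => 1 * r + - complex.Re (c j)).
  by apply/funext => s; rewrite mul1r.
by apply: continuous_affine => s A sA; exact: sA.
Qed.

(** The inverse shear, from straightened coordinates back to [t]. *)
Definition unshear (a b : R) : C := (a +i* (b - psi a))%C.

Definition safe (a b : R) : Prop := forall j, unshear a b != c j.

Lemma unshear_eq a b j : unshear a b = c j -> a = complex.Re (c j) /\ b = (nat_of_ord j)%:R.
Proof.
rewrite /unshear => e.
have ea : a = complex.Re (c j) by rewrite -e.
have eb : b - psi a = complex.Im (c j) by rewrite -e.
split=> //; move: eb; rewrite (@psi_near j) ?ea ?subrr ?normr0 ?ler01 //; lra.
Qed.

Definition pA (x : C) (a b : R) : X := pt x (unshear a b - x ^+ 2) 1.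

Lemma pA_off x a b : safe a b -> off_conics c x (unshear a b - x ^+ 2) 1.
Proof. by move=> h j; rewrite mulr1 subrK expr1n mulr1 subr_eq0. Qed.

(* On [z != 0] the coordinates are [x / z] and [t = (y z + x^2) / z^2], in which
   the [j]-th conic is [t = c j]; [(aA, bA)] is the sheared position of [t]. *)
Definition inA (q : X) : Prop := hc q 0 2 != 0.
Definition xA (q : X) : C := hc q 0 0 / hc q 0 2.
Definition tA (q : X) : C := hc q 0 1 / hc q 0 2 + xA q * xA q.
Definition aA (q : X) : R := complex.Re (tA q).
Definition bA (q : X) : R := complex.Im (tA q) + psi (aA q).

Lemma coords_A (q : X) x y z : coords (complement_val q) (cvec x y z *m cf_M D) -> z != 0 ->
  [/\ inA q, xA q = x / z & tA q = y / z + (x / z) ^+ 2].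
Proof.
move=> /(ncv_unique (cf_unit D))[k k0 e] z0.
have ratio u : (k * u) / (k * z) = u / z by rewrite -mulf_div divff ?mul1r.
by rewrite /inA /tA /xA /hc e cvecZ !mxE /= mulf_neq0 // !ratio expr2.
Qed.

Lemma unshear_tA q : unshear (aA q) (bA q) = tA q.
Proof. by rewrite /unshear /bA /aA addrK; case: (tA q). Qed.

Lemma pA_A x a b : safe a b ->
  [/\ inA (pA x a b), xA (pA x a b) = x, aA (pA x a b) = a & bA (pA x a b) = b].
Proof.
move=> h; have [] := coords_A (ptP (@pA_off x _ _ h)) (oner_neq0 _); rewrite -/(pA x a b).
rewrite !divr1 subrK => h1 h2 h3.
by split=> //; rewrite /bA /aA h3 /= ?subrK.
Qed.

Lemma hc_cvec q : exists x y z, hc q = cvec x y z.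
Proof. exact: cvec_surj. Qed.

Lemma pA_eq q : inA q -> pA (xA q) (aA q) (bA q) = q.
Proof.
rewrite /pA => Aq; apply: pt_eq; rewrite unshear_tA; have := hcP q.
have k0 : (hc q 0 2)^-1 != 0 by rewrite invr_eq0.
move=> /(coordsZ k0); rewrite scalemxAl.
have [x [y [z e]]] := hc_cvec q.
move: Aq; rewrite /tA /xA /inA e !mxE /= cvecZ => z0.
have -> : z^-1 * x = x / z by rewrite mulrC.
have -> : z^-1 * y = y / z + x / z * (x / z) - (x / z) ^+ 2 by rewrite expr2 addrK mulrC.
by rewrite mulVf.
Qed.

Lemma safe_A q : inA q -> safe (aA q) (bA q).
Proof.
move=> Aq j; rewrite unshear_tA; apply/eqP => e.
have [x [y [z ez]]] := hc_cvec q; have := hcP q; rewrite ez.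
move=> qv; move: (qv) => /(complement_off (cf_F2 D) (cf_a_neq0 D) (cf_FE D))/(_ j)/eqP; apply.
move: Aq e; rewrite /inA /tA /xA ez !mxE /= => z0 <-; field; exact: z0.
Qed.

Section ChartContinuity.

Lemma entry_continuous k (v : row3) : {for v, continuous (fun w : row3 => w 0 k)}.
Proof. exact: coord_continuous. Qed.

Lemma open_entry_neq0 k : open [set v : row3 | v 0 k != 0].
Proof.
rewrite openE => v /= vk; exact: (near_neq0 (@entry_continuous k v) vk).
Qed.

Lemma near_hc_neq0 k q : hc q 0 k != 0 -> \forall q' \near q, hc q' 0 k != 0.
Proof.
move=> qk; have hom (v : row3) (l : C) : l != 0 -> v 0 k != 0 -> (l *: v) 0 k != 0.
  by move=> l0 vk; rewrite mxE mulf_neq0.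
have nq := open_nbhs_nbhs (conj (chart_open F (cf_unit D) (@open_entry_neq0 k) hom)
  (ex_intro2 _ _ (hc q) (hcP q) qk)).
apply: filterS nq => q' [v q'v vk].
by have [l l0] := ncv_unique (cf_unit D) q'v; rewrite /hc => ->; exact: hom.
Qed.

Lemma hc_chart_continuous (T : topologicalType) (phi : row3 -> T) (k : 'I_3) q :
  (forall (v : row3) (l : C), l != 0 -> v 0 k != 0 -> phi (l *: v) = phi v) ->
  (forall v : row3, v 0 k != 0 -> {for v, continuous phi}) -> hc q 0 k != 0 ->
  {for q, continuous (fun q' : X => phi (hc q'))}.
Proof.
move=> hom cphi qk.
have hom' (v : row3) (l : C) : l != 0 -> v 0 k != 0 -> (l *: v) 0 k != 0 /\ phi (l *: v) = phi v.
  by move=> l0 vk; split; [rewrite mxE mulf_neq0|exact: hom].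
apply: (chart_continuous (cf_unit D) (@open_entry_neq0 k) hom' cphi _ (hcP q) qk).
move=> q' v q'v vk; have [l l0] := ncv_unique (cf_unit D) q'v.
by rewrite /hc => ->; exact: hom.
Qed.

Lemma ratio_continuous j k q : hc q 0 k != 0 ->
  {for q, continuous (fun q' : X => hc q' 0 j / hc q' 0 k : C)}.
Proof.
apply: (@hc_chart_continuous _ (fun v : row3 => v 0 j / v 0 k : C)) => v.
  by move=> l l0 vk; rewrite !mxE -mulf_div divff // mul1r.
move=> vk; apply: (@continuousM C _ (fun v : row3 => v 0 j) (fun v : row3 => (v 0 k)^-1)).
  exact: entry_continuous.
by apply: continuousV => //; exact: entry_continuous.
Qed.

Lemma xA_continuous q : inA q -> {for q, continuous xA}.
Proof. exact: ratio_continuous. Qed.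

Lemma tA_continuous q : inA q -> {for q, continuous tA}.
Proof.
move=> Aq; have c1 := @ratio_continuous 1 2 q Aq; have c0 := @ratio_continuous 0 2 q Aq.
exact: (continuousD c1 (continuousM c0 c0)).
Qed.

Lemma aA_continuous q : inA q -> {for q, continuous aA}.
Proof.
move=> Aq; apply: (@continuous_comp _ _ _ tA (fun z : C => complex.Re z)).
  exact: tA_continuous.
exact: Re_continuous.
Qed.

Lemma bA_continuous q : inA q -> {for q, continuous bA}.
Proof.
move=> Aq; apply: (@continuousD R R _ (fun q => complex.Im (tA q)) (fun q => psi (aA q))).
  apply: (@continuous_comp _ _ _ tA (fun z : C => complex.Im z)).
    exact: tA_continuous.
  exact: Im_continuous.
apply: (@continuous_comp _ _ _ aA psi); first exact: aA_continuous.
exact: psi_continuous.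
Qed.

Lemma pA_continuous (T : topologicalType) (f : T -> C) (g h : T -> R) t :
  {for t, continuous f} -> {for t, continuous g} -> {for t, continuous h} ->
  safe (g t) (h t) -> {for t, continuous (fun s => pA (f s) (g s) (h s))}.
Proof.
move=> cf cg ch st.
have cpsi : {for t, continuous (fun s => psi (g s))}.
  by apply: (@continuous_comp _ _ _ g psi) => //; exact: psi_continuous.
have cu : {for t, continuous (fun s => unshear (g s) (h s) - f s ^+ 2)}.
  have -> : (fun s => unshear (g s) (h s) - f s ^+ 2) =
    (fun s => unshear (g s) (h s)) \- (f \* f) by apply/funext => s; rewrite /= expr2.
  apply: continuousB; last exact: continuousM.
  by apply: continuous_complex => //; exact: (continuousB ch cpsi).
exact: (pt_continuous cf cu (@cst_continuous T C 1 t) (@pA_off (f t) _ _ st)).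
Qed.

Lemma near_inA q : inA q -> \forall q' \near q, inA q'.
Proof. exact: near_hc_neq0. Qed.

End ChartContinuity.

Section Region.
Variable P : set (R * R).

Definition UA : set X := [set q | inA q /\ P (aA q, bA q)].

Lemma UA_open : open P -> open UA.
Proof.
move=> oP; rewrite openE => q [Aq Pq].
have nP : \forall q' \near q, P (aA q', bA q').
  have [[A B] /= [nA nB] AB] := open_nbhs_nbhs (conj oP Pq).
  have h1 : \forall q' \near q, A (aA q') by exact: (aA_continuous Aq nA).
  have h2 : \forall q' \near q, B (bA q') by exact: (bA_continuous Aq nB).
  by apply: filterS2 h1 h2 => q' ? ?; apply: AB.
by apply: filterS2 (near_inA Aq) nP => q' ? ?; split.
Qed.

Hypothesis P_safe : forall a b, P (a, b) -> safe a b.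
Hypothesis P_convex : forall a b a' b' s, P (a, b) -> P (a', b') -> 0 <= s <= 1 ->
  P ((1 - s) * a + s * a', (1 - s) * b + s * b').

(** In the coordinates [(x, a, b)] the set is the product of the complex line and a convex region,
    so it contracts linearly. *)
Lemma UA_contracts a0 b0 : P (a0, b0) -> contracts_to R UA (pA 0 a0 b0).
Proof.
move=> P0.
pose K (z : I01 R * X) := let s := I01_val z.1 in
  pA ((s%:C)%C * xA z.2) ((1 - s) * a0 + s * aA z.2) ((1 - s) * b0 + s * bA z.2).
exists K; split.
- move=> s u [Au Pu]; have s01 := I01_bounds s.
  have PK := P_convex P0 Pu s01.
  have [h1 h2 h3 h4] := @pA_A ((I01_val s)%:C%C * xA u) _ _ (P_safe PK).
  split; first by split=> //; rewrite /K /= h3 h4.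
  have cs : {for (s, u), continuous (fun z : I01 R * X => I01_val z.1)}.
    apply: (@continuous_comp _ _ _ (fun z : I01 R * X => z.1)); first exact: cvg_fst.
    exact: I01_val_continuous.
  have c2 (T : topologicalType) (f : X -> T) : {for u, continuous f} ->
      {for (s, u), continuous (fun z : I01 R * X => f z.2)}.
    move=> cf; apply: (@continuous_comp _ _ _ (fun z : I01 R * X => z.2)) => //.
    exact: cvg_snd.
  have cc (r : R) : {for (s, u), continuous (fun z : I01 R * X => r)}.
    exact: cst_continuous.
  have lin r (f : X -> R) : {for u, continuous f} ->
     {for (s, u), continuous (fun z : I01 R * X => (1 - I01_val z.1) * r + I01_val z.1 * f z.2)}.
    move=> /c2 cf; exact: (continuousD (continuousM (continuousB (cc 1) cs) (cc r))
      (continuousM cs cf)).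
  apply: pA_continuous; last exact: P_safe.
  + have cx : {for (s, u), continuous (fun z : I01 R * X => ((I01_val z.1)%:C)%C : C)}.
      apply: (@continuous_comp _ _ _ (fun z : I01 R * X => I01_val z.1)
        (fun r : R => (r%:C)%C : C)); first exact: cs.
      exact: real_complex_continuous.
    exact: (continuousM cx (c2 _ _ (xA_continuous Au))).
  + exact: (lin _ _ (aA_continuous Au)).
  + exact: (lin _ _ (bA_continuous Au)).
- move=> u _; rewrite /K /= I01_zeroE I01_valK ?lexx ?ler01 //.
  by rewrite mul0r !mul0r !addr0 subr0 !mul1r.
- move=> u [Au _]; rewrite /K /= I01_oneE I01_valK ?lexx ?ler01 //.
  by rewrite mul1r subrr !mul0r !add0r !mul1r pA_eq.
Qed.

End Region.
End AffineChart.

(** * The chart at infinity *)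

Section ChartAtInfinity.
Variables (R : realType) (n : nat).
Local Notation C := (Cplx R).
Local Notation row3 := 'rV[C]_3.
Variables (F : 'I_n -> mpoly 3 C) (D : conic_frame F).
Local Notation X := (complement F).
Local Notation c := (cf_c D).
Variable x0 : X.
Local Notation hc := (hc D).

(** The squared modulus as a real number; the norm of [C] has its values in [C]. *)
Definition sqn (z : C) : R := complex.Re z ^+ 2 + complex.Im z ^+ 2.

Lemma sqnM (z w : C) : sqn (z * w) = sqn z * sqn w.
Proof. by case: z => a b; case: w => a' b'; rewrite /sqn /=; ring. Qed.

Lemma sqn_real (r : R) : sqn ((r%:C)%C : C) = r ^+ 2.
Proof. by rewrite /sqn /= expr0n addr0. Qed.

Lemma sqn_ge0 z : 0 <= sqn z.
Proof. by rewrite addr_ge0 ?sqr_ge0. Qed.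

Lemma sqn_eq0 z : (sqn z == 0) = (z == 0).
Proof. by rewrite paddr_eq0 ?sqr_ge0 // !sqrf_eq0 eq_complex. Qed.

Lemma sqn1 : sqn 1 = 1.
Proof. by rewrite /sqn /= expr1n expr0n addr0. Qed.

Lemma sqnV z : z != 0 -> sqn z^-1 = (sqn z)^-1.
Proof.
move=> z0; have s0 : sqn z != 0 by rewrite sqn_eq0.
by apply: (mulfI s0); rewrite -sqnM !divff // sqn1.
Qed.

Lemma sqn_continuous (T : topologicalType) (f : T -> C) t :
  {for t, continuous f} -> {for t, continuous (fun s => sqn (f s))}.
Proof.
move=> cf.
have cr : {for t, continuous (fun s => complex.Re (f s))}.
  by apply: (@continuous_comp _ _ _ f (fun z : C => complex.Re z)) => //; exact: Re_continuous.
have ci : {for t, continuous (fun s => complex.Im (f s))}.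
  by apply: (@continuous_comp _ _ _ f (fun z : C => complex.Im z)) => //; exact: Im_continuous.
have := continuousD (continuousM cr cr) (continuousM ci ci).
by congr ({for t, continuous _}); apply/funext => s; rewrite /sqn /= !expr2.
Qed.

(** One constant for all estimates at infinity: it keeps the conics out of [nearL] and makes [|t|]
    there dominate the heights, the abscissae and the effect of the shear. *)
Definition radius : R := 2 * (1 + psi_max D + n%:R + (\sum_j `|complex.Re (c j)|) +
  2 * \sum_j sqn (c j)).

Lemma psi_max_ge0 : 0 <= psi_max D.
Proof. exact: sumr_ge0. Qed.

Lemma sum_ge_term (f : 'I_n -> R) j : (forall i, 0 <= f i) -> f j <= \sum_i f i.
Proof. by move=> f0; rewrite (bigD1 j) //= lerDl sumr_ge0. Qed.

Lemma radius_sqn j : 1 + 4 * sqn (c j) <= radius.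
Proof.
have h1 := @sum_ge_term (fun j => sqn (c j)) j (fun i => sqn_ge0 _).
have h2 : 0 <= \sum_j `|complex.Re (c j)| by exact: sumr_ge0.
have h3 := psi_max_ge0; have h4 : 0 <= n%:R :> R by exact: ler0n.
rewrite /radius; lra.
Qed.

Lemma radius_Re j : 2 * (1 + psi_max D + n%:R + `|complex.Re (c j)|) <= radius.
Proof.
have h1 : 0 <= \sum_j sqn (c j) by apply: sumr_ge0 => i _; exact: sqn_ge0.
have h2 := @sum_ge_term (fun j => `|complex.Re (c j)|) j (fun i => normr_ge0 _).
rewrite /radius; lra.
Qed.

Lemma radius_ge : 2 * (1 + psi_max D + n%:R) <= radius.
Proof.
have h1 : 0 <= \sum_j sqn (c j) by apply: sumr_ge0 => i _; exact: sqn_ge0.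
have h2 : 0 <= \sum_j `|complex.Re (c j)| by exact: sumr_ge0.
rewrite /radius; lra.
Qed.

Lemma radius_gt1 : 1 < radius.
Proof.
have h1 := psi_max_ge0; have h2 := radius_ge; have h4 : 0 <= n%:R :> R by exact: ler0n.
lra.
Qed.

(** [y] and [w] stand for the ratios [y / x] and [z / x]. The first bound puts [t / x^2 = 1 + y w]
    within 1/2 of 1, the second makes [x / z] large; both survive shrinking [y] and [w]. *)
Definition nearL (y w : C) : Prop := sqn (y * w) < 4^-1 /\ radius * sqn w < 1.

Lemma nearL_scale y w (s s' : R) : 0 <= s <= 1 -> 0 <= s' <= 1 -> nearL y w ->
  nearL ((s%:C)%C * y) ((s'%:C)%C * w).
Proof.
move=> /andP[s0 s1] /andP[s'0 s'1] [h1 h2].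
have sq (r : R) : 0 <= r -> r <= 1 -> 0 <= r ^+ 2 <= 1.
  by move=> r0 r1; rewrite sqr_ge0 exprn_ile1.
have [/andP[a0 a1] /andP[b0 b1]] := (sq _ s0 s1, sq _ s'0 s'1).
have w0 := sqn_ge0 w; have yw0 := sqn_ge0 (y * w); have r1 := radius_gt1.
split; last first.
  rewrite sqnM sqn_real mulrCA; apply: le_lt_trans h2.
  by rewrite ler_piMl // mulr_ge0 //; lra.
have -> : (s%:C)%C * y * ((s'%:C)%C * w) = ((s%:C)%C * (s'%:C)%C) * (y * w) by rewrite mulrACA.
rewrite sqnM (sqnM (s%:C)%C (s'%:C)%C) !sqn_real; apply: le_lt_trans h1.
by rewrite ler_piMl // mulr_ile1.
Qed.

(** On the conic [y w + 1 = c j w^2] has modulus below 1/2, and so has [y w]; they cannot differ by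
    1. *)
Lemma nearL_off y w : nearL y w -> off_conics c 1 y w.
Proof.
move=> [h1 h2] j; rewrite expr1n; apply/eqP => /eqP; rewrite subr_eq0 => /eqP e.
have : sqn (y * w + 1) < 4^-1.
  rewrite e expr2 !sqnM; have := radius_sqn j; have := radius_gt1.
  have w0 := sqn_ge0 w; have c0 := sqn_ge0 (c j).
  move: (sqn w) (sqn (c j)) radius h2 w0 c0 => s k r h2 s0 k0 r1 rk.
  have : k * (s * s) * 4 < (r * s) * (r * s) + 0 * s \/ s = 0.
    have [->|sn0] := eqVneq s 0; [by right|left].
    have sp : 0 < s by rewrite lt_def sn0.
    have : 0 < s * s by exact: mulr_gt0.
    have : 4 * k < r * r by nra.
    move=> h3 h4; nra.
  move=> [h3|->]; last by rewrite !mulr0; lra.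
  have : 0 <= r * s by rewrite mulr_ge0 //; lra.
  nra.
move: h1; case: (y * w) => u v; rewrite /sqn /=; nra.
Qed.

Definition inL (q : X) : Prop := hc q 0 0 != 0.
Definition yL (q : X) : C := hc q 0 1 / hc q 0 0.
Definition wL (q : X) : C := hc q 0 2 / hc q 0 0.
Definition UL : set X := [set q | inL q /\ nearL (yL q) (wL q)].

Lemma coords_L (q : X) y w : coords (complement_val q) (cvec 1 y w *m cf_M D) ->
  [/\ inL q, yL q = y & wL q = w].
Proof.
move=> /(ncv_unique (cf_unit D))[k k0 e].
have ratio u : (k * u) / (k * 1) = u by rewrite -mulf_div divff ?mul1r ?divr1.
by rewrite /inL /yL /wL /hc e cvecZ !mxE /= mulf_neq0 ?oner_neq0 // !ratio.
Qed.

Lemma pt_L y w : nearL y w ->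
  [/\ inL (pt D x0 1 y w), yL (pt D x0 1 y w) = y & wL (pt D x0 1 y w) = w].
Proof. by move=> /nearL_off h; apply: coords_L; exact: ptP. Qed.

Lemma UL_pt y w : nearL y w -> UL (pt D x0 1 y w).
Proof. by move=> h; have [h1 h2 h3] := pt_L h; split; rewrite ?h2 ?h3. Qed.

Lemma pt_L_eq q : inL q -> pt D x0 1 (yL q) (wL q) = q.
Proof.
move=> Lq; apply: pt_eq; have := hcP D q.
have k0 : (hc q 0 0)^-1 != 0 by rewrite invr_eq0.
move=> /(coordsZ k0); rewrite scalemxAl.
have [x [y [z e]]] := hc_cvec D q.
move: Lq; rewrite /yL /wL /inL e !mxE /= cvecZ => z0.
by rewrite mulVf; [rewrite (mulrC _ y) (mulrC _ z)|].
Qed.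

Lemma UL_open : open UL.
Proof.
rewrite openE => q [Lq [h1 h2]].
have cy : {for q, continuous yL} by exact: ratio_continuous.
have cw : {for q, continuous wL} by exact: ratio_continuous.
have cyw := sqn_continuous (continuousM cy cw).
have crw : {for q, continuous (fun q' => radius * sqn (wL q'))}.
  exact: (continuousM (@cst_continuous _ _ radius q) (sqn_continuous cw)).
have n1 : \forall q' \near q, sqn (yL q' * wL q') < 4^-1.
  exact: (cyw _ (lt_nbhsl h1)).
have n2 : \forall q' \near q, radius * sqn (wL q') < 1 by exact: (crw _ (lt_nbhsl h2)).
have n3 : \forall q' \near q, inL q' by exact: near_hc_neq0.
by apply: filterS3 n1 n2 n3 => q' ? ? ?; split.
Qed.

Lemma UL_contracts : contracts_to R UL (pt D x0 1 0 0).
Proof.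
pose K (z : I01 R * X) := let s := ((I01_val z.1)%:C)%C in
  pt D x0 1 (s * yL z.2) (s * wL z.2).
exists K; split.
- move=> s u [Lu Nu]; have s01 := I01_bounds s.
  have NK := nearL_scale s01 s01 Nu.
  split; first exact: UL_pt.
  have cs : {for (s, u), continuous (fun z : I01 R * X => I01_val z.1)}.
    apply: (@continuous_comp _ _ _ (fun z : I01 R * X => z.1)); first exact: cvg_fst.
    exact: I01_val_continuous.
  have cx : {for (s, u), continuous (fun z : I01 R * X => ((I01_val z.1)%:C)%C : C)}.
    apply: (@continuous_comp _ _ _ (fun z : I01 R * X => I01_val z.1)
      (fun r : R => (r%:C)%C : C)); first exact: cs.
    exact: real_complex_continuous.
  have c2 (f : X -> C) : {for u, continuous f} ->
      {for (s, u), continuous (fun z : I01 R * X => f z.2)}.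
    move=> cf; apply: (@continuous_comp _ _ _ (fun z : I01 R * X => z.2)) => //.
    exact: cvg_snd.
  have cy := c2 _ (@ratio_continuous _ _ _ D 1 0 u Lu).
  have cw := c2 _ (@ratio_continuous _ _ _ D 2 0 u Lu).
  have c1 : {for (s, u), continuous (fun z : I01 R * X => 1 : C)} by exact: cst_continuous.
  exact: (pt_continuous c1 (continuousM cx cy) (continuousM cx cw) (nearL_off NK)).
- move=> u _; rewrite /K /= I01_zeroE I01_valK ?lexx ?ler01 //.
  by rewrite !mul0r.
- move=> u [Lu _]; rewrite /K /= I01_oneE I01_valK ?lexx ?ler01 //.
  by rewrite !mul1r pt_L_eq.
Qed.

(** Off the conics [z = 0] forces [x] to be nonzero, hence [w = 0], where both bounds of [nearL]
    hold. *)
Lemma inA_or_UL q : inA D q \/ UL q.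
Proof.
have [x [y [z e]]] := hc_cvec D q; have := hcP D q; rewrite e => qv.
have offq := complement_off (cf_F2 D) (cf_a_neq0 D) (cf_FE D) qv.
rewrite /UL /nearL /inA /inL /yL /wL /= e !mxE /=.
have [z0|] := eqVneq z 0; [right|by left].
have := offq (Ordinal (cf_n_ge1 D)); rewrite z0 expr0n mulr0 mulr0 add0r subr0 sqrf_eq0 => x_neq0.
have s0 : sqn 0 = 0 by apply/eqP; rewrite sqn_eq0.
by split=> //; rewrite mul0r mulr0 s0 mulr0; split; lra.
Qed.

Lemma A_of_L q : inL q -> (inA D q <-> wL q != 0).
Proof. by rewrite /inL /inA /wL => h; rewrite mulf_eq0 invr_eq0 (negbTE h) orbF. Qed.

(* [t = x^2 (1 + y w)] near the line at infinity. *)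
Lemma UL_A_bounds q : UL q -> inA D q ->
  radius < sqn (xA D q) /\ sqn (tA D q - xA D q ^+ 2) < 4^-1 * sqn (xA D q) ^+ 2.
Proof.
move=> [Lq [h1 h2]] Aq.
have [w0 Zx] : wL q != 0 /\ xA D q = (wL q)^-1.
  by split; [exact/(A_of_L Lq)|rewrite /wL /xA invf_div].
have yE : tA D q - xA D q ^+ 2 = xA D q ^+ 2 * (yL q * wL q).
  move: Aq Lq; rewrite /tA /xA /inA /inL /yL /wL.
  by move: (hc q 0 0) (hc q 0 1) (hc q 0 2) => x y z z0 x_neq0; field; rewrite z0 x_neq0.
have sw : 0 < sqn (wL q) by rewrite lt_def sqn_eq0 w0 sqn_ge0.
have sx : 0 < sqn (xA D q) by rewrite Zx sqnV // invr_gt0.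
have sx2 : sqn (xA D q ^+ 2) = sqn (xA D q) ^+ 2 by rewrite !expr2 sqnM.
rewrite yE sqnM sx2; split; last by rewrite mulrC ltr_pM2r // exprn_gt0.
by rewrite Zx sqnV // -div1r ltr_pdivlMr.
Qed.

End ChartAtInfinity.

(** * Pieces of the affine chart *)

Inductive piece := Strip of nat | Lft of nat | Rgt of nat.

Section Pieces.
Variables (R : realType) (n : nat).
Local Notation C := (Cplx R).
Variables (F : 'I_n -> mpoly 3 C) (D : conic_frame F).
Local Notation X := (complement F).
Local Notation c := (cf_c D).
Variable x0 : X.

(* Real part of the puncture at height [j]; junk value [0] for [j >= n]. *)
Definition abscissa (j : nat) : R :=
  if insub j is Some i then complex.Re (c i) else 0.

Lemma abscissa_ord (j : 'I_n) : abscissa j = complex.Re (c j).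
Proof. by rewrite /abscissa valK. Qed.

Definition wide : R := 1 + \sum_j `|complex.Re (c j)|.

Lemma abscissa_wide j : - wide < abscissa j < wide.
Proof.
have w0 : 0 <= \sum_j `|complex.Re (c j)| by exact: sumr_ge0.
rewrite -ltr_norml /abscissa /wide; case: insubP => [i _ _|_]; last by rewrite normr0; lra.
by have := @sum_ge_term R n (fun i => `|complex.Re (c i)|) i (fun i => normr_ge0 _); lra.
Qed.

(* The punctures are the points [(abscissa j, j)], [j < n].  The strips lie between
   consecutive heights; [Strip m] and [Strip m.+1] are joined by a band on each
   side of the puncture at height [m]. *)
Definition region (i : piece) : set (R * R) := match i with
  | Strip m => [set z | [/\ (m <= n)%N, (0 < m)%N -> m%:R - 1 < z.2 &
                            (m < n)%N -> z.2 < m%:R]]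
  | Lft j => [set z | [/\ (j < n)%N, j%:R - 1 < z.2, z.2 < j%:R + 1 & z.1 < abscissa j]]
  | Rgt j => [set z | [/\ (j < n)%N, j%:R - 1 < z.2, z.2 < j%:R + 1 & abscissa j < z.1]]
  end.

Lemma nat_between (i j : nat) : j%:R - 1 < i%:R :> R -> i%:R < j%:R + 1 :> R -> i = j.
Proof.
rewrite ltrBlDr !natr1 !ltr_nat !ltnS => h1 h2.
by apply/eqP; rewrite eqn_leq h1 h2.
Qed.

Lemma region_safe i a b : region i (a, b) -> safe D a b.
Proof.
have n1 := cf_n_ge1 D.
move=> Pi j; apply/eqP => /unshear_eq[ea eb]; move: Pi; rewrite ea eb.
case: i => [m|i|i] /=; last 2 first.
- move=> [_ h1 h2]; rewrite -(nat_between h1 h2) abscissa_ord; lra.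
- move=> [_ h1 h2]; rewrite -(nat_between h1 h2) abscissa_ord; lra.
move=> [mn h1 h2]; have jn := ltn_ord j.
have mj : (m <= j)%N.
  case: m {mn h2} h1 => // m /(_ isT); rewrite -natr1 addrK ltr_nat; exact.
by have := h2 (leq_ltn_trans mj jn); rewrite ltr_nat ltnNge mj.
Qed.

Lemma convex_lt (u b b' s : R) : u < b -> u < b' -> 0 <= s <= 1 -> u < (1 - s) * b + s * b'.
Proof.
move=> h1 h2 /andP[h3 h4]; have [bb|/ltW bb] := leP b b'.
  have : 0 <= s * (b' - b) by rewrite mulr_ge0 ?subr_ge0.
  lra.
have : 0 <= (1 - s) * (b - b') by rewrite mulr_ge0 ?subr_ge0.
lra.
Qed.

Lemma convex_gt (u b b' s : R) : b < u -> b' < u -> 0 <= s <= 1 -> (1 - s) * b + s * b' < u.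
Proof.
move=> h1 h2 s01; have := @convex_lt (- u) (- b) (- b') s; rewrite !ltrN2 => /(_ h1 h2 s01).
lra.
Qed.

Lemma region_convex i a b a' b' s : region i (a, b) -> region i (a', b') -> 0 <= s <= 1 ->
  region i ((1 - s) * a + s * a', (1 - s) * b + s * b').
Proof.
case: i => [m|j|j] /= [h1 h2 h3] => [[_ h2' h3']|h4 [_ h2' h3' h4']|h4 [_ h2' h3' h4']] s01.
- by split=> // h; [apply: convex_lt => //; auto|apply: convex_gt => //; auto].
- by split=> //; [exact: convex_lt|exact: convex_gt|exact: convex_gt].
- by split=> //; [exact: convex_lt|exact: convex_gt|exact: convex_lt].
Qed.

Lemma region_open i : open (region i).
Proof.
have c1 (z : R * R) : {for z, continuous (@fst R R)} by exact: cvg_fst.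
have c2 (z : R * R) : {for z, continuous (@snd R R)} by exact: cvg_snd.
have l2 (z : R * R) u : z.2 < u -> \forall w \near z, w.2 < u.
  by move=> h; exact: (c2 z _ (lt_nbhsl h)).
have g2 (z : R * R) u : u < z.2 -> \forall w \near z, u < w.2.
  by move=> h; exact: (c2 z _ (lt_nbhsr h)).
have l1 (z : R * R) u : z.1 < u -> \forall w \near z, w.1 < u.
  by move=> h; exact: (c1 z _ (lt_nbhsl h)).
have g1 (z : R * R) u : u < z.1 -> \forall w \near z, u < w.1.
  by move=> h; exact: (c1 z _ (lt_nbhsr h)).
rewrite openE => z; case: i => [m|j|j] /=.
- move=> [mn h1 h2].
  have e1 : \forall w \near z, (0 < m)%N -> m%:R - 1 < w.2.
    case: (ltnP 0 m) h1 => [_ /(_ isT) h|]; last by move=> *; apply: filterE.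
    by apply: filterS (g2 z _ h).
  have e2 : \forall w \near z, (m < n)%N -> w.2 < m%:R.
    case: (ltnP m n) h2 => [_ /(_ isT) h|]; last by move=> *; apply: filterE.
    by apply: filterS (l2 z _ h).
  by apply: filterS2 e1 e2 => w ? ?; split.
- move=> [jn h1 h2 h3].
  by apply: filterS3 (g2 z _ h1) (l2 z _ h2) (l1 z _ h3) => w ? ? ?; split.
- move=> [jn h1 h2 h3].
  by apply: filterS3 (g2 z _ h1) (l2 z _ h2) (g1 z _ h3) => w ? ? ?; split.
Qed.

Lemma sum_ltn_ord k m : (\sum_(i < k) (i < m) = minn m k)%N.
Proof.
elim: k => [|k IH]; first by rewrite big_ord0 minn0.
rewrite big_ord_recr /= IH; case: (ltngtP k m) => [km|mk|<-].
- by rewrite (minn_idPr km) addn1.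
- by rewrite (minn_idPl (leqW (ltnW mk))) addn0.
- by rewrite (minn_idPl (leqnSn k)) addn0.
Qed.

(** The index of the strip containing [b]; at a puncture height, that of the strip above. *)
Definition level (b : R) : nat := \sum_(i < n) (i%:R <= b :> R).

Lemma level_eq b m : (m <= n)%N -> ((0 < m)%N -> m%:R - 1 <= b) ->
  ((m < n)%N -> b < m%:R) -> level b = m.
Proof.
move=> mn h1 h2.
have -> : level b = (\sum_(i < n) (i < m))%N.
  apply: eq_bigr => i _; congr nat_of_bool; apply/idP/idP => [ib|im].
    rewrite ltnNge; apply/negP => mi.
    have := h2 (leq_ltn_trans mi (ltn_ord i)); apply/negP; rewrite -leNgt.
    by apply: le_trans ib; rewrite ler_nat.
  have m0 : (0 < m)%N by exact: leq_ltn_trans im.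
  by apply: le_trans (h1 m0); rewrite lerBrDr natr1 ler_nat.
by rewrite sum_ltn_ord; exact/minn_idPl.
Qed.

Lemma level_spec b : [/\ (level b <= n)%N,
  (0 < level b)%N -> (level b)%:R - 1 <= b & (level b < n)%N -> b < (level b)%:R].
Proof.
have ex : exists m, (m == n) || (b < m%:R) by exists n; rewrite eqxx.
case: (ex_minnP ex) => m mP mmin.
have mn : (m <= n)%N by apply: mmin; rewrite eqxx.
have h1 : (0 < m)%N -> m%:R - 1 <= b.
  case: m {mP} mmin mn => // m mmin mn _; rewrite -natr1 addrK leNgt.
  by apply/negP => bm; have := mmin m; rewrite bm orbT ltnn => /(_ isT).
have h2 : (m < n)%N -> b < m%:R by move=> mn'; move: mP; rewrite ltn_eqF.
by rewrite (level_eq mn h1 h2).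
Qed.

Definition uncut (b : R) : Prop := forall j : nat, (j < n)%N -> b != j%:R.

Lemma strip_level m a b : region (Strip m) (a, b) -> level b = m.
Proof. by move=> /= [mn h1 h2]; apply: level_eq => // /h1; lra. Qed.

Lemma level_strip a b : uncut b -> region (Strip (level b)) (a, b).
Proof.
move=> ub; have [h1 h2 h3] := level_spec b; split=> //= l0.
have := h2 l0; rewrite le_eqVlt => /orP[/eqP e|//].
have [k lk] : exists k, level b = k.+1 by case: (level b) l0 => // k _; exists k.
have := ub k; rewrite -e lk -natr1 addrK eqxx; rewrite -lk => /(_ h1).
by [].
Qed.

Lemma strip_uncut m a b : region (Strip m) (a, b) -> uncut b.
Proof.
move=> /= [mn h1 h2] j jn; apply/eqP => e; rewrite e in h1 h2.
have mj : (m <= j)%N.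
  case: m {mn h2} h1 => // m /(_ isT); rewrite -natr1 addrK ltr_nat; exact.
by have := h2 (leq_ltn_trans mj jn); rewrite ltr_nat ltnNge mj.
Qed.

Lemma level_band j b : (j < n)%N -> j%:R - 1 < b -> b < j%:R + 1 ->
  level b = if j%:R <= b then j.+1 else j.
Proof.
move=> jn h1 h2; case: leP => jb; apply: level_eq => //.
- by move=> _; rewrite -natr1; lra.
- by move=> _; rewrite -natr1.
- exact: ltnW.
- by move=> _; lra.
Qed.

Lemma cut_piece i a j : (j < n)%N -> region i (a, j%:R) -> i = Lft j \/ i = Rgt j.
Proof.
move=> jn Pi; case: i Pi => [m|i|i] Pi.
- by have := strip_uncut Pi jn; rewrite eqxx.
- by case: Pi => _ h1 h2 _; left; rewrite (nat_between h1 h2).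
- by case: Pi => _ h1 h2 _; right; rewrite (nat_between h1 h2).
Qed.

Lemma uncut_or_cut b : uncut b \/ exists2 j, (j < n)%N & b = j%:R.
Proof.
have [h|h] := pselect (exists2 j, (j < n)%N & b = j%:R); [by right|left].
by move=> j jn; apply/eqP => e; apply: h; exists j.
Qed.

Lemma region_unique_on_cut i i' a j : (j < n)%N -> region i (a, j%:R) ->
  region i' (a, j%:R) -> i = i'.
Proof.
move=> jn Pi Pi'; move: (Pi) (Pi').
case: (cut_piece jn Pi) => ->; case: (cut_piece jn Pi') => -> //=;
  by move=> [_ _ _ h1] [_ _ _ h2]; have := lt_trans h1 h2; rewrite ltxx.
Qed.

Definition center_coords (i : piece) : R * R := match i with
  | Strip m => (- wide, m%:R - 2^-1)
  | Lft j => (- wide, j%:R)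
  | Rgt j => (wide, j%:R)
  end.

Definition center (i : piece) : X :=
  pA D x0 0 (center_coords i).1 (center_coords i).2.

Lemma region_center i z : region i z -> region i (center_coords i).
Proof.
case: i => [m|j|j] /=.
- by move=> [mn _ _]; split=> // _; lra.
- by move=> [jn _ _ _]; have /andP[h _] := abscissa_wide j; split=> //; lra.
- by move=> [jn _ _ _]; have /andP[_ h] := abscissa_wide j; split=> //; lra.
Qed.

Definition chart (i : piece) : set X := UA D (region i).

Lemma chart_open_piece i : open (chart i).
Proof. exact/UA_open/region_open. Qed.

Lemma chart_contracts i p : chart i p -> contracts_to R (chart i) (center i).
Proof.
move=> [_ Pi]; have := region_center Pi; case e : (center_coords i) => [a b].
rewrite /center e; apply: UA_contracts; first exact: region_safe.
by move=> *; exact: region_convex.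
Qed.

Lemma chart_cover q : inA D q -> exists i, chart i q.
Proof.
move=> Aq; case: (uncut_or_cut (bA D q)) => [ub|[j jn e]].
  by exists (Strip (level (bA D q))); split=> //; exact: level_strip.
have /(_ (Ordinal jn)) sq := safe_A Aq.
have aq : aA D q != abscissa j.
  apply: contra_neq sq => ea.
  have je : abscissa j = complex.Re (c (Ordinal jn)) by rewrite -(abscissa_ord (Ordinal jn)).
  rewrite /unshear e ea je (@psi_near _ _ _ D (Ordinal jn)) ?subrr ?normr0 ?ler01 //=.
  by rewrite opprB addrC subrK; case: (c _).
case: (ltgtP (aA D q) (abscissa j)) aq => // h _.
  by exists (Lft j); split=> //=; rewrite e; split=> //; lra.
by exists (Rgt j); split=> //=; rewrite e; split=> //; lra.
Qed.

(** The overlap lies over an intersection of convex regions, hence is itself contractible. *)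
Lemma chart_join i i' p q : chart i p -> chart i' p -> chart i q -> chart i' q ->
  exists f : {path I01 R from p to q in X},
    (forall t, chart i (f t)) /\ (forall t, chart i' (f t)).
Proof.
move=> ip i'p iq i'q.
pose P := region i `&` region i'.
have PC : contracts_to R (UA D P) (pA D x0 0 (aA D p) (bA D p)).
  apply: UA_contracts => [a b [/region_safe]|a b a' b' s [h1 h2] [h3 h4] s01|] //.
    by split; exact: region_convex.
  by split; [case: ip|case: i'p].
have [|| f fP] := contracts_to_join PC (p := p) (q := q).
- by split; [case: ip|split; [case: ip|case: i'p]].
- by split; [case: iq|split; [case: iq|case: i'q]].
by exists f; split=> t; have [h1 [h2 h3]] := fP t; split.
Qed.

Section Labels.
Variables (Gamma : groupType) (gamma : nat -> Gamma).

(** Between a strip and a band the only nontrivial transition is from [Rgt j] to [Strip j.+1]: the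
    cut runs to the right from the [j]-th puncture. *)
Definition label (i : piece) (q : X) : Gamma :=
  if i is Rgt j then (if j%:R <= bA D q then gamma j else 1%g) else 1%g.

Lemma label_locally_constant i q : chart i q -> uncut (bA D q) ->
  \forall q' \near q, label i q' = label i q.
Proof.
case: i => [m|j|j] [Aq Pi] ub; try exact: filterE.
have jn : (j < n)%N by case: Pi.
rewrite /label /=; case: (ltgtP j%:R (bA D q)) (ub j jn) => // h _.
  have nb : \forall q' \near q, j%:R < bA D q' by exact: (bA_continuous Aq (lt_nbhsr h)).
  by apply: filterS nb => q' /ltW ->.
have nb : \forall q' \near q, bA D q' < j%:R by exact: (bA_continuous Aq (lt_nbhsl h)).
by apply: filterS nb => q' h'; rewrite leNgt h'.
Qed.

(** Labels jump only at puncture heights, and there a point lies in a single piece. *)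
Lemma label_compat i i' q : chart i q -> chart i' q ->
  \forall q' \near q, (label i q' / label i' q' = label i q / label i' q)%g.
Proof.
move=> iq i'q; case: (uncut_or_cut (bA D q)) => [ub|[j jn e]].
  apply: filterS2 (label_locally_constant iq ub) (label_locally_constant i'q ub).
  by move=> q' -> ->.
have -> : i' = i.
  case: iq i'q => [_ Pi] [_ Pi']; rewrite e in Pi Pi'.
  by apply: region_unique_on_cut jn Pi' Pi.
by apply: filterE => q'; rewrite !mulgV.
Qed.

End Labels.
End Pieces.

(** * The label of the chart at infinity *)

Section LabelAtInfinity.
Variables (R : realType) (n : nat).
Local Notation C := (Cplx R).
Variables (F : 'I_n -> mpoly 3 C) (D : conic_frame F).
Local Notation X := (complement F).
Local Notation c := (cf_c D).
Local Notation aA := (aA D).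
Local Notation bA := (bA D).
Local Notation UL := (UL D).
Local Notation chart := (chart D).

Definition xre (q : X) : R := complex.Re (xA D q).
Definition xim (q : X) : R := complex.Im (xA D q).
Definition tim (q : X) : R := complex.Im (tA D q).

Lemma UL_real_bounds q : UL q -> inA D q ->
  let S := xre q ^+ 2 + xim q ^+ 2 in radius D < S /\
  (aA q - (xre q ^+ 2 - xim q ^+ 2)) ^+ 2 + (tim q - 2 * xre q * xim q) ^+ 2 < 4^-1 * S ^+ 2.
Proof.
move=> Uq Aq S; have [h1 h2] := UL_A_bounds Uq Aq; split=> //; move: h2.
rewrite /S /xre /xim /aA /tim; case: (tA D q) => t1 t2; case: (xA D q) => x1 x2.
rewrite /sqn /=; congr (_ < _); ring.
Qed.

Lemma quarter_sqr (r : R) : 4^-1 * r ^+ 2 = (2^-1 * r) ^+ 2.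
Proof. by field. Qed.

Section Bounds.
Variable q : X.
Hypotheses (Uq : UL q) (Aq : inA D q).
Let bnd := UL_real_bounds Uq Aq.

(** For imaginary [x] the square [x^2] is a negative real, at distance at least [|x|^2] from any [t]
    with nonnegative real part; but [t] is within [|x|^2 / 2] of it. *)
Lemma UL_xre_neq0 : 0 <= aA q -> xre q != 0.
Proof.
have [h1 h2] := bnd => a0; apply/eqP => x0; move: h2; rewrite x0 => h2.
have := sqr_ge0 (xim q); move: (xim q ^+ 2) h2 => y h2 y0.
suff : y ^+ 2 <= (aA q - (0 ^+ 2 - y)) ^+ 2.
  by have := sqr_ge0 (tim q - 2 * 0 * xim q); have := sqr_ge0 y; nra.
by rewrite expr0n sub0r opprK ler_sqr ?nnegrE //; lra.
Qed.

Lemma UL_xim_neq0 : aA q <= 0 -> xim q != 0.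
Proof.
have [h1 h2] := bnd => a0; apply/eqP => x0; move: h2; rewrite x0 => h2.
have := sqr_ge0 (xre q); move: (xre q ^+ 2) h2 => y h2 y0.
suff : y ^+ 2 <= (aA q - (y - 0 ^+ 2)) ^+ 2.
  by have := sqr_ge0 (tim q - 2 * xre q * 0); have := sqr_ge0 y; nra.
by rewrite expr0n subr0 -[leRHS]sqrrN opprB ler_sqr ?nnegrE //; lra.
Qed.

(** [|t|] is at least [|x^2| - |t - x^2|], which exceeds [|x|^2 / 2], and [|x|^2] exceeds
    [radius]. *)
Lemma UL_modulus : 4^-1 * radius D ^+ 2 < aA q ^+ 2 + tim q ^+ 2.
Proof.
have [] := bnd; set S := xre q ^+ 2 + _ => h1 h2.
have r1 := radius_gt1 D.
have SE : S ^+ 2 = (xre q ^+ 2 - xim q ^+ 2) ^+ 2 + (2 * xre q * xim q) ^+ 2.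
  by rewrite /S; ring.
have rS : radius D ^+ 2 < S ^+ 2 by rewrite ltr_sqr ?nnegrE; lra.
move: SE h2; move: (xre q ^+ 2 - _) (2 * xre q * xim q) => u v SE h2.
have := sqr_ge0 (2 * aA q - u); have := sqr_ge0 (2 * tim q - v); nra.
Qed.

(** The imaginary part of [x^2] is [2 xre xim]; with [Re t = 0], opposite signs would put [t] too
    far from [x^2]. *)
Lemma UL_tim_sign : aA q = 0 -> 0 < tim q * (xre q * xim q).
Proof.
have [_ h2] := bnd => a0; move: h2; rewrite a0 ltNge => h2.
apply/negP => h; have := UL_modulus; rewrite a0; have := sqr_ge0 (tim q).
have := sqr_ge0 (xre q ^+ 2 - xim q ^+ 2); nra.
Qed.

Lemma bA_tim : `|bA q - tim q| <= psi_max D.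
Proof. by rewrite /bA /tim [_ + psi _ _]addrC addrK; exact: psi_le. Qed.

Lemma UL_height_gt : aA q = 0 -> 0 < tim q -> n%:R < bA q.
Proof.
move=> a0 t0; have := UL_modulus; have := radius_ge D; have := bA_tim.
rewrite a0 expr0n add0r ler_norml => /andP[h1 h2] h3 h4.
have r1 := radius_gt1 D.
have : 2^-1 * radius D < tim q by rewrite -ltr_sqr ?nnegrE -?quarter_sqr //; lra.
by lra.
Qed.

Lemma UL_height_lt : aA q = 0 -> tim q < 0 -> bA q < 0.
Proof.
move=> a0 t0; have := UL_modulus; have := radius_ge D; have := bA_tim.
rewrite a0 expr0n add0r ler_norml => /andP[h1 h2] h3 h4.
have r1 := radius_gt1 D; have n0 : 0 <= n%:R :> R by exact: ler0n.
have : 2^-1 * radius D < - tim q.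
  by rewrite -ltr_sqr ?nnegrE -?quarter_sqr ?sqrrN //; lra.
by lra.
Qed.

(** At a puncture height [Im t] is bounded by the height and the shear, so the large modulus of [t]
    must come from its real part. *)
Lemma UL_abscissa j : (j < n)%N -> bA q = j%:R -> `|abscissa D j| < `|aA q|.
Proof.
move=> jn bj; have := UL_modulus; have := radius_Re D (Ordinal jn); have := bA_tim.
rewrite -abscissa_ord /= bj; have := normr_ge0 (abscissa D j).
move: (`|abscissa D j|) => r r0 h1 h2 h3.
have pm := psi_max_ge0 D; have j0 : 0 <= j%:R :> R by exact: ler0n.
have jn' : j%:R <= n%:R :> R by rewrite ler_nat ltnW.
have ht : `|tim q| <= psi_max D + n%:R.
  have := ler_distD 0 (tim q) j%:R; rewrite subr0 sub0r normrN (ger0_norm j0).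
  have := ler_distD j%:R (tim q) 0; rewrite !subr0 (ger0_norm j0) distrC; lra.
have ht2 : tim q ^+ 2 <= (psi_max D + n%:R) ^+ 2.
  by rewrite -[leLHS]real_normK ?num_real ?ler_sqr ?nnegrE // addr_ge0 // ler0n.
rewrite -ltr_sqr ?nnegrE // (real_normK (num_real _)).
have : (1 + psi_max D + n%:R + r) ^+ 2 <= 4^-1 * radius D ^+ 2.
  by rewrite quarter_sqr ler_sqr ?nnegrE; lra.
have pr : 0 <= (psi_max D + n%:R) * r by rewrite mulr_ge0 // addr_ge0 // ler0n.
have p0 : 0 <= psi_max D + n%:R by rewrite addr_ge0 // ler0n.
nra.
Qed.

Lemma UL_cut_left j : (j < n)%N -> bA q = j%:R -> aA q < 0 -> aA q < abscissa D j.
Proof.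
move=> jn bj a0; have := UL_abscissa jn bj; rewrite (ltr0_norm a0) ltr_norml => ?; lra.
Qed.

Lemma UL_cut_right j : (j < n)%N -> bA q = j%:R -> 0 < aA q -> abscissa D j < aA q.
Proof.
move=> jn bj a0; have := UL_abscissa jn bj; rewrite (gtr0_norm a0) ltr_norml => ?; lra.
Qed.

End Bounds.

Section LabelL.
Variables (Gamma : groupType) (gamma : nat -> Gamma).
Local Notation label := (label D gamma).

Definition prefix_prod (m : nat) : Gamma := (\prod_(i < m) gamma i)%g.
Local Notation P := (prefix_prod n).

Lemma prefix_prodS m : prefix_prod m.+1 = (prefix_prod m * gamma m)%g.
Proof. by rewrite /prefix_prod big_ord_recr. Qed.

(* Near the line at infinity [t] is close to [x ^ 2], so a turn of [x] around
   infinity makes [t] cross all the cuts [{b = j, a > abscissa j}] twice. *)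
Definition labelL (q : X) : Gamma :=
  if 0 <= aA q then
    ((if 0 < xre q then 1 else P) * prefix_prod (level n (bA q)))%g
  else if 0 < xim q then P else 1%g.

(** Where [labelL] disagrees with the affine labels by [P * P]: the part of [Re t = 0] with [x] in
    the third quadrant. *)
Definition slit (q : X) : Prop := [/\ aA q = 0, xre q < 0 & xim q < 0].

Lemma near_sign (f : X -> R) q : {for q, continuous f} -> f q != 0 ->
  \forall q' \near q, (0 < f q') = (0 < f q).
Proof.
move=> cf; case: (ltgtP (f q) 0) => // h _.
  have nf : \forall q' \near q, f q' < 0 by exact: (cf _ (lt_nbhsl h)).
  by apply: filterS nf => q' h'; rewrite ltNge ltW.
have nf : \forall q' \near q, 0 < f q' by exact: (cf _ (lt_nbhsr h)).
by apply: filterS nf => q' ->.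
Qed.

Lemma level_locally_constant q : inA D q -> uncut n (bA q) ->
  \forall q' \near q, level n (bA q') = level n (bA q).
Proof.
move=> Aq ub; have h : chart (Strip (level n (bA q))) q by split=> //; exact: level_strip.
have := open_nbhs_nbhs (conj (@chart_open_piece _ _ _ D (Strip (level n (bA q)))) h).
by apply: filterS => q' [_ /strip_level].
Qed.

Lemma xre_continuous q : inA D q -> {for q, continuous xre}.
Proof.
move=> Aq; apply: (@continuous_comp _ _ _ (xA D) (fun z : C => complex.Re z)).
  exact: xA_continuous.
exact: Re_continuous.
Qed.

Lemma xim_continuous q : inA D q -> {for q, continuous xim}.
Proof.
move=> Aq; apply: (@continuous_comp _ _ _ (xA D) (fun z : C => complex.Im z)).
  exact: xA_continuous.
exact: Im_continuous.
Qed.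

Lemma label_Rgt_prefix j q : chart (Rgt j) q ->
  (prefix_prod (level n (bA q)) / label (Rgt j) q = prefix_prod j)%g.
Proof.
move=> [_ /= [jn h1 h2 _]]; rewrite /= (level_band jn h1 h2).
by case: ifP => _; rewrite ?prefix_prodS ?mulgK ?divg1.
Qed.

(** For [aA < 0] no cut is met; for [aA > 0] the prefix product and the label of [Rgt j] jump
    together; for [aA = 0] the level is 0 or [n] and [UL_tim_sign] ties the quadrant of [x] to the
    sign of [tim]. Only the third quadrant calls for the relation. *)
Lemma labelL_compat i q : UL q -> chart i q ->
  (P * P = 1)%g \/ ~ slit q ->
  \forall q' \near q, (labelL q' / label i q' = labelL q / label i q)%g.
Proof.
move=> Uq iq nslit; have Aq : inA D q by case: iq.
have nA := near_inA Aq.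
have n_i := open_nbhs_nbhs (conj (@chart_open_piece _ _ _ D i) iq).
case: (ltgtP (aA q) 0) => a0.
- have na : \forall q' \near q, aA q' < 0 by exact: (aA_continuous Aq (lt_nbhsl a0)).
  have nx := near_sign (xim_continuous Aq) (UL_xim_neq0 Uq Aq (ltW a0)).
  have nlab : \forall q' \near q, label i q' = label i q.
    case: (uncut_or_cut n (bA q)) => [ub|[j jn e]].
      exact: (label_locally_constant gamma iq ub).
    case: iq => _; rewrite e => /[dup] /(cut_piece jn)[] -> [_ _ _ h]; first exact: filterE.
    by have := lt_trans h (UL_cut_left Uq Aq jn e a0); rewrite ltxx.
  apply: filterS3 na nx nlab => q' a0' e1 e2.
  by rewrite /labelL !leNgt a0 a0' /= e1 e2.
- have na : \forall q' \near q, 0 < aA q' by exact: (aA_continuous Aq (lt_nbhsr a0)).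
  have nx := near_sign (xre_continuous Aq) (UL_xre_neq0 Uq Aq (ltW a0)).
  case: (uncut_or_cut n (bA q)) => [ub|[j jn e]].
    have nlab := label_locally_constant gamma iq ub.
    have nlev := level_locally_constant Aq ub.
    apply: filterS (filterI (filterI na nx) (filterI nlab nlev)) => q' [[a0' e1] [e2 e3]].
    by rewrite /labelL !ltW // e1 e2 e3.
  have ij : i = Rgt j.
    case: (iq) => _; rewrite e => /[dup] /(cut_piece jn)[] -> [_ _ _ h] //.
    by have := lt_trans h (UL_cut_right Uq Aq jn e a0); rewrite ltxx.
  subst i; apply: filterS3 na nx n_i => q' a0' e1 ijq'.
  by rewrite /labelL !ltW // e1 -!mulgA !label_Rgt_prefix.
- have x1 := UL_xre_neq0 Uq Aq; rewrite a0 lexx in x1; have {}x1 := x1 isT.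
  have x2 := UL_xim_neq0 Uq Aq; rewrite a0 lexx in x2; have {}x2 := x2 isT.
  have nx1 := near_sign (xre_continuous Aq) x1.
  have nx2 := near_sign (xim_continuous Aq) x2.
  have tx := UL_tim_sign Uq Aq a0.
  have n1 := cf_n_ge1 D.
  have nlevE (q' : X) : n%:R < bA q' -> level n (bA q') = n.
    by move=> h; apply: level_eq => //; [move=> _; lra|rewrite ltnn].
  have nlev0 (q' : X) : bA q' < 0 -> level n (bA q') = 0%N.
    by move=> h; apply: level_eq.
  case: (ltgtP (tim q) 0) => t0; last by move: tx; rewrite t0 mul0r ltxx.
    have b0 := UL_height_lt Uq Aq a0 t0.
    have nb : \forall q' \near q, bA q' < 0 by exact: (bA_continuous Aq (lt_nbhsl b0)).
    have ub : uncut n (bA q) by move=> j _; rewrite lt_eqF // (lt_le_trans b0).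
    have nlab := label_locally_constant gamma iq ub.
    have x12 : (0 < xim q) = ~~ (0 < xre q).
      move: tx; rewrite nmulr_rgt0 //.
      by case: (ltgtP (xre q) 0) x1 x2 => // h _; case: (ltgtP (xim q) 0) => // h' _; nra.
    apply: filterS (filterI (filterI nb nlab) (filterI nx1 nx2)) => q' [[b0' e1] [e2 e3]].
    rewrite /labelL e1 a0 lexx nlev0 // nlev0 // /prefix_prod big_ord0 !mulg1 e2 e3 x12.
    by case: (0 <= aA q'); case: (0 < xre q).
  have b0 := UL_height_gt Uq Aq a0 t0.
  have nb : \forall q' \near q, n%:R < bA q' by exact: (bA_continuous Aq (lt_nbhsr b0)).
  have ub : uncut n (bA q).
    by move=> j jn; rewrite gt_eqF // (le_lt_trans _ b0) // ler_nat ltnW.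
  have nlab := label_locally_constant gamma iq ub.
  have x12 : (0 < xim q) = (0 < xre q).
    move: tx; rewrite pmulr_rgt0 //.
    by case: (ltgtP (xre q) 0) x1 x2 => // h _; case: (ltgtP (xim q) 0) => // h' _; nra.
  apply: filterS (filterI (filterI nb nlab) (filterI nx1 nx2)) => q' [[b0' e1] [e2 e3]].
  rewrite /labelL e1 a0 lexx nlevE // nlevE // e2 e3 x12.
  case: (boolP (0 < xre q)) => xp; first by case: (0 <= aA q'); rewrite ?mul1g.
  (* Third quadrant: the two formulas give [P * P] and 1. *)
  case: (0 <= aA q') => //; suff -> : (P * P = 1)%g by [].
  case: nslit => // ns; exfalso; apply: ns; split=> //.
    by rewrite lt_neqAle x1 leNgt.
  by rewrite lt_neqAle x2 leNgt x12.
Qed.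

End LabelL.
End LabelAtInfinity.

(** * Generators *)

Section Cover.
Variables (R : realType) (n : nat).
Local Notation C := (Cplx R).
Variables (F : 'I_n -> mpoly 3 C) (D : conic_frame F).
Local Notation X := (complement F).
Local Notation c := (cf_c D).
Variable x0 : X.
Local Notation chart := (chart D).
Local Notation path a b := {path I01 R from a to b in X}.

(* [None] is the chart around the line at infinity. *)
Definition cover (i : option piece) : set X :=
  if i is Some k then chart k else UL D.

Definition cover_center (i : option piece) : X :=
  if i is Some k then center D x0 k else pt D x0 1 0 0.

Lemma cover_open i : open (cover i).
Proof. by case: i => [k|]; [exact: chart_open_piece|exact: UL_open]. Qed.

Lemma cover_contracts i p : cover i p -> contracts_to R (cover i) (cover_center i).
Proof. by case: i => [k|] /=; [exact: chart_contracts|move=> _; exact: UL_contracts]. Qed.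

Lemma cover_all q : exists i, cover i q.
Proof.
case: (inA_or_UL D q) => [/chart_cover[i iq]|Uq]; first by exists (Some i).
by exists None.
Qed.

Lemma pA_chart i a b : region D i (a, b) -> chart i (pA D x0 0 a b).
Proof. by move=> Pi; have [h1 h2 h3 h4] := pA_A x0 0 (region_safe Pi); split; rewrite ?h3 ?h4. Qed.

Lemma strip_center m : (m <= n)%N -> chart (Strip m) (center D x0 (Strip m)).
Proof. by move=> mn; apply: pA_chart => /=; split=> // _; lra. Qed.

Lemma strip_center_Lft m : (m < n)%N ->
  chart (Lft m) (center D x0 (Strip m)) /\ chart (Lft m) (center D x0 (Strip m.+1)).
Proof.
move=> mn; have /andP[h _] := abscissa_wide D m.
by split; apply: pA_chart => /=; split=> //; rewrite -?(natr1 m); lra.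
Qed.

Definition right_below (j : nat) : X := pA D x0 0 (wide D) (j%:R - 2^-1).
Definition right_above (j : nat) : X := pA D x0 0 (wide D) (j%:R + 2^-1).

Lemma right_below_charts j : (j < n)%N ->
  chart (Strip j) (right_below j) /\ chart (Rgt j) (right_below j).
Proof.
move=> jn; have /andP[_ h] := abscissa_wide D j.
by split; apply: pA_chart => /=; split=> //; try (by move=> _; lra); try lra; exact: ltnW.
Qed.

Lemma right_above_charts j : (j < n)%N ->
  chart (Rgt j) (right_above j) /\ chart (Strip j.+1) (right_above j).
Proof.
move=> jn; have /andP[_ h] := abscissa_wide D j.
by split; apply: pA_chart => /=; split=> //; rewrite -?(natr1 j); try (by move=> _; lra); lra.
Qed.

Definition far (x : C) : X := pt D x0 1 0 x^-1.

Lemma far_spec x : radius D < sqn x ->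
  [/\ UL D (far x), inA D (far x), xA D (far x) = x & tA D (far x) = x ^+ 2].
Proof.
move=> rx; have r1 := radius_gt1 D.
have x_neq0 : x != 0 by rewrite -sqn_eq0; apply/lt0r_neq0; lra.
have sx : 0 < sqn x by lra.
have s0 : sqn (0 : C) = 0 by apply/eqP; rewrite sqn_eq0.
have N : nearL D 0 x^-1.
  split; first by rewrite mul0r s0; lra.
  by rewrite sqnV // ltr_pdivrMr // mul1r.
have [] := coords_A (ptP (D := D) x0 (nearL_off N)); first by rewrite invr_eq0.
rewrite -/(far x) => h1 h2 h3; split=> //; first exact: UL_pt.
  by rewrite h2 div1r invrK.
by rewrite h3 mul0r add0r div1r invrK.
Qed.

(** Its square is [2 i radius^2], so [far_base] lies on the slit and in [Strip n]; the turn around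
    infinity starts and ends there. *)
Definition corner : C := (- radius D -i* radius D)%C.

Lemma corner_far : radius D < sqn corner.
Proof. by have := radius_gt1 D; rewrite /sqn /= => ?; nra. Qed.

Definition far_base : X := far corner.

Lemma far_base_charts : chart (Strip n) far_base /\ UL D far_base.
Proof.
have [h1 h2 h3 h4] := far_spec corner_far; split=> //; split=> //=.
have ta : tA D far_base = (0 +i* (2 * radius D ^+ 2))%C.
  by rewrite h4 expr2; apply/eqP; rewrite eq_complex /=; apply/andP; split; apply/eqP; ring.
have e1 : aA D far_base = 0 by rewrite /aA ta.
have e2 : tim D far_base = 2 * radius D ^+ 2 by rewrite /tim ta.
have := @UL_height_gt _ _ _ _ _ h1 h2 e1; rewrite e2 => hgt.
split=> //; last by rewrite ltnn.
move=> _; have r1 := radius_gt1 D; have : n%:R < bA D far_base by apply: hgt; nra.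
by lra.
Qed.

Section Connected.

Lemma cover_joined i p q : cover i p -> cover i q -> exists f : path p q, True.
Proof.
by move=> ip iq; have [f _] := contracts_to_join (cover_contracts ip) ip iq; exists f.
Qed.

Lemma strip_joined m : (m <= n)%N ->
  exists f : path (center D x0 (Strip 0)) (center D x0 (Strip m)), True.
Proof.
elim: m => [_|m IH mn]; first by exists (cst_path R _).
have [f _] := IH (ltnW mn); have [h1 h2] := strip_center_Lft mn.
have [g _] := @cover_joined (Some (Lft m)) _ _ h1 h2.
by exists (concat f g).
Qed.

Lemma base_joined q : exists f : path (center D x0 (Strip 0)) q, True.
Proof.
have viaS m p : (m <= n)%N -> chart (Strip m) p -> exists f : path (center D x0 (Strip 0)) p, True.
  move=> mn mp; have [f _] := strip_joined mn.
  have [g _] := @cover_joined (Some (Strip m)) _ _ (strip_center mn) mp.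
  by exists (concat f g).
have [[i|] iq] := cover_all q; last first.
  have [h1 h2] := far_base_charts; have [f _] := viaS n _ (leqnn n) h1.
  have [g _] := @cover_joined None _ _ h2 iq.
  by exists (concat f g).
case: i iq => [m|j|j] iq.
- have mn : (m <= n)%N by case: iq => _ [].
  exact: viaS mn iq.
- have jn : (j < n)%N by case: iq => _ [].
  have [f _] := strip_joined (ltnW jn); have [h1 _] := strip_center_Lft jn.
  have [g _] := @cover_joined (Some (Lft j)) _ _ h1 iq.
  by exists (concat f g).
- have jn : (j < n)%N by case: iq => _ [].
  have [h1 h2] := right_below_charts jn; have [f _] := viaS j _ (ltnW jn) h1.
  have [g _] := @cover_joined (Some (Rgt j)) _ _ h2 iq.
  by exists (concat f g).
Qed.

Lemma complement_joined (p q : X) : exists f : path p q, True.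
Proof.
have [f _] := base_joined p; have [g _] := base_joined q.
by exists (concat (path_rev f) g).
Qed.

End Connected.

Local Notation spoke := (spoke cover_contracts).

(** Provides a path for every triple, arbitrary when [p] is not in both charts, so that the tethers
    can be defined without membership proofs. *)
Lemma edge_exists i j p : exists s : path (cover_center i) (cover_center j),
  forall (hi : cover i p) (hj : cover j p),
  s = concat (spoke hi) (path_rev (spoke hj)).
Proof.
have [[hi hj]|h] := pselect (cover i p /\ cover j p).
  exists (concat (spoke hi) (path_rev (spoke hj))) => hi' hj'.
  by rewrite (Prop_irrelevance hi hi') (Prop_irrelevance hj hj').
have [f _] := complement_joined (cover_center i) (cover_center j).
by exists f => hi hj; case: h.
Qed.

Definition edge i j p : path (cover_center i) (cover_center j) :=
  projT1 (cid (edge_exists i j p)).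

Lemma edgeE i j p (hi : cover i p) (hj : cover j p) :
  edge i j p = concat (spoke hi) (path_rev (spoke hj)).
Proof. by rewrite /edge; case: cid. Qed.

(* The tethers follow the tree of charts
   [Strip 0 - Lft 0 - Strip 1 - ... - Strip n], [Strip j - Rgt j], [Strip n - infinity]. *)
Fixpoint strip_tether (m : nat) : path x0 (cover_center (Some (Strip m))) :=
  match m with
  | 0%N => projT1 (cid (complement_joined x0 (cover_center (Some (Strip 0)))))
  | k.+1 => concat (concat (strip_tether k)
      (edge (Some (Strip k)) (Some (Lft k)) (center D x0 (Strip k))))
      (edge (Some (Lft k)) (Some (Strip k.+1)) (center D x0 (Strip k.+1)))
  end.

Definition tau (i : option piece) : path x0 (cover_center i) :=
  match i with
  | Some (Strip m) => strip_tether m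
  | Some (Lft j) => concat (strip_tether j)
      (edge (Some (Strip j)) (Some (Lft j)) (center D x0 (Strip j)))
  | Some (Rgt j) => concat (strip_tether j)
      (edge (Some (Strip j)) (Some (Rgt j)) (right_below j))
  | None => concat (strip_tether n) (edge (Some (Strip n)) None far_base)
  end.

Definition tr i j p (hi : cover i p) (hj : cover j p) : pi1 R x0 :=
  trans cover_contracts tau hi hj.

Lemma tr_edge i j p (hi : cover i p) (hj : cover j p) :
  tau j = concat (tau i) (edge i j p) -> tr hi hj = 1%g.
Proof. by move=> e; apply: trans_tree; rewrite e (edgeE hi hj). Qed.

Lemma tr_chart_path i j p q (ip : chart i p) (jp : chart j p) (iq : chart i q)
    (jq : chart j q) :
  @tr (Some i) (Some j) p ip jp = @tr (Some i) (Some j) q iq jq.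
Proof.
have [f [fi fj]] := chart_join x0 ip jp iq jq.
exact: (trans_path (U := cover) cover_contracts tau (i := Some i) (j := Some j) _ _ _ _ fi fj).
Qed.

Lemma tr_Strip_Lft m p (h : chart (Strip m) p) (h' : chart (Lft m) p) :
  @tr (Some (Strip m)) (Some (Lft m)) p h h' = 1%g.
Proof.
have mn : (m < n)%N by case: h' => _ [].
rewrite (tr_chart_path h h' (strip_center (ltnW mn)) (strip_center_Lft mn).1).
exact: tr_edge.
Qed.

Lemma tr_Lft_Strip m p (h : chart (Lft m) p) (h' : chart (Strip m.+1) p) :
  @tr (Some (Lft m)) (Some (Strip m.+1)) p h h' = 1%g.
Proof.
have mn : (m < n)%N by case: h => _ [].
rewrite (tr_chart_path h h' (strip_center_Lft mn).2 (strip_center mn)).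
exact: tr_edge.
Qed.

Lemma tr_Strip_Rgt m p (h : chart (Strip m) p) (h' : chart (Rgt m) p) :
  @tr (Some (Strip m)) (Some (Rgt m)) p h h' = 1%g.
Proof.
have mn : (m < n)%N by case: h' => _ [].
rewrite (tr_chart_path h h' (right_below_charts mn).1 (right_below_charts mn).2).
exact: tr_edge.
Qed.

Lemma tr_far_base (h : chart (Strip n) far_base) (h' : UL D far_base) :
  @tr (Some (Strip n)) None far_base h h' = 1%g.
Proof. exact: tr_edge. Qed.

(** Crossing the [j]-th cut upwards closes a cycle of charts that the tree of tethers leaves open; 1
    is a default for [j >= n]. *)
Definition alpha (j : nat) : pi1 R x0 :=
  if pselect (j < n)%N is left jn then
    @tr (Some (Rgt j)) (Some (Strip j.+1)) _ (right_above_charts jn).1 (right_above_charts jn).2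
  else 1%g.

Lemma tr_Rgt_Strip m p (h : chart (Rgt m) p) (h' : chart (Strip m.+1) p) :
  @tr (Some (Rgt m)) (Some (Strip m.+1)) p h h' = alpha m.
Proof.
have mn : (m < n)%N by case: h => _ [].
by rewrite /alpha; case: pselect => // jn; exact: tr_chart_path.
Qed.

Local Notation label := (label D alpha).

Lemma tr_to_strip i m p (h : chart i p) (h' : chart (Strip m) p) :
  @tr (Some i) (Some (Strip m)) p h h' = label i p.
Proof.
have lm : level n (bA D p) = m by case: h' => _ /strip_level.
case: i h => [m'|j|j] h.
- have e : m' = m by case: (h) => _ /strip_level; rewrite lm.
  by move: h; rewrite e => h; exact: trans_refl.
- have [_ [jn h1 h2 _]] := h; move: lm; rewrite (level_band jn h1 h2) /=.
  case: ifP => _ e; move: h'; rewrite -e => h'; first exact: tr_Lft_Strip.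
  by rewrite /tr -transV [trans _ _ _ _]tr_Strip_Lft invg1.
- have [_ [jn h1 h2 _]] := h; move: lm; rewrite (level_band jn h1 h2) /=.
  case: ifP => _ e; move: h'; rewrite -e => h'; first exact: tr_Rgt_Strip.
  by rewrite /tr -transV [trans _ _ _ _]tr_Strip_Rgt invg1.
Qed.

(** At an uncut height both charts are compared with the strip containing the point; at a cut height
    they coincide. *)
Lemma tr_label i j p (hi : chart i p) (hj : chart j p) :
  @tr (Some i) (Some j) p hi hj = (label i p / label j p)%g.
Proof.
case: (uncut_or_cut n (bA D p)) => [ub|[k kn e]].
  have hm : chart (Strip (level n (bA D p))) p.
    by split; [case: hi|exact: level_strip].
  rewrite -(tr_to_strip hi hm) -(tr_to_strip hj hm) /tr transV.
  by symmetry; exact: transM.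
have ij : i = j.
  case: (hi) (hj) => _ Pi [_ Pj]; rewrite e in Pi Pj.
  exact: region_unique_on_cut kn Pi Pj.
by subst j; rewrite mulgV; exact: trans_refl.
Qed.

End Cover.

(** * The relation *)

Section TurnFunctions.
Variable R : realType.
Implicit Types v : R.

(** Angles are counted in turns, to match [unit_circle]. *)
Definition cosT v : R := cos (2 * pi * v).
Definition sinT v : R := sin (2 * pi * v).

Lemma cosT_continuous : continuous cosT.
Proof.
apply: (continuous_compT (a := fun v => 2 * pi * v)); last exact: continuous_cos.
have -> : (fun v : R => 2 * pi * v) = (fun v => 2 * pi * v + 0).
  by apply/funext => v; rewrite addr0.
by apply: continuous_affine => v A vA; exact: vA.
Qed.

Lemma sinT_continuous : continuous sinT.
Proof.
apply: (continuous_compT (a := fun v => 2 * pi * v)); last exact: continuous_sin.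
have -> : (fun v : R => 2 * pi * v) = (fun v => 2 * pi * v + 0).
  by apply/funext => v; rewrite addr0.
by apply: continuous_affine => v A vA; exact: vA.
Qed.

Lemma cosT2_sinT2 v : cosT v ^+ 2 + sinT v ^+ 2 = 1.
Proof. exact: cos2Dsin2. Qed.

Lemma cosT0 : cosT 0 = 1. Proof. by rewrite /cosT mulr0 cos0. Qed.
Lemma sinT0 : sinT 0 = 0. Proof. by rewrite /sinT mulr0 sin0. Qed.

Lemma cosTS v : cosT (v + 1) = cosT v.
Proof. by rewrite /cosT mulrDr mulr1 mulr_natl cosD2pi. Qed.

Lemma sinTS v : sinT (v + 1) = sinT v.
Proof. by rewrite /sinT mulrDr mulr1 mulr_natl sinD2pi. Qed.

Lemma cosT_half v : cosT (v + 2^-1) = - cosT v.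
Proof. by rewrite /cosT mulrDr (mulrC 2 pi) mulfK ?pnatr_eq0 // cosDpi. Qed.

Lemma sinT_half v : sinT (v + 2^-1) = - sinT v.
Proof. by rewrite /sinT mulrDr (mulrC 2 pi) mulfK ?pnatr_eq0 // sinDpi. Qed.

Lemma cosT_gt0 v : - 4^-1 < v < 4^-1 -> 0 < cosT v.
Proof.
move=> /andP[h1 h2]; have p0 := pi_gt0 R; apply: cos_gt0_pihalf; apply/andP.
have : 0 < pi * (4^-1 - v) by rewrite mulr_gt0 ?subr_gt0.
have : 0 < pi * (v + 4^-1) by rewrite mulr_gt0 //; lra.
by split; lra.
Qed.

Lemma sinT_gt0 v : 0 < v < 2^-1 -> 0 < sinT v.
Proof.
move=> /andP[h1 h2]; have p0 := pi_gt0 R; apply: sin_gt0_pi; apply/andP.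
have : 0 < pi * (2^-1 - v) by rewrite mulr_gt0 ?subr_gt0.
have : 0 < pi * v by rewrite mulr_gt0.
by split; lra.
Qed.

Lemma cosT_lt0 v : 4^-1 < v < 3 / 4 -> cosT v < 0.
Proof. by move=> h; rewrite -(subrK 2^-1 v) cosT_half oppr_lt0 cosT_gt0 //; lra. Qed.

Lemma sinT_lt0 v : 2^-1 < v < 1 -> sinT v < 0.
Proof. by move=> h; rewrite -(subrK 2^-1 v) sinT_half oppr_lt0 sinT_gt0 //; lra. Qed.

Lemma cosT_gt0_right v : 3 / 4 < v < 5 / 4 -> 0 < cosT v.
Proof. by move=> h; rewrite -(subrK 1 v) cosTS cosT_gt0 //; lra. Qed.

Lemma sinT1 : sinT 1 = 0. Proof. by rewrite -(add0r 1) sinTS sinT0. Qed.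
Lemma cosT1 : cosT 1 = 1. Proof. by rewrite -[X in cosT X]add0r cosTS cosT0. Qed.

Lemma unit_circleE (t : I01 R) :
  unit_circle t = (cosT (I01_val t) +i* sinT (I01_val t))%C.
Proof. by []. Qed.

Lemma sqn_unit_circle (t : I01 R) : sqn (unit_circle t) = 1.
Proof. exact: cosT2_sinT2. Qed.

Lemma unit_circle_continuous (t : I01 R) : {for t, continuous (@unit_circle R)}.
Proof.
apply: continuous_complex.
  apply: (@continuous_comp _ _ _ (@I01_val R) cosT); first exact: I01_val_continuous.
  exact: cosT_continuous.
apply: (@continuous_comp _ _ _ (@I01_val R) sinT); first exact: I01_val_continuous.
exact: sinT_continuous.
Qed.

Lemma I01_val_zero : I01_val (zero : I01 R) = 0.
Proof. by rewrite I01_zeroE I01_valK ?lexx ?ler01. Qed.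

Lemma I01_val_one : I01_val (one : I01 R) = 1.
Proof. by rewrite I01_oneE I01_valK ?lexx ?ler01. Qed.

Lemma unit_circle_zero : unit_circle (zero : I01 R) = 1.
Proof. by rewrite unit_circleE I01_val_zero cosT0 sinT0. Qed.

Lemma unit_circle_one : unit_circle (one : I01 R) = 1.
Proof. by rewrite unit_circleE I01_val_one cosT1 sinT1. Qed.

Lemma near_I01_gt (t : I01 R) r : r < I01_val t -> \forall u \near t, r < I01_val u.
Proof. by move=> h; exact: (I01_val_continuous (lt_nbhsr h)). Qed.

Lemma near_I01_lt (t : I01 R) r : I01_val t < r -> \forall u \near t, I01_val u < r.
Proof. by move=> h; exact: (I01_val_continuous (lt_nbhsl h)). Qed.

End TurnFunctions.

Section Relation.
Variables (R : realType) (n : nat).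
Local Notation C := (Cplx R).
Variables (F : 'I_n -> mpoly 3 C) (D : conic_frame F).
Local Notation X := (complement F).
Variable x0 : X.
Local Notation chart := (chart D).
Local Notation alpha := (alpha D x0).
Local Notation label := (label D alpha).
Local Notation P := (prefix_prod alpha n).
Local Notation path a b := {path I01 R from a to b in X}.

Definition clam i j p q (hp : cover D i p) (hq : cover D j q) (f : path p q) : pi1 R x0 :=
  lam (@cover_contracts R n F D x0) (tau D x0) hp hq f.

Lemma clam_label p q (f : path p q) (K : I01 R -> pi1 R x0) :
  (forall t, exists i, chart i (f t) /\
     \forall u \near t, (K u / label i (f u) = K t / label i (f t))%g) ->
  forall i j (hp : chart i p) (hq : chart j q),
  @clam (Some i) (Some j) p q hp hq f = (label i p / K zero * (K one / label j q))%g.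
Proof.
move=> loc i j hp hq.
pose l (k : option piece) (r : X) : pi1 R x0 := if k is Some k' then label k' r else 1%g.
pose J := [set k : option piece | exists k', k = Some k'].
have trE : forall k k' r (hk : cover D k r) (hk' : cover D k' r), J k -> J k' ->
    trans (@cover_contracts R n F D x0) (tau D x0) hk hk' = (l k r / l k' r)%g.
  by move=> k k' r hk hk' [m ek] [m' ek']; subst k k'; exact: tr_label.
have loc' t : exists k, [/\ J k, cover D k (f t) &
    \forall u \near t, (K u / l k (f u) = K t / l k (f t))%g].
  by have [k [h1 h2]] := loc t; exists (Some k); split=> //; exists k.
have Js k : J (Some k) by exists k.
exact: (lam_lift (@cover_open R n F D) trE loc' (i := Some i) (j := Some j) hp hq (Js i) (Js j)).
Qed.

Definition corner_turn (t : I01 R) : C := corner D * unit_circle t.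

Lemma sqn_corner_turn t : radius D < sqn (corner_turn t).
Proof. by rewrite /corner_turn sqnM sqn_unit_circle mulr1; exact: corner_far. Qed.

Lemma far_turn_continuous : continuous (fun t => far D x0 (corner_turn t)).
Proof.
move=> t.
have cc : {for t, continuous (cst (corner D) : I01 R -> C)} by exact: cst_continuous.
have cx : {for t, continuous corner_turn}.
  exact: (continuousM cc (@unit_circle_continuous R t)).
have x_neq0 : corner_turn t != 0.
  rewrite -sqn_eq0 lt0r_neq0 // (lt_trans _ (sqn_corner_turn t)) //.
  by rewrite (lt_trans ltr01) // radius_gt1.
have c1 : {for t, continuous (cst 1 : I01 R -> C)} by exact: cst_continuous.
have c0 : {for t, continuous (cst 0 : I01 R -> C)} by exact: cst_continuous.
have off : off_conics (cf_c D) 1 0 (corner_turn t)^-1.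
  have [Uf Af xf tf] := far_spec x0 (sqn_corner_turn t).
  apply: nearL_off; split; first by rewrite mul0r /sqn /= expr0n addr0 invr_gt0 ltr0n.
  rewrite sqnV // ltr_pdivrMr ?mul1r; first exact: sqn_corner_turn.
  by rewrite (lt_trans _ (sqn_corner_turn t)) // (lt_trans ltr01) // radius_gt1.
exact: (pt_continuous c1 c0 (continuousV x_neq0 cx) off).
Qed.

Lemma far_turn_zero : far D x0 (corner_turn zero) = far_base D x0.
Proof. by rewrite /corner_turn unit_circle_zero mulr1. Qed.

Lemma far_turn_one : far D x0 (corner_turn one) = far_base D x0.
Proof. by rewrite /corner_turn unit_circle_one mulr1. Qed.

Definition far_turn : path (far_base D x0) (far_base D x0) :=
  mk_path far_turn_continuous far_turn_zero far_turn_one.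

Section TurnCoordinates.
Variable t : I01 R.
Local Notation v := (I01_val t).

Lemma far_turn_UL : UL D (far_turn t).
Proof. by have [] := far_spec x0 (sqn_corner_turn t). Qed.

Lemma far_turn_A : inA D (far_turn t).
Proof. by have [] := far_spec x0 (sqn_corner_turn t). Qed.

Lemma far_turn_xre : xre D (far_turn t) = radius D * (sinT v - cosT v).
Proof.
have [_ _ e _] := far_spec x0 (sqn_corner_turn t).
by rewrite /xre [far_turn t]/= e /corner_turn unit_circleE /=; ring.
Qed.

Lemma far_turn_xim : xim D (far_turn t) = - radius D * (sinT v + cosT v).
Proof.
have [_ _ e _] := far_spec x0 (sqn_corner_turn t).
by rewrite /xim [far_turn t]/= e /corner_turn unit_circleE /=; ring.
Qed.

Lemma far_turn_a : aA D (far_turn t) = - 4 * radius D ^+ 2 * (cosT v * sinT v).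
Proof.
have [_ _ _ e] := far_spec x0 (sqn_corner_turn t).
by rewrite /aA [far_turn t]/= e /corner_turn unit_circleE expr2 /=; ring.
Qed.

End TurnCoordinates.

(** On the circle [t = x^2] is imaginary once in each quadrant of [x]; in the third one this happens
    at the corner, the start and end of the turn. *)
Lemma far_turn_not_slit (t : I01 R) : 0 < I01_val t < 1 -> ~ slit D (far_turn t).
Proof.
move=> /andP[t0 t1] []; rewrite far_turn_a far_turn_xre far_turn_xim.
have r1 := radius_gt1 D; have r0 : 0 < radius D by lra.
have r20 : 0 < radius D ^+ 2 by rewrite exprn_gt0.
have k0 : - 4 * radius D ^+ 2 != 0 by apply: ltr0_neq0; lra.
move=> /eqP; rewrite mulf_eq0 (negbTE k0) /= mulf_eq0.
rewrite pmulr_rlt0 // mulNr oppr_lt0 pmulr_rgt0 // => /orP[/eqP->|/eqP s0]; first lra.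
rewrite s0 sub0r oppr_lt0 add0r => c0 _; move: s0 c0.
have [h|h|h] := ltgtP (I01_val t) 2^-1.
- have : 0 < sinT (I01_val t) by apply: sinT_gt0; rewrite t0.
  by move=> /lt0r_neq0/negbTE h' /eqP; rewrite h'.
- have : sinT (I01_val t) < 0 by apply: sinT_lt0; rewrite h.
  by move=> /ltr0_neq0/negbTE h' /eqP; rewrite h'.
- by have : cosT (I01_val t) < 0 by [apply: cosT_lt0; lra]; move=> h1 _ h2; lra.
Qed.

(* Lifting one turn of [x], from just after to just before the slit, multiplies
   by [P * P], although the turn is contractible in the chart at infinity. *)
Lemma squared_product_trivial : (P * P = 1)%g.
Proof.
have [hS hL] := far_base_charts D x0.
(* On the slit [labelL] takes the value [P * P] of the end of the turn, while just after the start
   it is 1; so the value at 0 is set to 1. *)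
pose K (t : I01 R) := if 0 < I01_val t then labelL D alpha (far_turn t) else 1%g.
have n_strip (t : I01 R) : far_turn t = far_base D x0 ->
    \forall u \near t, chart (Strip n) (far_turn u).
  move=> e; have nS : nbhs (far_turn t) (chart (Strip n)).
    by rewrite e; exact: open_nbhs_nbhs (conj (@chart_open_piece _ _ _ D (Strip n)) hS).
  exact: (@cts_fun _ _ far_turn t _ nS).
have r1 := radius_gt1 D; have r0 : 0 < radius D by lra.
have r20 : 0 < radius D ^+ 2 by rewrite exprn_gt0.
have K1 : K one = (P * P)%g.
  rewrite /K I01_val_one ltr01 /labelL far_turn_a far_turn_xre I01_val_one cosT1 sinT1.
  rewrite !mulr0 lexx sub0r mulrN1 oppr_gt0 ltNge ltW //=.
  by rewrite path_one; case: hS => _ /strip_level ->.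
have Kend (u : I01 R) : chart (Strip n) (far_turn u) -> 3 / 4 < I01_val u ->
    K u = (P * P)%g.
  move=> [_ /strip_level lu] h; have /andP[_ u1] := I01_bounds u.
  have cu : 0 < cosT (I01_val u) by apply: cosT_gt0_right; lra.
  have su : sinT (I01_val u) <= 0.
    move: u1; rewrite le_eqVlt => /orP[/eqP->|u1]; first by rewrite sinT1.
    by apply/ltW/sinT_lt0; lra.
  rewrite /K (lt_trans _ h) ?divr_gt0 ?ltr0n // /labelL far_turn_a far_turn_xre lu.
  have cs : 0 <= - (cosT (I01_val u) * sinT (I01_val u)).
    by rewrite oppr_ge0 mulr_ge0_le0 // ltW.
  rewrite ifT; last by have := mulr_ge0 (ltW r20) cs; lra.
  by rewrite ifF //; apply/negbTE; rewrite -leNgt pmulr_rle0 //; lra.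
have loc t : exists i, chart i (far_turn t) /\
    \forall u \near t, (K u / label i (far_turn u) = K t / label i (far_turn t))%g.
  have /andP[] := I01_bounds t; rewrite le_eqVlt => /orP[/eqP t0|t0] t1.
    have tz : t = zero by rewrite -(clampK t) -t0.
    exists (Strip n); rewrite tz path_zero; split=> //.
    have n1 : \forall u \near (zero : I01 R), I01_val u < 4^-1.
      by apply: near_I01_lt; rewrite I01_val_zero invr_gt0 ltr0n.
    apply: filterS n1 => u u4; rewrite /= !divg1 /K I01_val_zero ltxx.
    case: ifP => // u0.
    have cu : 0 < cosT (I01_val u) by apply: cosT_gt0; lra.
    have su : 0 < sinT (I01_val u) by apply: sinT_gt0; lra.
    have cs := mulr_gt0 cu su.
    rewrite /labelL far_turn_a far_turn_xim ifF; last first.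
      by apply/negbTE; rewrite -ltNge; have := mulr_gt0 r20 cs; lra.
    by rewrite ifF // mulNr oppr_gt0; apply/negbTE; rewrite -leNgt mulr_ge0 ?ltW // addr_gt0.
  move: t1; rewrite le_eqVlt => /orP[/eqP t1|t1].
    have te : t = one by rewrite -(clampK t) t1.
    exists (Strip n); rewrite te path_one; split=> //.
    have n1 : \forall u \near (one : I01 R), 3 / 4 < I01_val u.
      by apply: near_I01_gt; rewrite I01_val_one; lra.
    have n2 := n_strip one (@path_one _ _ _ _ far_turn).
    by apply: filterS2 n1 n2 => u h1 h2; rewrite /= !divg1 (Kend u) // K1.
  have [i it] := chart_cover (far_turn_A t); exists i; split=> //.
  have nl := labelL_compat (gamma := alpha) (far_turn_UL t) it
    (or_intror (far_turn_not_slit (introT andP (conj t0 t1)))).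
  have n1 : \forall u \near t, (labelL D alpha (far_turn u) / label i (far_turn u) =
      labelL D alpha (far_turn t) / label i (far_turn t))%g.
    exact: (@cts_fun _ _ far_turn t _ nl).
  have n2 := near_I01_gt t0.
  by apply: filterS2 n1 n2 => u e u0; rewrite /K u0 t0.
have K0 : K zero = 1%g by rewrite /K I01_val_zero ltxx.
(* The turn stays in the chart at infinity, so its class is a transition into that chart times the
   inverse transition. *)
have trivial_turn : @clam (Some (Strip n)) (Some (Strip n)) _ _ hS hS far_turn = 1%g.
  rewrite /clam (lam_trans (i := Some (Strip n)) (j := Some (Strip n)) (k := None)
    _ _ hS hS hL hL far_turn_UL).
  by rewrite -(transV _ _ (i := Some (Strip n)) (j := None) hS hL) mulgV.
have := clam_label loc hS hS.
by rewrite trivial_turn K0 K1 /= !divg1 mul1g.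
Qed.

End Relation.

(** * Generation *)

Section FarConnected.
Variables (R : realType) (n : nat).
Local Notation C := (Cplx R).
Variables (F : 'I_n -> mpoly 3 C) (D : conic_frame F).
Local Notation X := (complement F).
Variable x0 : X.
Local Notation path a b := {path I01 R from a to b in X}.

Definition near_infinity (q : X) : Prop := UL D q /\ inA D q.

Definition far_joined (p q : X) : Prop :=
  exists f : path p q, forall t, near_infinity (f t).

Lemma far_joined_trans p q r : far_joined p q -> far_joined q r -> far_joined p r.
Proof.
by move=> [f fP] [g gP]; exists (concat f g); exact: concat_in.
Qed.

Lemma far_segment (y w y' w' : C) :
  (forall s : R, 0 <= s <= 1 -> let z := ((1 - s)%:C * w + s%:C * w')%C in
     nearL D ((1 - s)%:C * y + s%:C * y')%C z /\ z != 0) ->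
  far_joined (pt D x0 1 y w) (pt D x0 1 y' w').
Proof.
move=> ok.
pose lin (u u' : C) (t : I01 R) := ((1 - I01_val t)%:C * u + (I01_val t)%:C * u')%C : C.
have clin u u' t : {for t, continuous (lin u u')}.
  have cv : {for t, continuous (fun t : I01 R => ((I01_val t)%:C)%C : C)}.
    apply: (@continuous_comp _ _ _ (@I01_val R) (fun r : R => (r%:C)%C : C)).
      exact: I01_val_continuous.
    exact: real_complex_continuous.
  have cv' : {for t, continuous (fun t : I01 R => ((1 - I01_val t)%:C)%C : C)}.
    apply: (@continuous_comp _ _ _ (fun t : I01 R => 1 - I01_val t) (fun r : R => (r%:C)%C : C)).
      have c1 : {for t, continuous (cst 1 : I01 R -> R)} by exact: cst_continuous.
      exact: (continuousB c1 (@I01_val_continuous R t)).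
    exact: real_complex_continuous.
  have cu (z : C) : {for t, continuous (cst z : I01 R -> C)} by exact: cst_continuous.
  exact: (continuousD (continuousM cv' (cu u)) (continuousM cv (cu u'))).
have lin0 u u' : lin u u' zero = u.
  by rewrite /lin I01_val_zero subr0 mul1r mul0r addr0.
have lin1 u u' : lin u u' one = u'.
  by rewrite /lin I01_val_one subrr mul1r mul0r add0r.
have okt t := ok _ (I01_bounds t).
pose g t := pt D x0 1 (lin y y' t) (lin w w' t).
have cg : continuous g.
  move=> t; have c1 : {for t, continuous (cst 1 : I01 R -> C)} by exact: cst_continuous.
  exact: (pt_continuous c1 (clin y y' t) (clin w w' t) (nearL_off (okt t).1)).
have g0 : g zero = pt D x0 1 y w by rewrite /g !lin0.
have g1 : g one = pt D x0 1 y' w' by rewrite /g !lin1.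
exists (mk_path cg g0 g1) => t; have [N z0] := okt t.
have [h1 h2 h3] := pt_L x0 N; split; first exact: (UL_pt x0 N).
by apply/(A_of_L h1); rewrite h3.
Qed.

Definition cross (w w' : C) : R :=
  complex.Re w * complex.Im w' - complex.Im w * complex.Re w'.

Lemma sqn0 : sqn (0 : C) = 0.
Proof. by apply/eqP; rewrite sqn_eq0. Qed.

(** A nonzero determinant makes [w] and [w'] independent over the reals, so the segment misses 0;
    the bound on [sqn] is convex. *)
Lemma far_segment_cross (w w' : C) : radius D * sqn w < 1 -> radius D * sqn w' < 1 ->
  cross w w' != 0 -> far_joined (pt D x0 1 0 w) (pt D x0 1 0 w').
Proof.
move=> h h' cr; have r1 := radius_gt1 D; apply: far_segment => s s01 z.
have sc (r : R) (u : C) : (r%:C)%C * u = (r * complex.Re u +i* (r * complex.Im u))%C.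
  by case: u => a b /=; apply/eqP; rewrite eq_complex /= !mul0r subr0 addr0 !eqxx.
move: h h' cr; rewrite /z !mulr0 addr0 !sc {z}; case: w => a b; case: w' => a' b'.
rewrite /nearL mul0r sqn0 /cross /sqn /= => h h' cr; case/andP: s01 => s0 s1.
split.
  split; first by rewrite invr_gt0 ltr0n.
  have e1 : 0 <= (1 - s) * s * ((a - a') ^+ 2 + (b - b') ^+ 2).
    by apply: mulr_ge0; [apply: mulr_ge0; lra|apply: addr_ge0; exact: sqr_ge0].
  have e2 : 0 <= radius D * ((1 - s) * s * ((a - a') ^+ 2 + (b - b') ^+ 2)).
    by rewrite mulr_ge0 //; lra.
  have e3 : (1 - s) * (radius D * (a ^+ 2 + b ^+ 2)) + s * (radius D * (a' ^+ 2 + b' ^+ 2)) < 1.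
    exact: convex_gt h h' (introT andP (conj s0 s1)).
  apply: le_lt_trans e3; rewrite -subr_ge0; move: e2; congr (0 <= _); ring.
apply/eqP => -[e1 e2].
have c1 : (1 - s) * (a * b' - b * a') = 0.
  have -> : (1 - s) * (a * b' - b * a') =
    ((1 - s) * a + s * a') * b' - ((1 - s) * b + s * b') * a' by ring.
  by rewrite e1 e2 !mul0r subrr.
have c2 : s * (a * b' - b * a') = 0.
  have -> : s * (a * b' - b * a') =
    a * ((1 - s) * b + s * b') - b * ((1 - s) * a + s * a') by ring.
  by rewrite e1 e2 !mulr0 subrr.
by move/eqP: cr; apply; lra.
Qed.

(** When [w] and [w'] are real multiples of each other the path turns through [i w], independent of
    both. *)
Lemma far_rotate (w w' : C) : w != 0 -> w' != 0 ->
  radius D * sqn w < 1 -> radius D * sqn w' < 1 ->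
  far_joined (pt D x0 1 0 w) (pt D x0 1 0 w').
Proof.
move=> w0 w'0 h h'; have [cr|] := eqVneq (cross w w') 0; last exact: far_segment_cross.
pose iw : C := (- complex.Im w +i* complex.Re w)%C.
have siw : sqn iw = sqn w by rewrite /sqn /= sqrrN addrC.
have sw : 0 < sqn w by rewrite lt_def sqn_eq0 w0 sqn_ge0.
have sw' : 0 < sqn w' by rewrite lt_def sqn_eq0 w'0 sqn_ge0.
apply: (@far_joined_trans _ (pt D x0 1 0 iw)); apply: far_segment_cross; rewrite ?siw //.
  have -> : cross w iw = sqn w by rewrite /cross /sqn /=; ring.
  exact: lt0r_neq0.
apply/eqP => dt; have : sqn w * sqn w' = cross w w' ^+ 2 + cross iw w' ^+ 2.
  by rewrite /cross /sqn /=; ring.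
by rewrite cr dt expr0n addr0 => /eqP; rewrite gt_eqF // mulr_gt0.
Qed.

(** [w] is moved first, in a punctured disc with [y = 0]; then [y] grows to its value with [w]
    fixed. *)
Lemma far_base_joined p : near_infinity p -> far_joined (far_base D x0) p.
Proof.
move=> [[Lp [N1 N2]] Ap]; have w0 : wL D p != 0 by exact/(A_of_L Lp).
have [[Lb [_ bN2]] Ab _ _] := far_spec x0 (corner_far D).
have b_neq0 : (corner D)^-1 != 0.
  rewrite invr_eq0 -sqn_eq0 lt0r_neq0 // (lt_trans _ (corner_far D)) //.
  by rewrite (lt_trans ltr01) // radius_gt1.
have bN : radius D * sqn (corner D)^-1 < 1.
  have cf := corner_far D; have r1 := radius_gt1 D.
  by rewrite sqnV ?ltr_pdivrMr ?mul1r //; [lra|rewrite -invr_eq0].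
apply: (@far_joined_trans _ (pt D x0 1 0 (wL D p))).
  exact: far_rotate.
rewrite -[p in far_joined _ p](pt_L_eq x0 Lp); apply: far_segment => s s01 z.
have -> : z = wL D p by rewrite /z -mulrDl -raddfD /= subrK mul1r.
rewrite mulr0 add0r; split=> //.
have := nearL_scale s01 (_ : 0 <= 1 <= 1) (conj N1 N2); rewrite mul1r; apply.
by rewrite ler01 lexx.
Qed.

(** Affine transitions are quotients of labels. For a transition from infinity at [r], a path near
    infinity from [far_base] to [r] is read twice: through affine charts it lies in [H]; through the
    chart at infinity it is that transition, the one at [far_base] being 1. *)
Lemma alpha_generates (H : {pred pi1 R x0}) : group_closed H ->
  (forall j, (j < n)%N -> alpha D x0 j \in H) -> forall a, a \in H.
Proof.
move=> Hg Ha; have [H1 HD] := Hg.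
have labH i q : chart D i q -> label D (alpha D x0) i q \in H.
  by case: i => [m|j|j] //= [_ [jn _ _ _]]; case: ifP => // _; exact: Ha.
pose J := [set k : option piece | exists k', k = Some k'].
have trA i j r (hi : cover D i r) (hj : cover D j r) : J i -> J j -> tr x0 hi hj \in H.
  by move=> [k ek] [l el]; subst i j; rewrite tr_label; apply: HD; exact: labH.
have [hS hL] := far_base_charts D x0.
have trL i r (hr : UL D r) (hi : chart D i r) :
    @tr _ _ _ D x0 None (Some i) r hr hi \in H.
  have [|f fP] := @far_base_joined r; first by split=> //; case: hi.
  have fH : @clam _ _ _ D x0 (Some (Strip n)) (Some i) _ _ hS hi f \in H.
    apply: (lam_closed (@cover_open R n F D) (J := J) Hg trA); last 2 first.
    - by exists (Strip n).
    - by exists i.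
    by move=> t; have [_ /chart_cover[k kt]] := fP t; exists (Some k) => //; exists k.
  move: fH; rewrite /clam (lam_trans (i := Some (Strip n)) (j := Some i) (k := None)
    _ _ hS hi hL hr (fun t => (fP t).1)).
  by rewrite [X in (X * _)%g](tr_far_base hS hL) mul1g.
have HV := group_closedV Hg.
have trH i j r (hi : cover D i r) (hj : cover D j r) : setT i -> setT j -> tr x0 hi hj \in H.
  move=> _ _; case: i hi => [i|] hi; case: j hj => [j|] hj.
  - by apply: trA; [exists i|exists j].
  - by rewrite /tr -transV; apply: HV; exact: trL.
  - exact: trL.
  - by rewrite /tr trans_refl.
move=> a; rewrite -(loop_class_repr a); set f := repr a.
have [i ix] := cover_all D x0.
pose th := tether (@cover_contracts R n F D x0) (tau D x0) ix.
have <- : @clam _ _ _ D x0 i i _ _ ix ix (concat (path_rev th) (concat f th)) = loop_class f.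
  exact: tethered_class_conj.
apply: (lam_closed (@cover_open R n F D) (J := setT) Hg trH) => // t.
by have [k kt] := cover_all D (concat (path_rev th) (concat f th) t); exists k.
Qed.

End FarConnected.

(** * Meridians *)

Section Meridian.
Variables (R : realType) (n : nat).
Local Notation C := (Cplx R).
Variables (F : 'I_n -> mpoly 3 C) (D : conic_frame F).
Local Notation X := (complement F).
Variable x0 : X.
Local Notation path a b := {path I01 R from a to b in X}.
Local Notation c := (cf_c D).
Local Notation M := (cf_M D).
Local Notation chart := (chart D).
Local Notation alpha := (alpha D x0).
Local Notation label := (label D alpha).

Variable j : 'I_n.

(** With [loop_b], the circle of radius 1/2 around the puncture, counterclockwise from its lowest
    point: it starts in [Strip j] and crosses the cut upwards after a quarter turn. *)
Definition loop_a (v : R) : R := complex.Re (c j) + 2^-1 * sinT v.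
Definition loop_b (v : R) : R := (nat_of_ord j)%:R - 2^-1 * cosT v.

Lemma sinT_le1 (v : R) : `|sinT v| <= 1 :> R.
Proof. by rewrite ler_norml sin_geN1 sin_le1. Qed.

Lemma cosT_le1 (v : R) : `|cosT v| <= 1 :> R.
Proof. by rewrite ler_norml cos_geN1 cos_le1. Qed.

Lemma loop_b_band (v : R) : (nat_of_ord j)%:R - 1 < loop_b v < (nat_of_ord j)%:R + 1.
Proof. by have := cosT_le1 v; rewrite /loop_b ler_norml => ?; lra. Qed.

Lemma loop_safe (v : R) : safe D (loop_a v) (loop_b v).
Proof.
move=> i; apply/eqP => /unshear_eq[ea eb].
have /andP[b1 b2] := loop_b_band v; rewrite eb in b1 b2.
have ij : i = j by apply: val_inj; exact: nat_between b1 b2.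
move: ea eb; rewrite ij /loop_a /loop_b => ea eb.
have s0 : sinT v = 0 by lra.
have c0 : cosT v = 0 by lra.
by have := cosT2_sinT2 v; rewrite s0 c0 expr0n addr0 => /eqP; rewrite eq_sym oner_eq0.
Qed.

(** The circle stays where [psi] is constant, so it is round in the coordinate [t] too. *)
Lemma loop_unshear (t : I01 R) : unshear D (loop_a (I01_val t)) (loop_b (I01_val t)) =
  c j + unit_circle t * (0 -i* 2^-1)%C.
Proof.
have := sinT_le1 (I01_val t); rewrite ler_norml => /andP[h1 h2].
rewrite /unshear (@psi_near _ _ _ D j); last first.
  by rewrite /loop_a addrC addKr ler_norml; lra.
rewrite unit_circleE /loop_a /loop_b; case: (c j) => u w.
by apply/eqP; rewrite eq_complex /=; apply/andP; split; apply/eqP; ring.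
Qed.

Definition small_loop_fun (t : I01 R) : X :=
  pA D x0 0 (loop_a (I01_val t)) (loop_b (I01_val t)).

Lemma small_loop_continuous : continuous small_loop_fun.
Proof.
move=> t; have cv := @I01_val_continuous R t.
have cs : {for t, continuous (fun t : I01 R => sinT (I01_val t))}.
  by apply: (@continuous_comp _ _ _ (@I01_val R) (@sinT R)); [exact: cv|exact: sinT_continuous].
have cc : {for t, continuous (fun t : I01 R => cosT (I01_val t))}.
  by apply: (@continuous_comp _ _ _ (@I01_val R) (@cosT R)); [exact: cv|exact: cosT_continuous].
have cst_ (r : R) : {for t, continuous (cst r : I01 R -> R)} by exact: cst_continuous.
have c0 : {for t, continuous (cst 0 : I01 R -> C)} by exact: cst_continuous.
exact: (pA_continuous c0 (continuousD (cst_ _) (continuousM (cst_ _) cs))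
  (continuousB (cst_ _) (continuousM (cst_ _) cc)) (loop_safe (I01_val t))).
Qed.

Definition small_loop_base : X := small_loop_fun zero.

Lemma small_loop_one : small_loop_fun one = small_loop_base.
Proof.
by rewrite /small_loop_base /small_loop_fun /loop_a /loop_b I01_val_zero I01_val_one
  cosT0 cosT1 sinT0 sinT1.
Qed.

Definition small_loop : path small_loop_base small_loop_base :=
  mk_path small_loop_continuous erefl small_loop_one.

Lemma small_loop_coords t : [/\ inA D (small_loop t),
  aA D (small_loop t) = loop_a (I01_val t) & bA D (small_loop t) = loop_b (I01_val t)].
Proof. by have [h1 h2 h3 h4] := pA_A x0 0 (loop_safe (I01_val t)). Qed.

Lemma small_loop_Strip_below t : 0 < cosT (I01_val t) -> chart (Strip j) (small_loop t).
Proof.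
have [h1 h2 h3] := small_loop_coords t => c0; split=> //=; rewrite h3 /loop_b.
have := cosT_le1 (I01_val t); rewrite ler_norml => /andP[h4 h5].
by split; [exact/ltnW|move=> _; lra|move=> _; lra].
Qed.

Lemma small_loop_Strip_above t : cosT (I01_val t) < 0 -> chart (Strip j.+1) (small_loop t).
Proof.
have [h1 h2 h3] := small_loop_coords t => c0; split=> //=; rewrite h3 /loop_b.
have := cosT_le1 (I01_val t); rewrite ler_norml => /andP[h4 h5].
by split=> // _; rewrite -(natr1 j); lra.
Qed.

Lemma small_loop_Rgt t : 0 < sinT (I01_val t) -> chart (Rgt j) (small_loop t).
Proof.
have [h1 h2 h3] := small_loop_coords t => s0; split=> //=; rewrite h3 h2.
have /andP[b1 b2] := loop_b_band (I01_val t).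
by split=> //; rewrite abscissa_ord /loop_a; lra.
Qed.

Lemma small_loop_Lft t : sinT (I01_val t) < 0 -> chart (Lft j) (small_loop t).
Proof.
have [h1 h2 h3] := small_loop_coords t => s0; split=> //=; rewrite h3 h2.
have /andP[b1 b2] := loop_b_band (I01_val t).
by split=> //; rewrite abscissa_ord /loop_a; lra.
Qed.

Lemma small_loop_base_Strip : chart (Strip j) small_loop_base.
Proof.
rewrite -(@path_zero _ _ _ _ small_loop); apply: small_loop_Strip_below.
by rewrite I01_val_zero cosT0.
Qed.

Lemma small_loop_class :
  @clam _ _ _ D x0 (Some (Strip j)) (Some (Strip j)) _ _
    small_loop_base_Strip small_loop_base_Strip small_loop = alpha j.
Proof.
(* A lift of the circle: it jumps at 1/4, where the cut is crossed inside [Rgt j]; the strict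
   inequality matches the large one in [label]. *)
pose K (t : I01 R) : pi1 R x0 := if I01_val t < 4^-1 then 1%g else alpha j.
suff loc t : exists i, chart i (small_loop t) /\
    \forall u \near t, (K u / label i (small_loop u) = K t / label i (small_loop t))%g.
  rewrite (clam_label loc) /K I01_val_zero I01_val_one invr_gt0 ltr0n ifF; last first.
    by apply/negbTE; rewrite -leNgt; lra.
  by rewrite /= !divg1 mul1g.
have /andP[t0 t1] := I01_bounds t.
have [h|h|h] := ltgtP (I01_val t) 4^-1.
- exists (Strip j); split; first by apply/small_loop_Strip_below/cosT_gt0; lra.
  by apply: filterS (near_I01_lt h) => u hu; rewrite /K h hu.
- have high i : (forall u, label i (small_loop u) = 1%g) ->
      \forall u \near t, (K u / label i (small_loop u) = K t / label i (small_loop t))%g.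
    move=> l1; apply: filterS (near_I01_gt h) => u hu.
    by rewrite /K !l1 !ltNge !ltW //; lra.
  have [h'|h'|h'] := ltgtP (I01_val t) (3 / 4).
  + by exists (Strip j.+1); split; [apply/small_loop_Strip_above/cosT_lt0; lra|exact: high].
  + by exists (Strip j); split; [apply/small_loop_Strip_below/cosT_gt0_right; lra|exact: high].
  + by exists (Lft j); split; [apply/small_loop_Lft/sinT_lt0; lra|exact: high].
- exists (Rgt j); split; first by apply/small_loop_Rgt/sinT_gt0; lra.
  have n1 : \forall u \near t, - 4^-1 < I01_val u by apply: near_I01_gt; lra.
  have n2 : \forall u \near t, I01_val u < 3 / 4 by apply: near_I01_lt; lra.
  have E u : - 4^-1 < I01_val u -> I01_val u < 3 / 4 ->
      (K u / label (Rgt j) (small_loop u) = 1)%g.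
    move=> u1 u2; have [_ _ eb] := small_loop_coords u.
    rewrite /K /= eb /loop_b.
    have [hu|hu|hu] := ltgtP (I01_val u) 4^-1.
    - have c0 : 0 < cosT (I01_val u) by apply: cosT_gt0; lra.
      by rewrite ifF ?divg1 //; apply/negbTE; rewrite -ltNge; lra.
    - have c0 : cosT (I01_val u) < 0 by apply: cosT_lt0; lra.
      by rewrite ifT ?mulgV //; lra.
    - have c0 : cosT (I01_val u) = 0.
        rewrite hu /cosT; have -> : 2 * pi * 4^-1 = pi / 2 :> R by field.
        exact: cos_pihalf.
      by rewrite c0 ifT ?mulgV //; lra.
  by apply: filterS2 n1 n2 => u u1 u2; rewrite !E //; lra.
Qed.

Definition node : 'rV[C]_3 := cvec 0 (c j) 1 *m M.
Definition node_direction : 'rV[C]_3 := cvec 0 (0 -i* 2^-1)%C 0 *m M.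

Lemma node_line (z : C) : node + z *: node_direction = cvec 0 (c j + z * (0 -i* 2^-1)%C) 1 *m M.
Proof. by rewrite /node /node_direction scalemxAl -mulmxDl cvecZ cvecD !mulr0 !addr0. Qed.

(** On the disc the real part of [t] moves by at most 1/2, while the other constants have real parts
    at distance at least 4. *)
Lemma node_line_off (z : C) : 0 < `|z| <= 1 ->
  off_conics c 0 (c j + z * (0 -i* 2^-1)%C) 1.
Proof.
move=> /andP[z0 z1] i; rewrite mulr1 expr0n addr0 expr1n mulr1 subr_eq0; apply/eqP.
have {}z0 : z != 0 by rewrite -normr_gt0.
have [->|ij] := eqVneq i j.
  move/eqP; rewrite -subr_eq0 addrC addKr mulf_eq0 (negbTE z0) /= eq_complex /=.
  by rewrite oppr_eq0 invr_eq0 pnatr_eq0 andbF.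
move=> e; have := cf_sep D ij.
have -> : complex.Re (c i) - complex.Re (c j) = 2^-1 * complex.Im z.
  rewrite -e; case: (c j) => u v; case: z {z0 z1 e} => a b /=; ring.
have iz : `|complex.Im z| <= 1.
  have := normc_ge_Re (z * 'i%C); rewrite normrM.
  have -> : `|'i%C : R[i]| = 1.
    by rewrite normc_def /= expr0n expr1n add0r sqrtr1.
  rewrite mulr1 => /le_trans/(_ z1); rewrite lecR -(normrN (complex.Re _)) -ImE.
  exact.
rewrite normrM (@ger0_norm _ 2^-1) ?invr_ge0 ?ler0n //; lra.
Qed.

Lemma diff3_frame (i : 'I_n) (x y z x' y' z' : C) :
  diff3 (F i) (cvec x y z *m M) (cvec x' y' z' *m M) =
  cf_a D i * (y * z' + y' * z + 2 * x * x' - 2 * c i * z * z').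
Proof.
have F2 := cf_F2 D i.
have := eval3D F2 (cvec x y z *m M) (cvec x' y' z' *m M).
rewrite -mulmxDl cvecD !(cf_FE D) => e.
apply: (addrI (cf_a D i * (y * z + x ^+ 2 - c i * z ^+ 2) +
  cf_a D i * (y' * z' + x' ^+ 2 - c i * z' ^+ 2))).
by rewrite -e; ring.
Qed.

Lemma diff3_prod (I : finType) (G : I -> mpoly 3 C) (k : I) v w :
  eval3 (G k) v = 0 ->
  diff3 (\prod_i G i) v w = diff3 (G k) v w * \prod_(i | i != k) eval3 (G i) v.
Proof.
move=> Gk; rewrite (bigD1 k) //= diff3M Gk mul0r addr0; congr (_ * _).
by rewrite /eval3 rmorph_prod.
Qed.

(** By the product rule only the [j]-th factor is differentiated at the node, and no other conic
    passes there. The factor [k] covers all coordinates of the point, as [singular_locus] allows any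
    of them. *)
Lemma diff3_node (k : C) : k != 0 ->
  diff3 (\prod_i F i) (k *: node) node_direction != 0.
Proof.
move=> k0; rewrite /node /node_direction scalemxAl cvecZ mulr0 mulr1.
rewrite (@diff3_prod _ _ j); last by rewrite (cf_FE D); ring.
rewrite mulf_neq0 //.
  rewrite diff3_frame !mulf_neq0 ?(cf_a_neq0 D) //.
  rewrite !mulr0 subr0 addr0 add0r mulf_neq0 // eq_complex /=.
  by rewrite oppr_eq0 invr_eq0 pnatr_eq0 andbF.
apply/prodf_neq0 => i ij; rewrite (cf_FE D) mulf_neq0 ?(cf_a_neq0 D) //.
have -> : k * c j * k + 0 ^+ 2 - c i * k ^+ 2 = k ^+ 2 * (c j - c i) by ring.
rewrite mulf_neq0 ?expf_neq0 // subr_eq0; apply/eqP => e.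
by have := cf_sep D ij; rewrite e subrr normr0; lra.
Qed.

Lemma alpha_meridian : meridian j (alpha j).
Proof.
have node0 : node != 0.
  by rewrite mulmxM_eq0 ?(cf_unit D) // cvec_eq0 oner_eq0 !andbF.
have [p pv] := coords_exists node0.
exists p, node, node_direction, small_loop_base,
  (tether (@cover_contracts R n F D x0) (tau D x0)
     (small_loop_base_Strip : cover D (Some (Strip j)) small_loop_base)), small_loop.
split=> //.
- split; first by exists node => //; rewrite /node (cf_FE D); ring.
  move=> [v pv' [_ dv]]; have [k k0 e] := coords_unique pv pv'.
  have := diff3_node k0; rewrite -e /diff3 big1 ?eqxx // => i _.
  by rewrite dv mul0r.
- by have := diff3_node (oner_neq0 C); rewrite scale1r.
- move=> z z1; rewrite node_line.
  exact: (off_conics_point (cf_n_ge1 D) (cf_F2 D) (cf_unit D) (cf_a_neq0 D) (cf_FE D)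
    (node_line_off z1)).
- split.
    move=> t; rewrite node_line -loop_unshear.
    set u := unshear _ _ _.
    have -> : u = u - 0 ^+ 2 by rewrite expr0n subr0.
    exact: (ptP x0 (pA_off 0 (loop_safe (I01_val t)))).
  rewrite -small_loop_class /clam /lam /tethered_class.
  by apply/loop_classP; exact: homotopic_assoc.
Qed.

End Meridian.

(** * Retraction onto the presented group *)

Lemma word_eval_pgen (S : choiceType) (rels : set (word S)) (w : word S) :
  word_eval (pgen rels) w = word_class rels w.
Proof.
elim: w => [|[s b] w IH]; first by rewrite /word_eval big_nil.
rewrite /word_eval big_cons [(\prod_(l <- w) _)%g]IH -cat1s -pg_mulE.
by congr (_ * _)%g; case: b => //=; rewrite [LHS]pg_invE.
Qed.

Section Retraction.
Variables (R : realType) (n : nat).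
Local Notation C := (Cplx R).
Variables (F : 'I_n -> mpoly 3 C) (D : conic_frame F).
Local Notation X := (complement F).
Variable x0 : X.
Local Notation chart := (chart D).
Variables (Gamma : groupType) (gamma : nat -> Gamma).
Hypothesis gamma_rel : (prefix_prod gamma n * prefix_prod gamma n = 1)%g.

Definition cover_label (i : option piece) : X -> Gamma :=
  if i is Some k then label D gamma k else labelL D gamma.

Lemma cover_label_compat i j x : cover D i x -> cover D j x ->
  \forall y \near x,
    (cover_label i y / cover_label j y = cover_label i x / cover_label j x)%g.
Proof.
case: i => [i|] ix; case: j => [j|] jx /=.
- exact: label_compat.
- apply: filterS (labelL_compat jx ix (or_introl gamma_rel)) => y.
  by move=> /(congr1 (fun g => g^-1)%g); rewrite !invgF.
- exact: labelL_compat jx (or_introl gamma_rel).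
- by apply: filterE => y; rewrite !mulgV.
Qed.

Definition cover_monodromy (a : pi1 R x0) : Gamma :=
  monodromy (@cover_open R n F D) (@cover_all R n F D) cover_label_compat a.

(** The factor, one per chart, by which the monodromy of a transition is twisted relative to the
    quotient of labels. *)
Definition cover_gauge (i : option piece) : Gamma :=
  (hol (@cover_open R n F D) (@cover_all R n F D) cover_label_compat (tau D x0 i) /
   cover_label i (cover_center D x0 i))%g.

Lemma cover_monodromy_tr i j p (hi : cover D i p) (hj : cover D j p) :
  cover_monodromy (tr x0 hi hj) =
  (cover_gauge i * (cover_label i p / cover_label j p) / cover_gauge j)%g.
Proof. exact: monodromy_trans. Qed.

Lemma cover_monodromy1 : cover_monodromy 1%g = 1%g.
Proof.
by apply: (mulgI (cover_monodromy 1%g)); rewrite -[LHS]monodromyM !mulg1.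
Qed.

(** With the transition and both labels trivial, [cover_monodromy_tr] reduces to the quotient of the
    two gauges. *)
Lemma cover_gauge_edge i j p (hi : cover D i p) (hj : cover D j p) :
  tr x0 hi hj = 1%g -> cover_label i p = 1%g -> cover_label j p = 1%g ->
  cover_gauge i = cover_gauge j.
Proof.
move=> e li lj; have := cover_monodromy_tr hi hj.
by rewrite e cover_monodromy1 li lj divg1 mulg1 => /esym/divg1_eq.
Qed.

Lemma cover_gauge_strip m : (m <= n)%N ->
  cover_gauge (Some (Strip m)) = cover_gauge (Some (Strip 0)).
Proof.
elim: m => // m IH mn; rewrite -(IH (ltnW mn)).
have [h2 h3] := strip_center_Lft D x0 mn.
have h1 := strip_center D x0 (ltnW mn); have h4 := strip_center D x0 mn.
rewrite (@cover_gauge_edge (Some (Strip m)) (Some (Lft m)) _ h1 h2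
  (tr_Strip_Lft x0 h1 h2) erefl erefl).
by rewrite (@cover_gauge_edge (Some (Lft m)) (Some (Strip m.+1)) _ h3 h4
  (tr_Lft_Strip x0 h3 h4) erefl erefl).
Qed.

Lemma cover_monodromy_alpha j : (j < n)%N -> cover_monodromy (alpha D x0 j) =
  (cover_gauge (Some (Strip 0)) * gamma j / cover_gauge (Some (Strip 0)))%g.
Proof.
move=> jn; have [a1 a2] := right_above_charts D x0 jn.
have [b1 b2] := right_below_charts D x0 jn.
rewrite -(tr_Rgt_Strip x0 a1 a2) cover_monodromy_tr (cover_gauge_strip jn).
have bE (s : R) : region D (Rgt j) (wide D, s) -> bA D (pA D x0 0 (wide D) s) = s.
  by move=> /region_safe/(pA_A x0 0)[].
have /andP[_ wj] := abscissa_wide D j.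
have e1 : label D gamma (Rgt j) (right_above D x0 j) = gamma j.
  rewrite /= bE ?ifT //=; last by split=> //; lra.
  lra.
have e2 : label D gamma (Rgt j) (right_below D x0 j) = 1%g.
  rewrite /= bE ?ifF //=; last by split=> //; lra.
  by apply/negbTE; rewrite -ltNge; lra.
rewrite /= -[(if _ then _ else _)]/(label D gamma (Rgt j) (right_above D x0 j)) e1 divg1.
have := @cover_gauge_edge (Some (Strip j)) (Some (Rgt j)) _ b1 b2 (tr_Strip_Rgt x0 b1 b2) erefl e2.
by rewrite (cover_gauge_strip (ltnW jn)) => ->.
Qed.

(** All strips share one gauge, so each [alpha j] has as monodromy [gamma j] conjugated by the same
    element; this undoes the conjugation. *)
Definition retraction (a : pi1 R x0) : Gamma :=
  ((cover_gauge (Some (Strip 0)))^-1 * cover_monodromy a * cover_gauge (Some (Strip 0)))%g.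

Lemma retractionM : {morph retraction : a b / a * b}%g.
Proof.
move=> a b; rewrite /retraction [cover_monodromy _]monodromyM.
by move: (cover_gauge _) => w; rewrite -!mulgA mulVKg.
Qed.

Lemma retraction_alpha j : (j < n)%N -> retraction (alpha D x0 j) = gamma j.
Proof.
move=> jn; rewrite /retraction cover_monodromy_alpha //.
by move: (cover_gauge _) => w; rewrite -!mulgA mulKg mulVg mulg1.
Qed.

End Retraction.


(** * The presentation *)

Theorem theorem7 (R : realType) (n : nat) (F : 'I_n -> mpoly.mpoly 3 (Cplx R))
    (n_ge1 : (1 <= n)%N)
    (F_quadric : forall i, quadric (F i))
    (F_distinct : injective (fun i => plane_curve (F i)))
    (F_tangent : exists p : P2 R,
        (forall i, plane_curve (F i) p) /\
        (forall i j, i != j ->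
           plane_curve (F i) `&` plane_curve (F j) = [set p]))
    (x0 : complement F) :
  exists a : 'I_n -> pi1 R x0,
    [/\ forall i, meridian i (a i),
        generates a &
        presents a [set squared_product n]].
Proof.
have [M [a [c [Mu a0 FE sep]]]] :=
  conics_normal_form n_ge1 F_quadric F_distinct F_tangent.
pose D := ConicFrame n_ge1 (fun i => (F_quadric i).1) Mu a0 FE sep.
pose al (i : 'I_n) : pi1 R x0 := alpha D x0 i.
have gen : generates al.
  move=> H Hg Ha; apply: (alpha_generates (D := D) Hg) => j jn.
  exact: (Ha (Ordinal jn)).
exists al; split=> //; first by move=> i; exact: alpha_meridian.
pose rels : set (word 'I_n) := [set squared_product n].
(* The labels are indexed by [nat]; 1 is the default beyond [n]. *)
pose gamma (j : nat) : presented_group rels :=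
  if insub j is Some i then pgen rels i else 1%g.
have gammaE (i : 'I_n) : gamma i = pgen rels i by rewrite /gamma valK.
have prodE : prefix_prod gamma n = (\prod_(i < n) pgen rels i)%g.
  by apply: eq_bigr => i _.
have gamma_rel : (prefix_prod gamma n * prefix_prod gamma n = 1)%g.
  rewrite prodE -word_eval_squared_product word_eval_pgen; apply/word_classP.
  by have := word_eq_rel [::] [::] (erefl : rels (squared_product n)); rewrite cats0.
apply: (@presents_of_retraction _ _ _ _ _ (@retraction _ _ _ D x0 _ _ gamma_rel)) => //.
- by move=> r ->; rewrite word_eval_squared_product; exact: squared_product_trivial.
- exact: retractionM.
- by move=> i; rewrite retraction_alpha // gammaE.
Qed.
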